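(* Let $\lambda=e^{2\pi i\theta}$ with $\theta\in\mathbb{R}\setminus\mathbb{Q}$ chosen such that the maps $z\mapsto \lambda z+z^3$ and $w\mapsto\lambda^{-1}w+w^3$ are both linearizable in a neighborhood of the origin, and let $F:\mathbb{P}^2\to\mathbb{P}^2$ be the holomorphic endomorphism $$F[Z:W:T]=[\lambda ZT^2+Z^3:\ \lambda^{-1}(WT^2+ZW^2)+W^3:\ T^3].$$ Then $F$ has an invariant Fatou component $\Omega$ on which all orbits converge to an embedded punctured disk $D^\star\subset\partial\Omega$, and $F$ acts on $D^\star$ as an irrational rotation.
   Context: The Fatou set of $F$ is the set of points of $\mathbb{P}^2$ having a neighborhood on which the family of iterates $\{F^n\}$ is normal; a Fatou component is a connected component of the Fatou set. A one-variable germ $z\mapsto\mu z+\dots$ at $0$ is linearizable if it is conjugate to $\zeta\mapsto\mu\zeta$ by a local biholomorphic change of coordinates. Saying that on $\Omega$ all orbits converge to a set $S$ means that $S$ is the limit set of $\Omega$: whenever a subsequence $F^{n_j}$ converges uniformly on compact subsets of $\Omega$ to a map $h$, one has $h(\Omega)=S$. A punctured disk is a Riemann surface biholomorphic to $\{\zeta\in\mathbb{C}: 0<|\zeta|<1\}$; $F$ acts on it as an irrational rotation if $F$ maps $D^\star$ to itself and such a biholomorphism conjugates $F|_{D^\star}$ to $\zeta\mapsto e^{2\pi i\tau}\zeta$ with $\tau$ irrational. *)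

(* Defs.v *)
From HB Require Import structures.
From mathcomp Require Import all_boot all_order all_algebra.
From mathcomp Require Import complex.
From mathcomp Require Import ring.
From mathcomp Require Import all_classical all_reals all_analysis.

Set Implicit Arguments.
Unset Strict Implicit.
Unset Printing Implicit Defensive.

Import Order.TTheory GRing.Theory Num.Theory.
Import numFieldNormedType.Exports.

Local Open Scope classical_set_scope.
Local Open Scope quotient_scope.
Local Open Scope ring_scope.

Section ProjectivePlane.
Variable C : numClosedFieldType.

Definition nzvec := {v : 'rV[C]_3 | v != 0}.
HB.instance Definition _ := Choice.on nzvec.

Definition same_line (u v : nzvec) : bool := (val u == val v)%MS.

Lemma same_line_refl : reflexive same_line.
Proof. by move=> u; rewrite /same_line submx_refl. Qed.

Lemma same_line_sym : symmetric same_line.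
Proof. by move=> u v; rewrite /same_line andbC. Qed.

Lemma same_line_trans : transitive same_line.
Proof.
move=> v u w /andP[uv vu] /andP[vw wv].
by rewrite /same_line (submx_trans uv vw) (submx_trans wv vu).
Qed.

Canonical same_line_equiv :=
  EquivRel same_line same_line_refl same_line_sym same_line_trans.

Definition P2 := {eq_quot same_line}.
HB.instance Definition _ := Choice.on P2.
HB.instance Definition _ := EqQuotient.on P2.

Definition P2_of (v : 'rV[C]_3) (nz : v != 0) : P2 := \pi_P2 (exist _ v nz).

(* The orthogonal projector onto the line spanned by v (acting on row vectors).
   It embeds P2 into matrices; the chordal distance so induced provides the
   uniform structure of P2, hence uniform convergence of maps into P2. *)
Definition line_proj (v : 'rV[C]_3) : 'M[C]_3 :=
  \matrix_(i, j) ((v 0 i)^* * v 0 j / \sum_k `|v 0 k| ^+ 2).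

Definition P2_chord (p : P2) : 'M[C]_3 := line_proj (val (repr p)).

HB.instance Definition _ := Uniform.copy P2 (initial_topology P2_chord).

Lemma P2_ofE (p : P2) : p = P2_of (valP (repr p)).
Proof.
rewrite -[LHS]reprK /P2_of; apply: (congr1 \pi_P2).
by apply: val_inj.
Qed.

Lemma P2_of_eq (u v : 'rV[C]_3) (hu : u != 0) (hv : v != 0) :
  P2_of hu = P2_of hv <-> exists2 a : C, a != 0 & u = a *: v.
Proof.
split.
- move=> /eqmodP /= /andP[/= + _] => /sub_rVP[a ua]; exists a => //.
  by apply: contraNneq hu => a0; rewrite ua a0 scale0r.
- move=> [a a0 ua]; apply/eqmodP => /=; rewrite /same_line /= ua.
  by apply/eqmxP; exact: eqmx_scale.
Qed.

Lemma sqnorm_neq0 (v : 'rV[C]_3) : v != 0 -> \sum_k `|v 0 k| ^+ 2 != 0.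
Proof.
apply: contraNneq => /eqP; rewrite psumr_eq0 => [/allP h|k _]; last first.
  by rewrite exprn_ge0.
apply/eqP/rowP => k; rewrite mxE; have := h k (mem_index_enum _).
by rewrite /= sqrf_eq0 normr_eq0 => /eqP.
Qed.

Lemma line_projZ (a : C) (v : 'rV[C]_3) : a != 0 ->
  line_proj (a *: v) = line_proj v.
Proof.
move=> a0; apply/matrixP => i j; rewrite !mxE.
have -> : \sum_k `|(a *: v) 0 k| ^+ 2 = a * a^* * \sum_k `|v 0 k| ^+ 2.
  rewrite mulr_sumr; apply: eq_bigr => k _.
  by rewrite mxE normrM exprMn -!normCK.
have aa0 : a * a^* != 0 by rewrite mulf_neq0// conjC_eq0.
rewrite rmorphM /= [a^* * _ * _]mulrACA [a^* * a]mulrC invfM mulrACA.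
by rewrite divff// mul1r.
Qed.

Lemma P2_chord_of (v : 'rV[C]_3) (nz : v != 0) :
  P2_chord (P2_of nz) = line_proj v.
Proof.
have /P2_of_eq[a a0 e] : P2_of (valP (repr (P2_of nz))) = P2_of nz.
  by rewrite -P2_ofE.
by rewrite /P2_chord e line_projZ.
Qed.

Lemma mul_line_proj (v w : 'rV[C]_3) :
  v *m line_proj w =
  ((\sum_k v 0 k * (w 0 k)^*) / \sum_k `|w 0 k| ^+ 2) *: w.
Proof.
apply/rowP => j; rewrite !mxE mulr_suml mulr_suml; apply: eq_bigr => k _.
by rewrite mxE !mulrA [RHS]mulrAC.
Qed.

Lemma mul_line_projK (v : 'rV[C]_3) : v != 0 -> v *m line_proj v = v.
Proof.
move=> nz; rewrite mul_line_proj.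
rewrite (eq_bigr (fun k => `|v 0 k| ^+ 2)) => [|k _]; last by rewrite normCK.
by rewrite divff ?scale1r ?sqnorm_neq0.
Qed.

Lemma continuous_mx (T : topologicalType) m n (f : T -> 'M[C]_(m.+1, n.+1)) x :
  (forall i j, {for x, continuous (fun t => f t i j)}) -> {for x, continuous f}.
Proof.
move=> h; apply/cvg_ballP => e e0; near=> t.
split=> //; near: t.
apply: filter_forall => i; apply: filter_forall => j.
by have /cvg_ballP/(_ e e0) := h i j.
Unshelve. all: by end_near. Qed.

Lemma continuous_conjC : continuous (fun z : C => z^*).
Proof.
move=> z A /nbhs_ballP[e /= e0 zA].
apply/nbhs_ballP; exists e => //= t zt; apply: zA; move: zt.
by rewrite -!ball_normE /= -rmorphB norm_conjC.
Qed.

Lemma continuous_sum3 (T : topologicalType) (f : 'I_3 -> T -> C) x :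
  (forall k, {for x, continuous (f k)}) ->
  {for x, continuous (fun t => \sum_k f k t)}.
Proof.
move=> fx; rewrite /prop_for /continuous_at !big_ord_recl big_ord0.
under eq_cvg do rewrite !big_ord_recl big_ord0.
exact: (cvgD (fx _) (cvgD (fx _) (cvgD (fx _) (cvg_cst _)))).
Qed.

Lemma continuous_line_proj (v : 'rV[C]_3) : v != 0 ->
  {for v, continuous line_proj}.
Proof.
move=> nz; apply: continuous_mx => i j.
have -> : (fun t : 'rV[C]_3 => line_proj t i j) =
  (fun t => (t 0 i)^* * t 0 j / \sum_k `|t 0 k| ^+ 2).
  by apply/funext => t; rewrite mxE.
have cc k : {for v, continuous (fun t : 'rV[C]_3 => t 0 k)}.
  exact: coord_continuous.
have ccj k : {for v, continuous (fun t : 'rV[C]_3 => (t 0 k)^*)}.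
  by apply: continuous_comp; [exact: cc|exact: continuous_conjC].
have cnum : {for v, continuous (fun t : 'rV[C]_3 => (t 0 i)^* * t 0 j)}.
  exact: (cvgM (ccj i) (cc j)).
have cden : {for v, continuous (fun t : 'rV[C]_3 => \sum_k `|t 0 k| ^+ 2)}.
  apply: continuous_sum3 => k.
  exact: (cvgM (cvg_norm (cc k)) (cvg_norm (cc k))).
have cinv : {for v, continuous (fun t : 'rV[C]_3 => (\sum_k `|t 0 k| ^+ 2)^-1)}.
  exact: (cvgV (sqnorm_neq0 nz) cden).
exact: (cvgM cnum cinv).
Qed.

(* The topology of P2 is the quotient topology of C^3 \ {0}. *)
Lemma open_P2E (U : set P2) :
  open U <-> open [set v : 'rV[C]_3 | exists nz : v != 0, U (P2_of nz)].
Proof.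
split.
- move=> [A oA <-]; rewrite openE => v [nz /= Av].
  rewrite P2_chord_of in Av.
  have nearnz : \forall w \near v, w != 0 :> 'rV[C]_3.
    by apply: (@cvgr_neq0 _ _ _ (nbhs v) _ id) nz; exact: cvg_id.
  have nearA : \forall w \near v, A (line_proj w).
    by apply: (continuous_line_proj nz); exact: open_nbhs_nbhs.
  apply: filterS2 nearnz nearA => w nzw Aw.
  by exists nzw; rewrite /= P2_chord_of.
- move=> oV; rewrite openE => p Up.
  set V := [set v | _] in oV.
  pose v := val (repr p); pose nzv : v != 0 := valP (repr p).
  have Vv : V v by exists nzv; rewrite -P2_ofE.
  have cont : {for line_proj v, continuous (fun M : 'M[C]_3 => v *m M)}.
    apply: continuous_mx => i j.
    have -> : (fun M : 'M[C]_3 => (v *m M) i j) =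
      (fun M => \sum_k v i k * M k j) by apply/funext => M; rewrite mxE.
    apply: continuous_sum3 => k.
    exact: (cvgMr (@coord_continuous _ _ _ _ _ _)).
  have : \forall M \near line_proj v, V (v *m M).
    apply: cont; rewrite /= mul_line_projK //.
    exact: (open_nbhs_nbhs (conj oV Vv)).
  move=> nearV.
  have : \forall q \near p, V (v *m P2_chord q).
    exact: (@initial_continuous P2 'M[C]_3 P2_chord p _ nearV).
  apply: filterS => q [nz].
  rewrite {2}(P2_ofE q).
  suff -> : P2_of nz = P2_of (valP (repr q)) by [].
  apply/P2_of_eq; move: (nz); rewrite /P2_chord mul_line_proj => nz'.
  eexists; last by reflexivity.
  by apply: contraNneq nz' => ->; rewrite scale0r.
Qed.


Definition Flift (lam : C) (v : 'rV[C]_3) : 'rV[C]_3 :=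
  let Z := v 0 0 in let W := v 0 1 in let T := v 0 2 in
  \row_j tnth [tuple lam * Z * T ^+ 2 + Z ^+ 3;
                     lam^-1 * (W * T ^+ 2 + Z * W ^+ 2) + W ^+ 3;
                     T ^+ 3] j.

Lemma Flift_neq0 (lam : C) (v : 'rV[C]_3) : v != 0 -> Flift lam v != 0.
Proof.
apply: contraNneq => e0.
have e (j : 'I_3) : Flift lam v 0 j = 0 by rewrite e0 mxE.
have T0 : v 0 2 = 0.
  by have := e 2; rewrite mxE !(tnth_nth 0) /= => /eqP; rewrite expf_eq0 => /eqP.
have Z0 : v 0 0 = 0.
  have := e 0; rewrite mxE !(tnth_nth 0) /= T0 expr0n mulr0 add0r => /eqP.
  by rewrite expf_eq0 => /eqP.
have W0 : v 0 1 = 0.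
  have := e 1; rewrite mxE !(tnth_nth 0) /= T0 Z0 expr0n mulr0 mul0r addr0.
  by rewrite mulr0 add0r => /eqP; rewrite expf_eq0 => /eqP.
apply/eqP/rowP => j; rewrite mxE.
case: j => -[|[|[|//]]] hj.
- by rewrite -[RHS]Z0; congr (v _ _); exact: val_inj.
- by rewrite -[RHS]W0; congr (v _ _); exact: val_inj.
- by rewrite -[RHS]T0; congr (v _ _); exact: val_inj.
Qed.

Definition Fmap (lam : C) (p : P2) : P2 :=
  P2_of (Flift_neq0 lam (valP (repr p))).

Lemma Fmap_of (lam : C) (v : 'rV[C]_3) (nz : v != 0) :
  Fmap lam (P2_of nz) = P2_of (Flift_neq0 lam nz).
Proof.
have /P2_of_eq[a a0 e] : P2_of (valP (repr (P2_of nz))) = P2_of nz.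
  by rewrite -P2_ofE.
apply/P2_of_eq; exists (a ^+ 3); first by rewrite expf_neq0.
rewrite e; apply/rowP => j; rewrite !mxE !(tnth_nth 0).
by case: j => -[|[|[|//]]] hj /=; ring.
Qed.

End ProjectivePlane.

Section Dynamics.
Variable T : uniformType.
Implicit Types (f h : T -> T) (U Om S : set T).

(* Every sequence of iterates of f has a subsequence that converges uniformly
   on the compact subsets of U. *)
Definition normal_iterates f U :=
  forall n : nat -> nat, exists2 k : nat -> nat,
    {homo k : i j / (i < j)%N} &
    exists h, {family compactly_in U, (fun j => iter (n (k j)) f) @ \oo --> h}.

Definition Fatou_set f : set T :=
  [set x | exists U, [/\ open U, U x & normal_iterates f U]].

Definition Fatou_component f Om :=
  exists2 x, Fatou_set f x & Om = connected_component (Fatou_set f) x.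

Definition is_limit_set f Om S :=
  forall (n : nat -> nat) h, {homo n : i j / (i < j)%N} ->
    {family compactly_in Om, (fun j => iter (n j) f) @ \oo --> h} ->
    h @` Om = S.

End Dynamics.

Section Holomorphic.
Variable C : numClosedFieldType.

(* mu z + ... is linearizable at 0: phi (with inverse psi) is the local
   biholomorphic change of coordinates. *)
Definition linearizable (f : C -> C) (mu : C) :=
  exists phi psi : C -> C,
    [/\ phi 0 = 0 /\ psi 0 = 0,
        \forall z \near (0 : C), derivable phi z 1 /\ derivable psi z 1,
        \forall z \near (0 : C), psi (phi z) = z /\ phi (psi z) = z &
        \forall z \near (0 : C), phi (f z) = mu * phi z].

Definition punctured_unit_disk : set C := [set z | 0 < `|z| < 1].

(* g is a local holomorphic lift of psi to C^3 \ {0}; the rank condition says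
   that the differential of psi at z is injective. *)
Definition immersive_at (psi : C -> P2 C) (z : C) :=
  exists g : C -> 'rV[C]_3,
    (\forall w \near z,
       derivable g w 1 /\ exists nz : g w != 0, psi w = P2_of nz) /\
    \rank (col_mx (g z) ('D_1 g z)) = 2%N.

(* The last condition makes psi a homeomorphism from A onto its image. *)
Definition holomorphic_embedding (A : set C) (psi : C -> P2 C) :=
  [/\ forall z, A z -> immersive_at psi z,
      {in A &, injective psi} &
      forall U, open U -> U `<=` A ->
        exists2 V, open V & psi @` U = V `&` psi @` A].

Definition parametrizes_punctured_disk (psi : C -> P2 C) (D : set (P2 C)) :=
  holomorphic_embedding punctured_unit_disk psi /\
  psi @` punctured_unit_disk = D.

Definition embedded_punctured_disk (D : set (P2 C)) :=
  exists psi, parametrizes_punctured_disk psi D.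

End Holomorphic.

Local Open Scope complex_scope.

Definition expi2pi (R : realType) (x : R) : R[i] :=
  cos (2 * pi * x) +i* sin (2 * pi * x).

Definition acts_as_irrational_rotation (R : realType)
    (F : P2 R[i] -> P2 R[i]) (D : set (P2 R[i])) :=
  F @` D `<=` D /\
  exists (psi : R[i] -> P2 R[i]) (tau : R),
    [/\ parametrizes_punctured_disk psi D, irrational tau &
        forall z, punctured_unit_disk z -> F (psi z) = psi (expi2pi tau * z)].

(* Main.v *)
Require Import Defs.
From mathcomp Require Import all_boot all_order all_algebra.
From mathcomp Require Import complex.
From mathcomp Require Import ring lra zify.
From mathcomp Require Import all_classical all_reals all_analysis.

Set Implicit Arguments.
Unset Strict Implicit.
Unset Printing Implicit Defensive.

Import Order.TTheory GRing.Theory Num.Theory.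
Import numFieldNormedType.Exports.

(** Let [p z = lam * z + z ^+ 3] and [q z w = lam^-1 * (w + z * w ^+ 2) + w ^+ 3].
In the affine chart [z : w : 1] the map is the skew product
[(z, w) |-> (p z, q z w)], which has multipliers [lam] and [lam^-1] at the
origin.

Near the origin let [phi] and [chi] be the linearizing coordinates of [p] and
[q 0].  The multipliers cancel in the product [U = phi z * chi w], and the
resonant term [z * w ^+ 2] turns its evolution into [U' = U * (1 + U * Y)] with
[Y] close to 1.  So [X = - 1 / U] moves by steps close to 1.  A point with [w]
close to [- conj z] starts with [X] close to the positive number [1 / |z|^2];
then [X] goes to infinity like [n] and [w] tends to 0 like [1 / n]
([basin_orbit], [basin_start]), while [z] turns around the origin as under a
rotation.  Since the iterates of [p] are as close to each other as the
corresponding powers of [lam], such points belong to the Fatou set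
([basin_Fatou]).

Let [Om] be the Fatou component of these points.  Near a Fatou point bounded
and escaping orbits cannot coexist, so [Om] consists of points with bounded
orbits ([Om_Kset]) and lies in the chart.  Openness of the map and compactness
give [F @` Om = Om] ([F_Om]).  The orbits in [Om] being bounded, the convergence
of [w] to 0 spreads to all of [Om] by Vitali's principle ([Om_wzero]).  This
keeps [Om] away from the axis [w = 0], where the derivative of the n-th iterate
in [w] has modulus 1 ([Om_not_axis]), and from the fibre [z = 0], where [q 0]
is conjugate to a rotation ([Om_not_fiber0]).

The projection of [Om] to the [z] coordinate, completed by 0, is a bounded
connected open set that [p] preserves, and there [p] is conjugate to the
rotation by [lam] of a full round disc ([siegel_disk]).  Removing the centre
gives a punctured disc [D] in the axis on which the map is an irrational
rotation.  If [lam ^+ n_j] tends to [l], then the iterates of order [n_j] tend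
on [Om] to the projection to the axis followed by the rotation by [l], whose
image is [D] ([limit_set_disk]); choosing [l = 1] shows that [D] is in the
closure of [Om] ([disk_boundary]).

The function theory behind this rests on averages instead of integrals.  A
function is treated as holomorphic when it is locally a uniform limit of
polynomials ([approx]); the integral over a circle is replaced by the limit of
the Cesaro means along the orbit of a point of that circle under the rotation
by [lam] ([mean], [fc]).  On polynomials this computes the coefficients
([fc_poly]), which yields Cauchy's estimates, Taylor expansions, the identity
theorem and the maximum principle.  The same means applied to the iterates of
[p] produce the linearizing coordinate [phi] and the power series of its
inverse ([cm], [bcoef]). *)

Local Open Scope classical_set_scope.
Local Open Scope ring_scope.
Local Open Scope complex_scope.

(** * The modulus of a complex number *)

Section Modulus.
Variable R : realType.
Implicit Types (x y z : R[i]) (r : R).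

(** The modulus as an element of [R], where the order is total; [`|z|] itself lives in [R[i]]. *)
Definition modc z : R := complex.Re `|z|.

Lemma modcE z : `|z| = (modc z)%:C.
Proof. by rewrite /modc normc_def. Qed.

Lemma modc_ge0 z : 0 <= modc z.
Proof. by rewrite -ler0c -modcE. Qed.

Lemma modc0 : modc 0 = 0.
Proof. by rewrite /modc normr0. Qed.

Lemma modc1 : modc 1 = 1.
Proof. by rewrite /modc normr1. Qed.

Lemma modc_eq0 z : (modc z == 0) = (z == 0).
Proof. by rewrite -[RHS]normr_eq0 modcE (inj_eq (@complexI R)). Qed.

Lemma modc_gt0 z : (0 < modc z) = (z != 0).
Proof. by rewrite lt_neqAle modc_ge0 andbT eq_sym modc_eq0. Qed.

Lemma modcM x y : modc (x * y) = modc x * modc y.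
Proof. by apply: (@complexI R); rewrite rmorphM /= -!modcE normrM. Qed.

Lemma modcX z n : modc (z ^+ n) = modc z ^+ n.
Proof. by apply: (@complexI R); rewrite rmorphXn /= -!modcE normrX. Qed.

Lemma modcV z : modc z^-1 = (modc z)^-1.
Proof. by apply: (@complexI R); rewrite fmorphV /= -!modcE normfV. Qed.

Lemma modcN z : modc (- z) = modc z.
Proof. by rewrite /modc normrN. Qed.

Lemma modcB x y : modc (x - y) = modc (y - x).
Proof. by rewrite /modc distrC. Qed.

Lemma modcD x y : modc (x + y) <= modc x + modc y.
Proof. by rewrite -lecR rmorphD /= -!modcE ler_normD. Qed.

Lemma modc_sub x y : modc (x - y) <= modc x + modc y.
Proof. by rewrite -(modcN y) modcD. Qed.

Lemma modc_real r : modc r%:C = `|r|.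
Proof. by rewrite /modc normc_def /= expr0n addr0 sqrtr_sqr. Qed.

Lemma modc_conj z : modc (conjc z) = modc z.
Proof. by rewrite /modc normcJ. Qed.

Lemma modc_nat n : modc n%:R = n%:R.
Proof. by rewrite -[n%:R](rmorph_nat (real_complex R)) modc_real normr_nat. Qed.

Lemma modc_dist x y : `|modc x - modc y| <= modc (x - y).
Proof.
have h1 := modcD (x - y) y; have h2 := modcD (y - x) x.
rewrite !subrK (modcB y x) in h1 h2.
by rewrite ler_norml; apply/andP; split; lra.
Qed.

Lemma modc_triangle x y z : modc (x - z) <= modc (x - y) + modc (y - z).
Proof. by have := modcD (x - y) (y - z); rewrite addrA subrK. Qed.

Lemma modc_sum (I : Type) (s : seq I) (P : pred I) (f : I -> R[i]) :
  modc (\sum_(i <- s | P i) f i) <= \sum_(i <- s | P i) modc (f i).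
Proof.
elim/big_ind2: _ => //; first by rewrite modc0.
by move=> x1 x2 y1 y2 h1 h2; apply: (le_trans (modcD _ _)); apply: lerD.
Qed.

Lemma modc_Re z : `|complex.Re z| <= modc z.
Proof. by rewrite -lecR -modcE normc_ge_Re. Qed.

Lemma modc_Im z : `|complex.Im z| <= modc z.
Proof.
rewrite /modc normc_def /= -sqrtr_sqr ler_wsqrtr //.
by rewrite lerDr sqr_ge0.
Qed.

Lemma modc_ReIm z : modc z <= `|complex.Re z| + `|complex.Im z|.
Proof.
rewrite {1}(complexE z); apply: (le_trans (modcD _ _)).
by rewrite modcM !modc_real /modc normc_def /= expr0n expr1n add0r sqrtr1 mul1r.
Qed.

Lemma modc_le_eps x y : (forall e, 0 < e -> modc (x - y) <= e) -> x = y.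
Proof.
move=> h; apply/eqP; rewrite -subr_eq0 -modc_eq0 eq_le modc_ge0 andbT.
by apply/ler_addgt0Pl => e e0; rewrite addr0; exact: h.
Qed.

End Modulus.

(** * Limits along an ultrafilter *)

Section UltraLimit.
Variable R : realType.
Variables (T : Type) (G : set_system T).
Context {UG : UltraFilter G}.
Implicit Types (u v : T -> R[i]) (l : R[i]).

(** Limits along a fixed ultrafilter: every bounded family has one, so that no
    subsequence has to be chosen. *)
Definition tends u l := forall e : R, 0 < e -> G [set t | modc (u t - l) <= e].

Lemma ultra_meet (A B : set T) : G A -> G B -> exists t, A t /\ B t.
Proof.
move=> hA hB.
have hI : G (A `&` B) by apply: filterI.
by have [t [At Bt]] := filter_ex hI; exists t.
Qed.

Lemma tends_uniq u l l' : tends u l -> tends u l' -> l = l'.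
Proof.
move=> h h'; apply: modc_le_eps => e e0.
have e2 : 0 < e / 2 by lra.
have [t [/= a b]] := ultra_meet (h _ e2) (h' _ e2).
have := modc_triangle l (u t) l'; rewrite (modcB l (u t)); lra.
Qed.

Lemma tends_cst l : tends (fun=> l) l.
Proof. by move=> e e0; apply: filterE => t /=; rewrite subrr modc0 ltW. Qed.

Lemma tendsD u v l m : tends u l -> tends v m -> tends (fun t => u t + v t) (l + m).
Proof.
move=> h h' e e0; have e2 : 0 < e / 2 by lra.
apply: filterS2 (h _ e2) (h' _ e2) => t /= a b.
have := modcD (u t - l) (v t - m); rewrite addrACA -opprD; lra.
Qed.

Lemma tendsZ u l a : tends u l -> tends (fun t => a * u t) (a * l).
Proof.
move=> h e e0; have a0 := modc_ge0 a.
have e2 : 0 < e / (modc a + 1) by rewrite divr_gt0 //; lra.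
apply: filterS (h _ e2) => t /= b; rewrite -mulrBr modcM.
have a1 : 0 < modc a + 1 by lra.
move: b; rewrite ler_pdivlMr // => b.
have := modc_ge0 (u t - l); nra.
Qed.

Lemma tendsN u l : tends u l -> tends (fun t => - u t) (- l).
Proof.
move=> h e e0; apply: filterS (h _ e0) => t /=.
by rewrite -opprD modcN.
Qed.

Lemma tendsB u v l m : tends u l -> tends v m -> tends (fun t => u t - v t) (l - m).
Proof. by move=> h /tendsN h'; exact: tendsD. Qed.

Lemma tends_le u l (M : R) : G [set t | modc (u t) <= M] -> tends u l -> modc l <= M.
Proof.
move=> hM h; apply/ler_addgt0Pl => e e0.
have [t [/= a b]] := ultra_meet hM (h _ e0).
have := modcD (l - u t) (u t); rewrite subrK (modcB l); lra.
Qed.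

Lemma tends_near u v l :
  (forall e : R, 0 < e -> G [set t | modc (u t - v t) <= e]) ->
  tends v l -> tends u l.
Proof.
move=> h h' e e0; have e2 : 0 < e / 2 by lra.
apply: filterS2 (h _ e2) (h' _ e2) => t /= a b.
have := modc_triangle (u t) (v t) l; lra.
Qed.

Lemma ultra_real_cvg (f : T -> R) (M : R) : G [set t | `|f t| <= M] ->
  exists l : R, forall e : R, 0 < e -> G [set t | `|f t - l| <= e].
Proof.
move=> hM.
pose H : set_system R := [set A | G (f @^-1` A)].
have PH : ProperFilter H.
  by apply: (fmap_proper_filter f).
have HM : H (`[- M, M])%classic.
  suff sub : [set t | `|f t| <= M] `<=` f @^-1` (`[- M, M])%classic.
    by rewrite /H /=; apply: filterS hM.
  by move=> t; rewrite /= in_itv /= -ler_norml.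
have [l [_ cl]] := @segment_compact R (- M) M H PH HM.
exists l => e e0.
have [h|hc] := in_ultra_setVsetC [set t | `|f t - l| <= e] UG; first exact: h.
have hb : nbhs l (ball l e) by exact: nbhsx_ballx.
have [x [/= xl xb]] : (~` [set x | `|x - l| <= e]) `&` ball l e !=set0.
  by apply: (cl _ _ hc hb).
exfalso; apply: xl; move: xb; rewrite -ball_normE /= => xb; rewrite distrC; exact: ltW.
Qed.

Lemma ultra_cvg u (M : R) : G [set t | modc (u t) <= M] -> exists l, tends u l.
Proof.
move=> hM.
have [a ha] : exists l : R, forall e : R, 0 < e -> G [set t | `|complex.Re (u t) - l| <= e].
  apply: (@ultra_real_cvg _ M); apply: filterS hM => t /=.
  exact: le_trans (modc_Re _).
have [b hb] : exists l : R, forall e : R, 0 < e -> G [set t | `|complex.Im (u t) - l| <= e].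
  apply: (@ultra_real_cvg _ M); apply: filterS hM => t /=.
  exact: le_trans (modc_Im _).
exists (a +i* b) => e e0; have e2 : 0 < e / 2 by lra.
apply: filterS2 (ha _ e2) (hb _ e2) => t /= h1 h2.
apply: (le_trans (modc_ReIm _)).
move: h1 h2; case: (u t) => x y /=; lra.
Qed.

End UltraLimit.

(** * Cesaro means *)

Section Mean.
Variable R : realType.
Implicit Types (u v : nat -> R[i]).

Lemma ex_ultra_nat : exists G : set_system nat, UltraFilter G /\ (\oo `<=` G).
Proof. exact: ultraFilterLemma. Qed.

Definition ultra_nat : set_system nat := projT1 (cid ex_ultra_nat).

Global Instance ultra_nat_ultra : UltraFilter ultra_nat.
Proof. by rewrite /ultra_nat; case: cid => G []. Qed.

Lemma ultra_nat_ge N (A : set nat) : (forall n, (N <= n)%N -> A n) -> ultra_nat A.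
Proof.
rewrite /ultra_nat; case: cid => G [/= _ sub] h; apply: sub.
by exists N => //.
Qed.

Lemma tends_eventually u l :
  (forall e : R, 0 < e -> exists N, forall n, (N <= n)%N -> modc (u n - l) <= e) ->
  tends ultra_nat u l.
Proof. by move=> h e /h [N hN]; apply: (@ultra_nat_ge N). Qed.

Lemma harmonic_small (c e : R) : 0 < e ->
  exists N, forall n, (N <= n)%N -> c / n.+1%:R <= e.
Proof.
move=> e0; exists (Num.bound (`|c| / e)) => n hn.
rewrite ler_pdivrMr ?ltr0n //.
have h0 : 0 <= `|c| / e by rewrite divr_ge0 // ltW.
have := archi_boundP h0; rewrite ltr_pdivrMr // => h.
apply: (le_trans (ler_norm c)); apply: (le_trans (ltW h)).
by rewrite mulrC ler_pM2l // ler_nat; apply: (leq_trans hn).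
Qed.

Definition avg u n : R[i] := (\sum_(i < n.+1) u i) / n.+1%:R.

Definition bdd u := exists M : R, forall n, modc (u n) <= M.

(** A limit of the Cesaro means along a fixed free ultrafilter. It is linear,
    bounded and shift invariant, and it kills [mu ^+ n] for every [mu] of modulus 1
    other than 1: along orbits of a rotation it does the work of the normalized
    integral over a circle. *)
Definition mean u : R[i] := xget 0 [set l | tends ultra_nat (avg u) l].

Lemma modc_avg u (v : nat -> R) n :
  (forall n, modc (u n) <= v n) -> modc (avg u n) <= (\sum_(i < n.+1) v i) / n.+1%:R.
Proof.
move=> h; rewrite /avg modcM modcV modc_nat ler_pM2r ?invr_gt0 ?ltr0n //.
by apply: (le_trans (modc_sum _ _ _)); apply: ler_sum => i _.
Qed.

Lemma avg_bound u (M : R) n : (forall n, modc (u n) <= M) -> modc (avg u n) <= M.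
Proof.
move=> h; have := @modc_avg u (fun=> M) n h.
by rewrite sumr_const card_ord -(mulr_natr M) mulfK // pnatr_eq0.
Qed.

Lemma mean_eq u l : tends ultra_nat (avg u) l -> mean u = l.
Proof.
move=> h; rewrite /mean; case: xgetP => [m _ /= hm|/(_ l)//].
exact: tends_uniq hm h.
Qed.

Lemma meanP u : bdd u -> tends ultra_nat (avg u) (mean u).
Proof.
move=> [M hM]; have [l hl] : exists l, tends ultra_nat (avg u) l.
  apply: (@ultra_cvg _ _ _ _ _ M); apply: filterE => n /=.
  exact: avg_bound.
by rewrite (mean_eq hl).
Qed.

Lemma bddD u v : bdd u -> bdd v -> bdd (fun n => u n + v n).
Proof.
move=> [M hM] [M' hM']; exists (M + M') => n.
by apply: (le_trans (modcD _ _)); apply: lerD.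
Qed.

Lemma bddZ u a : bdd u -> bdd (fun n => a * u n).
Proof.
move=> [M hM]; exists (modc a * M) => n; rewrite modcM.
by apply: ler_wpM2l => //; exact: modc_ge0.
Qed.

Lemma bddN u : bdd u -> bdd (fun n => - u n).
Proof. by move=> [M hM]; exists M => n; rewrite modcN. Qed.

Lemma bddM u v : bdd u -> bdd v -> bdd (fun n => u n * v n).
Proof.
move=> [M hM] [M' hM']; exists (M * M') => n; rewrite modcM.
by apply: ler_pM => //; exact: modc_ge0.
Qed.

Lemma bddX (mu : R[i]) : modc mu = 1 -> bdd (fun n => mu ^+ n).
Proof. by move=> h; exists 1 => n; rewrite modcX h expr1n. Qed.

Lemma bdd_cst a : bdd (fun=> a).
Proof. by exists (modc a). Qed.

Lemma meanD u v : bdd u -> bdd v -> mean (fun n => u n + v n) = mean u + mean v.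
Proof.
move=> /meanP hu /meanP hv; apply: mean_eq.
rewrite (_ : avg _ = fun n => avg u n + avg v n); first exact: tendsD.
by apply/funext => n; rewrite /avg big_split /= mulrDl.
Qed.

Lemma meanZ u a : bdd u -> mean (fun n => a * u n) = a * mean u.
Proof.
move=> /meanP hu; apply: mean_eq.
rewrite (_ : avg _ = fun n => a * avg u n); first exact: tendsZ.
by apply/funext => n; rewrite /avg -mulr_sumr mulrA.
Qed.

Lemma meanB u v : bdd u -> bdd v -> mean (fun n => u n - v n) = mean u - mean v.
Proof.
move=> hu hv; rewrite meanD //; last exact: bddN.
congr (_ + _); rewrite -[RHS]mulN1r -meanZ //.
by congr mean; apply/funext => n; rewrite mulN1r.
Qed.

Lemma mean_cst a : mean (fun=> a) = a.
Proof.
apply: mean_eq; rewrite (_ : avg _ = fun=> a); first exact: tends_cst.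
by apply/funext => n; rewrite /avg sumr_const card_ord -(mulr_natr a) mulfK // pnatr_eq0.
Qed.

Lemma bdd_sum (m : nat) (f : nat -> nat -> R[i]) :
  (forall k, bdd (f k)) -> bdd (fun n => \sum_(k < m) f k n).
Proof.
move=> h; elim: m => [|m IH].
  by exists 0 => n; rewrite big_ord0 modc0.
have [M hM] := bddD IH (h m).
by exists M => n; rewrite big_ord_recr /=.
Qed.

Lemma mean_sum (m : nat) (f : nat -> nat -> R[i]) :
  (forall k, bdd (f k)) ->
  mean (fun n => \sum_(k < m) f k n) = \sum_(k < m) mean (f k).
Proof.
move=> h; elim: m => [|m IH].
  rewrite big_ord0 -[RHS](mean_cst 0); congr mean.
  by apply/funext => n; rewrite big_ord0.
rewrite big_ord_recr /= -IH -meanD //; last exact: bdd_sum.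
by congr mean; apply/funext => n; rewrite big_ord_recr.
Qed.

Lemma mean_bound u (M : R) : (forall n, modc (u n) <= M) -> modc (mean u) <= M.
Proof.
move=> h; apply: (tends_le _ (meanP _)); last by exists M.
by apply: filterE => n /=; exact: avg_bound.
Qed.

Lemma mean_le u (v : nat -> R) (l : R) : bdd (fun n => (v n)%:C) ->
  (forall n, modc (u n) <= v n) -> mean (fun n => (v n)%:C) = l%:C ->
  modc (mean u) <= l.
Proof.
move=> bv h hl.
have bu : bdd u.
  case: bv => M hM; exists M => n; apply: (le_trans (h n)).
  by apply: le_trans (hM n); rewrite modc_real ler_norm.
apply/ler_addgt0Pl => e e0; have e2 : 0 < e / 2 by lra.
have [n [/= a b]] := ultra_meet (meanP bu e2) (meanP bv e2).
have c := modc_avg n h.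
have d := modcD (mean u - avg u n) (avg u n).
rewrite subrK (modcB (mean u)) in d.
have f : (\sum_(i < n.+1) v i) / n.+1%:R - l <= e / 2.
  apply: le_trans (ler_norm _) _; rewrite -modc_real.
  move: b; rewrite hl /avg; congr (modc _ <= _).
  rewrite rmorphB rmorphM fmorphV rmorph_nat rmorph_sum /=; congr (_ - _).
move: c f; set S := _ / n.+1%:R => c f; lra.
Qed.

(** The geometric sums stay bounded by [2 / |mu - 1|]. *)
Lemma mean_geo (mu : R[i]) : modc mu = 1 -> mu != 1 -> mean (fun n => mu ^+ n) = 0.
Proof.
move=> h1 hn; apply: mean_eq; apply: tends_eventually => e e0.
have d0 : 0 < modc (mu - 1) by rewrite modc_gt0 subr_eq0.
have [N hN] := harmonic_small (2 / modc (mu - 1)) e0.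
exists N => n /hN {hN}; apply: le_trans.
have e1 : modc (mu ^+ n.+1 - 1) = modc (mu - 1) * modc (\sum_(i < n.+1) mu ^+ i).
  by rewrite -modcM subrX1.
rewrite subr0 /avg modcM modcV modc_nat ler_pM2r ?invr_gt0 ?ltr0n //.
rewrite ler_pdivlMr // mulrC -e1.
by apply: (le_trans (modc_sub _ _)); rewrite modcX h1 modc1 expr1n.
Qed.

(** The two Cesaro means differ by [(u n.+1 - u 0) / n.+1]. *)
Lemma mean_shift u : bdd u -> mean (fun n => u n.+1) = mean u.
Proof.
move=> bu; have [M hM] := bu; apply: mean_eq.
apply: (tends_near _ (meanP bu)) => e e0.
have [N hN] := harmonic_small (2 * M) e0.
apply: (@ultra_nat_ge N) => n /hN {hN}; apply: le_trans.
rewrite /avg -mulrBl modcM modcV modc_nat ler_pM2r ?invr_gt0 ?ltr0n //.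
have -> : \sum_(i < n.+1) u i.+1 - \sum_(i < n.+1) u i = u n.+1 - u 0%N.
  rewrite big_ord_recr [X in _ - X]big_ord_recl /=.
  under [X in _ - (_ + X)]eq_bigr do rewrite /bump /= add1n.
  by ring.
apply: (le_trans (modc_sub _ _)).
by rewrite (_ : 2 * M = M + M); [exact: lerD|ring].
Qed.

End Mean.

(** * Polynomials bounded on a disc *)

Section PolyEstimates.
Variable R : realType.
Variable lam : R[i].
Hypothesis lam_mod : modc lam = 1.
Hypothesis lam_irr : forall k, lam ^+ k.+1 != 1.
Implicit Types (P : {poly R[i]}) (x y a : R[i]) (r e M : R) (f : R[i] -> R[i]).

Lemma lam_neq0 : lam != 0.
Proof. by rewrite -modc_gt0 lam_mod. Qed.

Lemma lamX_mod k : modc (lam ^+ k) = 1.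
Proof. by rewrite modcX lam_mod expr1n. Qed.

Lemma lamV_mod : modc lam^-1 = 1.
Proof. by rewrite modcV lam_mod invr1. Qed.

Lemma lamXV_mod k : modc (lam ^- k) = 1.
Proof. by rewrite modcV lamX_mod invr1. Qed.

Lemma lamX_neq0 k : lam ^+ k != 0.
Proof. by rewrite expf_neq0 // lam_neq0. Qed.

Lemma lamX_inj i k : lam ^+ i = lam ^+ k -> i = k.
Proof.
wlog: i k / (i <= k)%N => [h e|le e].
  by case/orP: (leq_total i k) => hh; [exact: h|symmetry; exact: h].
apply/eqP; rewrite eqn_leq le /= leqNgt; apply/negP => lt.
have := lam_irr (k - i).-1; rewrite prednK ?subn_gt0 // => /eqP; apply.
apply: (mulfI (lamX_neq0 i)); rewrite -exprD subnKC // -e.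
by rewrite mulr1.
Qed.

Lemma mean_lam i k : mean (fun n => (lam ^+ i / lam ^+ k) ^+ n) = (i == k)%:R.
Proof.
have [->|ne] := eqVneq i k.
  rewrite divff ?lamX_neq0 //; under eq_fun do rewrite expr1n.
  exact: mean_cst.
apply: mean_geo; first by rewrite modcM lamX_mod lamXV_mod mulr1.
apply: contraNneq ne => h; apply/eqP/lamX_inj.
by rewrite -[LHS]mulr1 -(mulVf (lamX_neq0 k)) mulrA h mul1r.
Qed.

(** The Fourier coefficient of index [k] on the circle of radius [r], the circle
    being sampled along an orbit of the rotation by [lam]. *)
Definition fc f r k := mean (fun n => f (r%:C * lam ^+ n) * (lam ^- k) ^+ n).

Lemma circle_mod r n : 0 <= r -> modc (r%:C * lam ^+ n) = r.
Proof. by move=> r0; rewrite modcM lamX_mod mulr1 modc_real ger0_norm. Qed.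

Lemma fc_bound f r M k : 0 <= r -> (forall x, modc x <= r -> modc (f x) <= M) ->
  modc (fc f r k) <= M.
Proof.
move=> r0 h; apply: mean_bound => n.
rewrite modcM modcX lamXV_mod expr1n mulr1; apply: h.
by rewrite circle_mod.
Qed.

Lemma fc_bdd f r M k : 0 <= r -> (forall x, modc x <= r -> modc (f x) <= M) ->
  bdd (fun n => f (r%:C * lam ^+ n) * (lam ^- k) ^+ n).
Proof.
move=> r0 h; exists M => n; rewrite modcM modcX lamXV_mod expr1n mulr1.
by apply: h; rewrite circle_mod.
Qed.

Lemma fc_near f g r M e k : 0 <= r -> (forall x, modc x <= r -> modc (f x) <= M) ->
  (forall x, modc x <= r -> modc (f x - g x) <= e) ->
  modc (fc f r k - fc g r k) <= e.
Proof.
move=> r0 hf h; rewrite /fc -meanB; first 1 last.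
- exact: fc_bdd hf.
- apply: (@fc_bdd _ _ (M + e)) => // x xr.
  have := modcD (g x - f x) (f x); rewrite subrK (modcB (g x)).
  by have := hf x xr; have := h x xr; lra.
apply: mean_bound => n.
rewrite -mulrBl modcM modcX lamXV_mod expr1n mulr1; apply: h.
by rewrite circle_mod.
Qed.

(** Orthogonality of the characters [lam ^+ i], which differ from each other
    because [lam] is not a root of unity. *)
Lemma fc_poly P r k : fc (horner P) r k = P`_k * r%:C ^+ k.
Proof.
rewrite /fc.
have e0 n : P.[r%:C * lam ^+ n] * (lam ^- k) ^+ n =
   \sum_(i < k.+1 + size P) P`_i * r%:C ^+ i * (lam ^+ i / lam ^+ k) ^+ n.
  rewrite (@horner_coef_wide _ (k.+1 + size P)) ?leq_addl // mulr_suml.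
  apply: eq_bigr => i _; rewrite !exprMn -!mulrA -!exprM; do 2 congr (_ * _).
  by rewrite mulnC.
under eq_fun do rewrite e0.
rewrite (@mean_sum _ (k.+1 + size P)
  (fun i n => P`_i * r%:C ^+ i * (lam ^+ i / lam ^+ k) ^+ n)); last first.
  by move=> i; apply/bddZ/bddX; rewrite modcM lamX_mod lamXV_mod mulr1.
have hk : (k < k.+1 + size P)%N by rewrite addSn ltnS leq_addr.
rewrite (bigD1 (Ordinal hk)) //= big1 ?addr0 => [|i ik].
  rewrite meanZ ?mean_lam ?eqxx ?mulr1 //.
  by apply/bddX; rewrite modcM lamX_mod lamXV_mod mulr1.
rewrite meanZ; last by apply/bddX; rewrite modcM lamX_mod lamXV_mod mulr1.
rewrite mean_lam (_ : (_ == k) = false) ?mulr0 //.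
by apply/negbTE; apply: contraNneq ik => e; apply/eqP/val_inj.
Qed.

Lemma poly_cauchy P r M k : 0 <= r -> (forall x, modc x <= r -> modc P.[x] <= M) ->
  modc P`_k * r ^+ k <= M.
Proof.
move=> r0 h; have := fc_bound k r0 h.
by rewrite fc_poly modcM modcX modc_real (ger0_norm r0).
Qed.

Lemma geo_sum_le2 (q : R) n : 0 <= q -> q <= 2^-1 -> \sum_(i < n) q ^+ i <= 2.
Proof.
move=> q0 q1; have := subrX1 q n; have : 0 <= q ^+ n by exact: exprn_ge0.
by nra.
Qed.

Lemma half_small (c e : R) : 0 < e -> exists m, c * 2^-1 ^+ m <= e.
Proof.
move=> e0; have [m hm] := harmonic_small `|c| e0; exists m.
apply: le_trans (hm m (leqnn m)); apply: (@le_trans _ _ (`|c| * 2^-1 ^+ m)).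
  by rewrite ler_wpM2r ?exprn_ge0 ?invr_ge0 ?ler0n ?ler_norm.
rewrite ler_wpM2l // exprVn lef_pV2 ?posrE ?exprn_gt0 ?ltr0n //.
by rewrite -natrX ler_nat ltn_expl.
Qed.

Lemma ratio_le_half x r m : 0 < r -> modc x <= r / 2 -> (modc x / r) ^+ m <= 2^-1 ^+ m.
Proof.
move=> r0 xr; have q0 : 0 <= modc x / r by rewrite divr_ge0 ?modc_ge0 ?ltW.
have q1 : modc x / r <= 2^-1 by rewrite ler_pdivrMr // mulrC.
by rewrite lerXn2r // nnegrE invr_ge0 ler0n.
Qed.

Lemma coef_le P r M k : 0 < r -> (forall x, modc x <= r -> modc P.[x] <= M) ->
  modc P`_k <= M / r ^+ k.
Proof.
move=> r0 h; rewrite ler_pdivlMr ?exprn_gt0 //.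
exact: poly_cauchy (ltW r0) h.
Qed.

Lemma bound_ge0 f r M : 0 <= r -> (forall x, modc x <= r -> modc (f x) <= M) -> 0 <= M.
Proof.
by move=> r0 h; apply: le_trans (modc_ge0 _) (h 0 _); rewrite modc0.
Qed.

Lemma poly_tail P r M m x : 0 < r -> (forall x, modc x <= r -> modc P.[x] <= M) ->
  modc x <= r / 2 ->
  modc (P.[x] - \sum_(k < m) P`_k * x ^+ k) <= 2 * M * (modc x / r) ^+ m.
Proof.
move=> r0 h xr; have M0 := bound_ge0 (ltW r0) h.
rewrite (@horner_coef_wide _ (m + size P)) ?leq_addl // big_split_ord /=.
rewrite addrAC subrr add0r; apply: (le_trans (modc_sum _ _ _)).
have q0 : 0 <= modc x / r by rewrite divr_ge0 ?modc_ge0 ?ltW.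
have q1 : modc x / r <= 2^-1 by rewrite ler_pdivrMr // mulrC.
apply: (@le_trans _ _ (\sum_(i < size P) M * (modc x / r) ^+ m * (modc x / r) ^+ i)).
  apply: ler_sum => i _; rewrite modcM modcX -mulrA -exprD expr_div_n.
  rewrite mulrA mulrAC ler_wpM2r ?exprn_ge0 ?modc_ge0 //.
  exact: coef_le.
rewrite -mulr_sumr; have := geo_sum_le2 (size P) q0 q1.
have : 0 <= M * (modc x / r) ^+ m by rewrite mulr_ge0 // exprn_ge0.
have -> : 2 * M * (modc x / r) ^+ m = 2 * (M * (modc x / r) ^+ m) by ring.
move: (M * _) (\sum_(i < _) _) => A B; nra.
Qed.

Lemma diffX_le x y (t : R) k : modc x <= t -> modc y <= t ->
  modc (x ^+ k.+1 - y ^+ k.+1) <= modc (x - y) * (2 * t) ^+ k.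
Proof.
move=> xt yt; have t0 := le_trans (modc_ge0 _) xt.
rewrite subrXX modcM ler_wpM2l ?modc_ge0 //.
apply: (le_trans (modc_sum _ _ _)).
apply: (@le_trans _ _ (\sum_(i < k.+1) t ^+ k)).
  apply: ler_sum => i _; rewrite modcM !modcX /=.
  have ik : (i <= k)%N by rewrite -ltnS.
  have -> : t ^+ k = t ^+ (k - i) * t ^+ i by rewrite -exprD subnK.
  rewrite ler_pM ?exprn_ge0 ?modc_ge0 //;
    by rewrite lerXn2r ?nnegrE ?modc_ge0.
rewrite sumr_const card_ord exprMn -[X in X <= _]mulr_natl.
by rewrite ler_wpM2r ?exprn_ge0 // -natrX ler_nat ltn_expl.
Qed.

(** By Cauchy's estimates the terms of degree two and more are Lipschitz with
    constant [O(M * t / r ^+ 2)] on the disc of radius [t]; the others are affine. *)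
Lemma poly_diff P r M (t : R) x y : 0 < r -> (forall x, modc x <= r -> modc P.[x] <= M) ->
  modc x <= t -> modc y <= t -> t <= r / 4 ->
  modc (P.[x] - P.[y] - P`_1 * (x - y)) <= 4 * M * t / r ^+ 2 * modc (x - y).
Proof.
move=> r0 h xt yt tr; have M0 := bound_ge0 (ltW r0) h.
have t0 := le_trans (modc_ge0 _) xt.
have hx z : P.[z] = P`_0 + P`_1 * z + \sum_(i < size P) P`_(i.+2) * z ^+ i.+2.
  rewrite (@horner_coef_wide _ (2 + size P)) ?leq_addl // big_split_ord /=.
  by rewrite !big_ord_recl big_ord0 addr0 /= expr0 expr1 mulr1.
rewrite !hx.
have -> : forall a b c d e f : R[i],
  a + b * c + d - (a + b * e + f) - b * (c - e) = d - f by move=> *; ring.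
rewrite -sumrB; apply: (le_trans (modc_sum _ _ _)).
apply: (@le_trans _ _ (\sum_(i < size P)
   (2 * M * t / r ^+ 2 * modc (x - y)) * (2 * t / r) ^+ i)).
  apply: ler_sum => i _; rewrite -mulrBr modcM.
  apply: (@le_trans _ _ (M / r ^+ i.+2 * (modc (x - y) * (2 * t) ^+ i.+1))).
    apply: ler_pM; rewrite ?modc_ge0 //; first exact: coef_le.
    exact: diffX_le.
  rewrite expr_div_n (exprS (2 * t)) -addn2 exprD.
  by rewrite le_eqVlt; apply/orP; left; apply/eqP; field; rewrite ?expf_neq0 ?gt_eqF.
rewrite -mulr_sumr.
have q0 : 0 <= 2 * t / r by apply: divr_ge0; [rewrite mulr_ge0|exact: ltW].
have q1 : 2 * t / r <= 2^-1 by rewrite ler_pdivrMr //; lra.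
have := geo_sum_le2 (size P) q0 q1.
have : 0 <= 2 * M * t / r ^+ 2 * modc (x - y).
  by rewrite !mulr_ge0 ?invr_ge0 ?exprn_ge0 ?modc_ge0 // ltW.
have -> : 4 * M * t / r ^+ 2 * modc (x - y) = 2 * (2 * M * t / r ^+ 2 * modc (x - y)) by ring.
move: (2 * M * t / r ^+ 2 * _) (\sum_(i < _) _) => A B; nra.
Qed.

(** A quantitative form of Vitali's theorem: the small disc controls the
    coefficients of low degree, and by Cauchy's estimates on the large disc those of
    high degree contribute little on the disc of radius [r / 2]. *)
Lemma poly_vitali M r eps delta : 0 < r -> 0 < eps -> 0 < delta ->
  exists2 eta : R, 0 < eta & forall P,
    (forall x, modc x <= r -> modc P.[x] <= M) ->
    (forall x, modc x <= eps -> modc P.[x] <= eta) ->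
    forall x, modc x <= r / 2 -> modc P.[x] <= delta.
Proof.
move=> r0 e0 d0; have d2 : 0 < delta / 2 by lra.
have [m hm] := half_small (2 * M) d2.
set S := \sum_(k < m) (r / 2 / eps) ^+ k.
have S0 : 0 <= S by apply: sumr_ge0 => i _; rewrite exprn_ge0 // !divr_ge0 // ltW.
have S1 : 0 < S + 1 by lra.
exists (delta / 2 / (S + 1)); first by rewrite divr_gt0.
move=> P hM he x xr.
have M0 := bound_ge0 (ltW r0) hM.
have h1 := poly_tail m r0 hM xr.
have h2 : modc (\sum_(k < m) P`_k * x ^+ k) <= delta / 2.
  apply: (le_trans (modc_sum _ _ _)).
  apply: (@le_trans _ _ (\sum_(k < m) delta / 2 / (S + 1) * (r / 2 / eps) ^+ k)).
    apply: ler_sum => k _; rewrite modcM modcX (expr_div_n _ _ k) mulrA mulrAC.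
    apply: ler_pM; rewrite ?modc_ge0 ?exprn_ge0 ?modc_ge0 //.
      exact: coef_le.
    by rewrite lerXn2r ?nnegrE ?modc_ge0 // divr_ge0 // ltW.
  rewrite -mulr_sumr -/S mulrAC ler_pdivrMr //; nra.
have h3 : 2 * M * (modc x / r) ^+ m <= delta / 2.
  by apply: le_trans hm; apply: ler_wpM2l; [lra|exact: ratio_le_half].
have := modcD (P.[x] - \sum_(k < m) P`_k * x ^+ k) (\sum_(k < m) P`_k * x ^+ k).
by rewrite subrK; lra.
Qed.

Lemma mul_conjc_mod (z : R[i]) : z * conjc z = (modc z ^+ 2)%:C.
Proof. by rewrite -sqr_normc modcE rmorphXn. Qed.

Lemma conjc_unit (z : R[i]) : modc z = 1 -> conjc z = z^-1.
Proof.
move=> z1; have z0 : z != 0 by rewrite -modc_gt0 z1.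
by apply: (mulfI z0); rewrite mul_conjc_mod z1 expr1n divff.
Qed.

Lemma mean_lamV k : mean (fun n => (lam ^- k.+1) ^+ n) = 0.
Proof.
apply: mean_geo; first exact: lamXV_mod.
by rewrite invr_eq1; exact: lam_irr.
Qed.

Lemma mean_lamP k : mean (fun n => (lam ^+ k.+1) ^+ n) = 0.
Proof. by apply: mean_geo; first exact: lamX_mod. Qed.

Lemma conjc1D (z : R[i]) : conjc (1 + z) = 1 + conjc z.
Proof. by case: z => x y; apply/eqP; rewrite eq_complex /=; apply/andP; split; apply/eqP; ring. Qed.

Lemma align_phase (A B : R[i]) :
  exists t, modc t = 1 /\ modc (A + t * B / 2) = modc A + modc B / 2.
Proof.
have hB : modc (B / 2) = modc B / 2 by rewrite modcM modcV modc_nat.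
have [A0|A0] := eqVneq A 0.
  by exists 1; rewrite modc1 A0 modc0 !add0r mul1r hB.
have [B0|B0] := eqVneq B 0.
  by exists 1; rewrite modc1 B0 modc0 mulr0 !mul0r !addr0.
have Ap : modc A != 0 by rewrite modc_eq0.
have Bp : modc B != 0 by rewrite modc_eq0.
exists (A / B * (modc B / modc A)%:C); split.
  rewrite !modcM modcV modc_real ger0_norm ?divr_ge0 ?modc_ge0 //; field.
  by rewrite Ap Bp.
have -> : A / B * (modc B / modc A)%:C * B = A * (modc B / modc A)%:C by rewrite mulrAC mulfVK.
have -> : A + A * (modc B / modc A)%:C / 2 = A * (1 + modc B / modc A / 2)%:C.
  rewrite rmorphD /= [X in _ = _ * (_ + X)]rmorphM fmorphV rmorph_nat /=; ring.
rewrite modcM modc_real ger0_norm; first by field.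
by rewrite addr_ge0 // !divr_ge0 ?modc_ge0.
Qed.

(** [P] is tested against the kernel [|1 + t * lam ^- (n * k.+1)|^2 / 2], which is
    nonnegative with mean 1; the phase [t] aligns the two coefficients. This gives the
    maximum principle [approx_max]. *)
Lemma poly_fejer P r M k : 0 < r -> (forall x, modc x <= r -> modc P.[x] <= M) ->
  modc P`_0 + modc P`_k.+1 * r ^+ k.+1 / 2 <= M.
Proof.
move=> r0 h; have M0 := bound_ge0 (ltW r0) h.
set A := P`_0; set B := P`_k.+1 * r%:C ^+ k.+1.
have BE : modc P`_k.+1 * r ^+ k.+1 = modc B.
  by rewrite /B modcM modcX modc_real gtr0_norm.
rewrite BE.
have [t [t1 tE]] := align_phase A B.
rewrite -tE.
pose nu := lam ^- k.+1.
have nu1 : modc nu = 1 by exact: lamXV_mod.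
pose v n := M * (modc (1 + t * nu ^+ n) ^+ 2 / 2).
have kE n : ((modc (1 + t * nu ^+ n) ^+ 2 / 2)%:C : R[i]) =
    1 + (t * nu ^+ n + conjc t * (lam ^+ k.+1) ^+ n) / 2.
  have h1 : conjc (t * nu ^+ n) = conjc t * (lam ^+ k.+1) ^+ n.
    by rewrite [LHS](rmorphM (@conjc R)) /= (rmorphXn (@conjc R)) /= (conjc_unit nu1) invrK.
  have h2 : t * nu ^+ n * (conjc t * (lam ^+ k.+1) ^+ n) = 1.
    by rewrite -h1 mul_conjc_mod modcM modcX t1 nu1 expr1n mulr1 expr1n.
  rewrite rmorphM /= -mul_conjc_mod (conjc1D (t * nu ^+ n)) h1 fmorphV rmorph_nat /=.
  have -> : (1 + t * nu ^+ n) * (1 + conjc t * (lam ^+ k.+1) ^+ n) =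
     2 + t * nu ^+ n + conjc t * (lam ^+ k.+1) ^+ n by rewrite mulrDl !mulrDr h2; ring.
  by field.
have vE n : (v n)%:C = M%:C + M%:C / 2 * (t * nu ^+ n) + M%:C / 2 * (conjc t * (lam ^+ k.+1) ^+ n).
  by rewrite /v [LHS](rmorphM (real_complex R)) [X in _ * X]kE; field.
have bnu c d : bdd (fun n => c * (d * nu ^+ n)) by do 2 apply: bddZ; exact: bddX.
have blam c d : bdd (fun n => c * (d * (lam ^+ k.+1) ^+ n)).
  by do 2 apply: bddZ; apply/bddX/lamX_mod.
have bP : bdd (fun n => P.[r%:C * lam ^+ n]).
  by exists M => n; apply: h; rewrite circle_mod // ltW.
have bPl i : bdd (fun n => P.[r%:C * lam ^+ n] * (lam ^- i) ^+ n).
  by apply: bddM => //; apply/bddX/lamXV_mod.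
have bPl' i : bdd (fun n => P.[r%:C * lam ^+ n] * (lam ^+ i) ^+ n).
  by apply: bddM => //; apply/bddX/lamX_mod.
pose u n := P.[r%:C * lam ^+ n] + t / 2 * (P.[r%:C * lam ^+ n] * nu ^+ n) +
   conjc t / 2 * (P.[r%:C * lam ^+ n] * (lam ^+ k.+1) ^+ n).
have mP0 : mean (fun n => P.[r%:C * lam ^+ n]) = A.
  rewrite [A](_ : _ = fc (horner P) r 0); last by rewrite fc_poly expr0 mulr1.
  rewrite /fc; congr mean.
  by apply/funext => n; rewrite expr0 invr1 expr1n mulr1.
have mPk : mean (fun n => P.[r%:C * lam ^+ n] * nu ^+ n) = B by exact: fc_poly.
have mPn : mean (fun n => P.[r%:C * lam ^+ n] * (lam ^+ k.+1) ^+ n) = 0.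
  have e0 n : P.[r%:C * lam ^+ n] * (lam ^+ k.+1) ^+ n =
     \sum_(i < size P) P`_i * r%:C ^+ i * (lam ^+ (i + k).+1) ^+ n.
    rewrite horner_coef mulr_suml; apply: eq_bigr => i _.
    rewrite exprMn -!mulrA -!exprM -exprD; do 2 congr (_ * _).
    by congr (_ ^+ _); lia.
  under eq_fun do rewrite e0.
  rewrite (@mean_sum _ (size P)
    (fun i n => P`_i * r%:C ^+ i * (lam ^+ (i + k).+1) ^+ n)); last first.
    by move=> i; apply/bddZ/bddX/lamX_mod.
  by apply: big1 => i _; rewrite meanZ ?mean_lamP ?mulr0 //; apply/bddX/lamX_mod.
have mu : mean u = A + t * B / 2.
  rewrite /u meanD; [|apply: bddD => //; apply: bddZ; exact: bPl|apply: bddZ; exact: bPl'].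
  rewrite meanD //; last by apply: bddZ; exact: bPl.
  rewrite mP0 meanZ; last exact: bPl.
  rewrite meanZ; last exact: bPl'.
  by rewrite mPk mPn mulr0 addr0; ring.
rewrite -mu; apply: (@mean_le _ u v).
- have [K hK] := bddD (bddD (@bdd_cst _ M%:C) (bnu (M%:C / 2) t)) (blam (M%:C / 2) (conjc t)).
  by exists K => n; rewrite vE; exact: hK.
- move=> n.
  have -> : u n = P.[r%:C * lam ^+ n] * ((modc (1 + t * nu ^+ n) ^+ 2 / 2)%:C).
    by rewrite kE /u; field.
  rewrite modcM modc_real ger0_norm ?divr_ge0 ?exprn_ge0 ?modc_ge0 //.
  rewrite /v ler_wpM2r ?divr_ge0 ?exprn_ge0 ?modc_ge0 //.
  by apply: h; rewrite circle_mod // ltW.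
- under eq_fun do rewrite vE.
  rewrite meanD; [|apply: bddD; [exact: bdd_cst|exact: bnu]|exact: blam].
  rewrite meanD; [|exact: bdd_cst|exact: bnu].
  rewrite mean_cst !meanZ; first by rewrite mean_lamV mean_lamP !mulr0 !addr0.
  all: do ?[apply: bddZ]; apply: bddX; rewrite ?lamX_mod ?lamXV_mod //.
Qed.

End PolyEstimates.

(** * Uniform limits of polynomials *)

Section Approx.
Variable R : realType.
Implicit Types (P Q : {poly R[i]}) (x y a b : R[i]) (r e M : R) (f g : R[i] -> R[i]).

(** Every function of the proof is a uniform limit of polynomials on small discs,
    and this property plays the part of holomorphy: it is stable under uniform
    limits, algebraic operations, composition and means. *)
Definition approx f a r := forall e : R, 0 < e ->
  exists P, forall x, modc x <= r -> modc (f (a + x) - P.[x]) <= e.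

Lemma le_lin_eps (A B K : R) : 0 <= K ->
  (forall e : R, 0 < e -> A <= B + K * e) -> A <= B.
Proof.
move=> K0 h; apply/ler_addgt0Pl => e e0.
have K1 : 0 < K + 1 by lra.
have := h (e / (K + 1)) (divr_gt0 e0 K1).
have : K * (e / (K + 1)) <= e by rewrite mulrA ler_pdivrMr //; nra.
lra.
Qed.

Lemma approx_ext f g a r : (forall x, modc x <= r -> f (a + x) = g (a + x)) ->
  approx f a r -> approx g a r.
Proof.
by move=> h hf e /hf [P hP]; exists P => x xr; rewrite -h //; exact: hP.
Qed.

Lemma approx_poly P a r : approx (horner P) a r.
Proof.
move=> e e0; exists (P \Po ('X + a%:P)) => x _.
by rewrite horner_comp !hornerE [x + a]addrC subrr modc0 ltW.
Qed.

Lemma approx_ispoly f P a r : (forall x, f x = P.[x]) -> approx f a r.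
Proof. by move=> h; apply: approx_ext (approx_poly P a r) => x _; rewrite h. Qed.

Lemma approx_id a r : approx id a r.
Proof. by apply: (@approx_ispoly _ 'X) => x; rewrite hornerX. Qed.

Lemma approx_cst c a r : approx (fun=> c) a r.
Proof. by apply: (@approx_ispoly _ c%:P) => x; rewrite hornerC. Qed.

Lemma approx_shift f a b r s : approx f a r -> modc b + s <= r -> approx f (a + b) s.
Proof.
move=> hf bs e /hf [P hP]; exists (P \Po ('X + b%:P)) => x xs.
rewrite -addrA horner_comp hornerD hornerX hornerC [x + b]addrC; apply: hP.
by have := modcD b x; lra.
Qed.

Lemma approxS f a r s : approx f a r -> s <= r -> approx f a s.
Proof.
by move=> hf sr; rewrite -[a]addr0; apply: approx_shift hf _; rewrite modc0 add0r.
Qed.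

Lemma approxD f g a r : approx f a r -> approx g a r -> approx (fun x => f x + g x) a r.
Proof.
move=> hf hg e e0; have e2 : 0 < e / 2 by lra.
have [P hP] := hf _ e2; have [Q hQ] := hg _ e2.
exists (P + Q) => x xr; rewrite hornerD.
have := modcD (f (a + x) - P.[x]) (g (a + x) - Q.[x]).
rewrite addrACA -opprD; have := hP x xr; have := hQ x xr; lra.
Qed.

Lemma poly_lip Q (T : R) : 0 <= T -> exists2 L : R, 0 <= L & forall x y,
  modc x <= T -> modc y <= T -> modc (Q.[x] - Q.[y]) <= L * modc (x - y).
Proof.
move=> T0; exists (\sum_(k < size Q) modc Q`_k.+1 * (2 * T) ^+ k).
  by apply: sumr_ge0 => k _; rewrite mulr_ge0 ?modc_ge0 ?exprn_ge0 // mulr_ge0.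
move=> x y xT yT.
rewrite !(@horner_coef_wide _ (1 + size Q) Q) ?leq_addl // !big_split_ord /=.
rewrite !big_ord1 /= !expr0 opprD addrACA subrr add0r -sumrB.
apply: (le_trans (modc_sum _ _ _)); rewrite mulr_suml; apply: ler_sum => k _.
rewrite add1n -mulrBr modcM -mulrA ler_wpM2l ?modc_ge0 // mulrC.
exact: diffX_le.
Qed.

Lemma approx_bdd f a r : 0 <= r -> approx f a r ->
  exists2 M : R, 0 <= M & forall x, modc x <= r -> modc (f (a + x)) <= M.
Proof.
move=> r0 hf; have [P hP] := hf 1 ltr01.
have [L L0 hL] := poly_lip P r0.
have P0 := modc_ge0 P.[0].
exists (modc P.[0] + L * r + 1).
  by have := mulr_ge0 L0 r0; lra.
move=> x xr; have h0 : modc 0 <= r by rewrite modc0.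
have := hP x xr; have := hL x 0 xr h0; rewrite subr0.
have := modcD (f (a + x) - P.[x]) P.[x]; have := modcD (P.[x] - P.[0]) P.[0].
rewrite !subrK; have : L * modc x <= L * r by rewrite ler_wpM2l.
by lra.
Qed.

Lemma approxM f g a r : 0 <= r -> approx f a r -> approx g a r ->
  approx (fun x => f x * g x) a r.
Proof.
move=> r0 hf hg e e0.
have [M M0 hM] := approx_bdd r0 hf; have [M' M'0 hM'] := approx_bdd r0 hg.
have K0 : 0 < M + M' + 1 by lra.
have d1 : 0 < Num.min 1 (e / (M + M' + 1)).
  by rewrite lt_min ltr01 divr_gt0.
have [P hP] := hf _ d1; have [Q hQ] := hg _ d1.
exists (P * Q) => x xr; rewrite hornerM.
have {hP} hP := hP x xr; have {hQ} hQ := hQ x xr.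
have {}hM := hM x xr; have {}hM' := hM' x xr.
move: d1 hP hQ; set d := Num.min _ _ => d1 hP hQ.
have [dle1 dle2] : d <= 1 /\ d * (M + M' + 1) <= e.
  split; first by rewrite ge_min lexx.
  by rewrite -ler_pdivlMr // ge_min lexx orbT.
move: (f _) (g _) P.[x] Q.[x] hM hM' hP hQ => u v p q hM hM' hP hQ.
have -> : u * v - p * q = (u - p) * v + u * (v - q) - (u - p) * (v - q) by ring.
have := modc_sub ((u - p) * v + u * (v - q)) ((u - p) * (v - q)).
have := modcD ((u - p) * v) (u * (v - q)); rewrite !modcM.
have h1 : modc (u - p) * modc v <= d * M' by apply: ler_pM; rewrite ?modc_ge0.
have h2 : modc u * modc (v - q) <= M * d by apply: ler_pM; rewrite ?modc_ge0.
have h3 : modc (u - p) * modc (v - q) <= d * 1.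
  by apply: ler_pM; rewrite ?modc_ge0 //; exact: le_trans dle1.
have : d * (M + M' + 1) = d * M' + M * d + d * 1 by ring.
lra.
Qed.

Lemma approxZ f c a r : 0 <= r -> approx f a r -> approx (fun x => c * f x) a r.
Proof. by move=> r0 hf; apply: approxM => //; exact: approx_cst. Qed.

Lemma approxB f g a r : 0 <= r -> approx f a r -> approx g a r ->
  approx (fun x => f x - g x) a r.
Proof.
move=> r0 hf hg; apply: (@approx_ext (fun x => f x + (-1) * g x)).
  by move=> x _; rewrite mulN1r.
by apply: approxD => //; exact: approxZ.
Qed.

Lemma approxX f k a r : 0 <= r -> approx f a r -> approx (fun x => f x ^+ k) a r.
Proof.
move=> r0 hf; elim: k => [|k IH]; first exact: approx_cst.
apply: (@approx_ext (fun x => f x * f x ^+ k)); last exact: approxM.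
by move=> x _; rewrite exprS.
Qed.

Lemma approx_unif f a r :
  (forall e : R, 0 < e -> exists g, approx g a r /\
     forall x, modc x <= r -> modc (f (a + x) - g (a + x)) <= e) -> approx f a r.
Proof.
move=> h e e0; have e2 : 0 < e / 2 by lra.
have [g [hg fg]] := h _ e2; have [P hP] := hg _ e2.
exists P => x xr; have := hP x xr; have := fg x xr.
have := modc_triangle (f (a + x)) (g (a + x)) P.[x]; lra.
Qed.

Lemma approx_comp f g a r b s : 0 <= r -> approx g b s -> approx f a r ->
  (forall x, modc x <= r -> modc (f (a + x) - b) <= s) ->
  approx (fun x => g (f x)) a r.
Proof.
move=> r0 hg hf hfs; apply: approx_unif => e e0.
have [Q hQ] := hg _ e0.
exists (fun x => Q.[f x - b]); split; last first.
  by move=> x xr; have := hQ _ (hfs x xr); rewrite [b + _]addrC subrK.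
have s0 : 0 <= s.
  by apply: le_trans (modc_ge0 _) (hfs 0 _); rewrite modc0.
move=> d d0; have s1 : 0 <= s + 1 by lra.
have [L L0 hL] := poly_lip Q s1.
have d1 : 0 < Num.min 1 (d / (L + 1)).
  by rewrite lt_min ltr01 divr_gt0 //; lra.
have [P hP] := hf _ d1; exists (Q \Po (P - b%:P)) => x xr.
rewrite horner_comp !hornerE.
have {}hP := hP x xr; have {}hfs := hfs x xr.
have [h1 h2] : Num.min 1 (d / (L + 1)) <= 1 /\ Num.min 1 (d / (L + 1)) * (L + 1) <= d.
  split; first by rewrite ge_min lexx.
  by rewrite -ler_pdivlMr ?ge_min ?lexx ?orbT //; lra.
have h3 : modc (f (a + x) - b - (P.[x] - b)) <= Num.min 1 (d / (L + 1)).
  by have -> : f (a + x) - b - (P.[x] - b) = f (a + x) - P.[x] by ring.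
have h4 : modc (P.[x] - b) <= s + 1.
  have := modc_triangle (P.[x] - b) (f (a + x) - b) 0.
  by rewrite !subr0 (modcB (P.[x] - b)); lra.
have h5 : modc (f (a + x) - b) <= s + 1 by lra.
have := hL _ _ h5 h4; move: h1 h2 h3; move: (Num.min _ _) (modc (_ - (_ - _))) => m n.
move=> *; nra.
Qed.

(** By Cauchy's estimates the polynomials can be truncated at a degree that does
    not depend on [n]; the mean of the truncations is a polynomial. *)
Lemma approx_mean (F : nat -> R[i] -> R[i]) a r M : 0 < r ->
  (exists lam : R[i], modc lam = 1 /\ forall k, lam ^+ k.+1 != 1) ->
  (forall n, exists P, forall x, F n (a + x) = P.[x]) ->
  (forall n x, modc x <= r -> modc (F n (a + x)) <= M) ->
  approx (fun z => mean (fun n => F n z)) a (r / 2).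
Proof.
move=> r0 [lam [lam1 lamk]] hP hM e e0.
pose P n := projT1 (cid (hP n)).
have PE n x : F n (a + x) = (P n).[x] by rewrite /P; case: cid.
have PM n x : modc x <= r -> modc (P n).[x] <= M by move=> ?; rewrite -PE; exact: hM.
have [m hm] := half_small (2 * M) e0.
exists (\poly_(k < m) mean (fun n => (P n)`_k)) => x xr.
have bP k : bdd (fun n => (P n)`_k).
  by exists (M / r ^+ k) => n; apply: (coef_le lam1 lamk _ r0); exact: PM.
have bPx k : bdd (fun n => (P n)`_k * x ^+ k).
  by have := bddZ (x ^+ k) (bP k); under eq_fun do rewrite mulrC.
rewrite horner_poly.
have -> : \sum_(k < m) mean (fun n => (P n)`_k) * x ^+ k =
   mean (fun n => \sum_(k < m) (P n)`_k * x ^+ k).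
  rewrite (@mean_sum _ m (fun k n => (P n)`_k * x ^+ k)) //.
  apply: eq_bigr => k _; rewrite mulrC -meanZ //.
  by congr mean; apply/funext => n; rewrite mulrC.
have bF : bdd (fun n => F n (a + x)).
  by exists M => n; apply: hM; lra.
rewrite -meanB //; last exact: (@bdd_sum _ m (fun k n => (P n)`_k * x ^+ k)).
apply: mean_bound => n; rewrite PE.
apply: (le_trans (poly_tail lam1 lamk m r0 (PM n) xr)); apply: le_trans hm.
have M0 : 0 <= M by apply: (bound_ge0 (ltW r0) (PM 0%N)).
by apply: ler_wpM2l; [lra|exact: ratio_le_half].
Qed.

Lemma approx_cont f a r e : 0 < r -> approx f a r -> 0 < e ->
  exists2 d : R, 0 < d & forall x, modc x <= d -> modc (f (a + x) - f a) <= e.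
Proof.
move=> r_gt0 hf e0; have e3 : 0 < e / 3 by lra.
have [Q hQ] := hf _ e3; have [L L0 hL] := poly_lip Q (ltW r_gt0).
have L1 : 0 < L + 1 by lra.
exists (Num.min r (e / 3 / (L + 1))); first by rewrite lt_min r_gt0 divr_gt0.
move=> x; rewrite le_min => /andP [xr]; rewrite ler_pdivlMr // => xe.
have h0 : modc (0 : R[i]) <= r by rewrite modc0 ltW.
have h1 := hQ x xr; have h2 := hQ 0 h0; have h3 := hL x 0 xr h0.
rewrite addr0 in h2; rewrite subr0 in h3.
have -> : f (a + x) - f a = (f (a + x) - Q.[x]) + (Q.[x] - Q.[0]) - (f a - Q.[0]) by ring.
have := modc_sub ((f (a + x) - Q.[x]) + (Q.[x] - Q.[0])) (f a - Q.[0]).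
have := modcD (f (a + x) - Q.[x]) (Q.[x] - Q.[0]).
by have := modc_ge0 x; nra.
Qed.

End Approx.

(** * Taylor expansion, identity theorem and maximum principle *)

Section Taylor.
Variable R : realType.
Variable lam : R[i].
Hypothesis lam_mod : modc lam = 1.
Hypothesis lam_irr : forall k, lam ^+ k.+1 != 1.
Implicit Types (P Q : {poly R[i]}) (x y a b : R[i]) (r e M : R) (f g : R[i] -> R[i]).

(** Taylor coefficients, computed as means over a circle of radius [r]. *)
Definition tc f a r k := fc lam (fun x => f (a + x)) r k / r%:C ^+ k.

Lemma tc_near f P a r M e k : 0 < r ->
  (forall x, modc x <= r -> modc (f (a + x)) <= M) ->
  (forall x, modc x <= r -> modc (f (a + x) - P.[x]) <= e) ->
  modc (tc f a r k - P`_k) * r ^+ k <= e.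
Proof.
move=> r0 hM h; have := fc_near lam_mod k (ltW r0) hM h.
rewrite (fc_poly lam_mod lam_irr); apply: le_trans.
rewrite -[r ^+ k](ger0_norm (exprn_ge0 _ (ltW r0))) -modc_real -modcM mulrBl rmorphXn /=.
rewrite /tc mulfVK // expf_neq0 // (inj_eq (@complexI R)); lra.
Qed.

Lemma approx_poly_bound f P a r M e :
  (forall x, modc x <= r -> modc (f (a + x)) <= M) ->
  (forall x, modc x <= r -> modc (f (a + x) - P.[x]) <= e) ->
  forall x, modc x <= r -> modc P.[x] <= M + e.
Proof.
move=> hM h x xr; have := hM x xr; have := h x xr.
by have := modc_triangle P.[x] (f (a + x)) 0; rewrite !subr0 (modcB P.[x]); lra.
Qed.

Lemma taylor f a r M m x : 0 < r -> approx f a r ->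
  (forall x, modc x <= r -> modc (f (a + x)) <= M) -> modc x <= r / 2 ->
  modc (f (a + x) - \sum_(k < m) tc f a r k * x ^+ k) <= 2 * M * (modc x / r) ^+ m.
Proof.
move=> r0 hf hM xr.
have q0 : 0 <= modc x / r by rewrite divr_ge0 ?modc_ge0 ?ltW.
have q1 : modc x / r <= 2^-1 by rewrite ler_pdivrMr // mulrC.
apply: (@le_lin_eps _ _ _ (m%:R + 3)) => [|e e0]; first by have := ler0n R m; lra.
have [P hP] := hf _ e0.
have h1 := poly_tail lam_mod lam_irr m r0 (approx_poly_bound hM hP) xr.
have xr' : modc x <= r by lra.
have h2 := hP x xr'.
have h3 : modc (\sum_(k < m) P`_k * x ^+ k - \sum_(k < m) tc f a r k * x ^+ k) <= m%:R * e.
  rewrite -sumrB; apply: (le_trans (modc_sum _ _ _)).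
  apply: (@le_trans _ _ (\sum_(k < m) e)); last first.
    by rewrite sumr_const card_ord mulr_natl.
  apply: ler_sum => k _; rewrite -mulrBl modcM modcX (modcB P`_k).
  have := tc_near k r0 hM hP; apply: le_trans; apply: ler_wpM2l; first exact: modc_ge0.
  by apply: lerXn2r; rewrite ?nnegrE ?modc_ge0 //; exact: ltW.
have h4 : (modc x / r) ^+ m <= 1 by apply: exprn_ile1 => //; lra.
have h5 : 0 <= (modc x / r) ^+ m by apply: exprn_ge0.
have h6 := modc_triangle (f (a + x)) P.[x] (\sum_(k < m) tc f a r k * x ^+ k).
have h7 := modc_triangle P.[x] (\sum_(k < m) P`_k * x ^+ k) (\sum_(k < m) tc f a r k * x ^+ k).
move: h1 h2 h3 h4 h5 h6 h7; set A := (_ ^+ m).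
move: (modc _) (modc _) (modc _) (modc _) (modc _) => A1 A2 A3 A4 A5.
by move=> *; nra.
Qed.

(** The estimate of [poly_diff] passes to uniform limits. At [y = 0] it gives
    differentiability, and in general the local Lipschitz property. *)
Lemma approx_diff f a r M t x y : 0 < r -> approx f a r ->
  (forall x, modc x <= r -> modc (f (a + x)) <= M) ->
  modc x <= t -> modc y <= t -> t <= r / 4 ->
  modc (f (a + x) - f (a + y) - tc f a r 1 * (x - y)) <=
    4 * M * t / r ^+ 2 * modc (x - y).
Proof.
move=> r0 hf hM xt yt tr; have t0 := le_trans (modc_ge0 _) xt.
set D := modc (x - y).
have D0 : 0 <= D by exact: modc_ge0.
apply: (@le_lin_eps _ _ _ (2 + D / r + 4 * t / r ^+ 2 * D)) => [|e e0].
  by rewrite !addr_ge0 // !mulr_ge0 // ?invr_ge0 ?mulr_ge0 // ?exprn_ge0 ?ltW.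
have [P hP] := hf _ e0.
have h1 := poly_diff lam_mod lam_irr r0 (approx_poly_bound hM hP) xt yt tr.
have xr' : modc x <= r by lra.
have yr' : modc y <= r by lra.
have h2 := hP x xr'; have h3 := hP y yr'.
have h4 := tc_near 1 r0 hM hP; rewrite expr1 -ler_pdivlMr // in h4.
have -> : f (a + x) - f (a + y) - tc f a r 1 * (x - y) =
  (P.[x] - P.[y] - P`_1 * (x - y)) + ((f (a + x) - P.[x]) - (f (a + y) - P.[y]))
  - (tc f a r 1 - P`_1) * (x - y) by ring.
apply: (le_trans (modc_sub _ _)).
have h5 : modc ((tc f a r 1 - P`_1) * (x - y)) <= e / r * D.
  by rewrite modcM ler_wpM2r.
have h6 := modcD (P.[x] - P.[y] - P`_1 * (x - y)) ((f (a + x) - P.[x]) - (f (a + y) - P.[y])).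
have h7 := modc_sub (f (a + x) - P.[x]) (f (a + y) - P.[y]).
have -> : 4 * M * t / r ^+ 2 * D + (2 + D / r + 4 * t / r ^+ 2 * D) * e =
  4 * (M + e) * t / r ^+ 2 * D + e + e + e / r * D by ring.
lra.
Qed.

(** The first nonzero Taylor coefficient is the leading one; if all of them are 0,
    the Taylor expansion says that [f] vanishes. *)
Lemma approx_order f a r : 0 < r -> approx f a r ->
  (forall x, modc x <= r / 2 -> f (a + x) = 0) \/
  exists k c K, [/\ c != 0, 0 <= K & forall x, modc x <= r / 2 ->
    modc (f (a + x) - c * x ^+ k) <= K * modc x ^+ k.+1].
Proof.
move=> r0 hf; have [M M0 hM] := approx_bdd (ltW r0) hf.
have [[k hk]|all0] := pselect (exists k, tc f a r k != 0).
  right; have hex : exists k, tc f a r k != 0 by exists k.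
  case: (ex_minnP hex) => {hex hk}k hk kmin.
  exists k, (tc f a r k), (2 * M / r ^+ k.+1); split => //.
    by rewrite !mulr_ge0 ?invr_ge0 ?exprn_ge0 // ltW.
  move=> x xr; have := taylor k.+1 r0 hf hM xr.
  rewrite big_ord_recr /= big1 ?add0r => [|i _].
    by rewrite expr_div_n -(mulrA (2 * M)) [_^-1 * _]mulrC.
  apply/eqP; rewrite mulf_eq0; apply/orP; left; apply/negPn/negP => /kmin.
  by rewrite leqNgt ltn_ord.
left => x xr; apply: modc_le_eps => e e0; rewrite subr0.
have [m hm] := half_small (2 * M) e0; apply: le_trans hm.
have := taylor m r0 hf hM xr; rewrite big1 ?subr0 => [h|i _]; last first.
  apply/eqP; rewrite mulf_eq0; apply/orP; left; apply/negPn/negP => hi.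
  by apply: all0; exists i.
apply: (le_trans h); by apply: ler_wpM2l; [lra|exact: ratio_le_half].
Qed.

(** The leading term dominates near [a], so zeros are isolated. *)
Lemma approx_zero_dichotomy f a r : 0 < r -> approx f a r ->
  (forall x, modc x <= r / 2 -> f (a + x) = 0) \/
  exists2 s : R, 0 < s & forall x, x != 0 -> modc x <= s -> f (a + x) != 0.
Proof.
move=> r0 hf; have [|[k [c [K [c0 K0 h]]]]] := approx_order r0 hf; first by left.
right; have cp : 0 < modc c by rewrite modc_gt0.
have K1 : 0 < 2 * (K + 1) by lra.
exists (Num.min (r / 2) (modc c / (2 * (K + 1)))).
  by rewrite lt_min; apply/andP; split; [lra|rewrite divr_gt0].
move=> x x0; rewrite le_min => /andP [xr]; rewrite ler_pdivlMr // => xc.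
apply: contraTneq isT => fx; exfalso.
have := h x xr; rewrite fx sub0r modcN modcM modcX exprS.
have xk : 0 < modc x ^+ k by rewrite exprn_gt0 // modc_gt0.
rewrite mulrA ler_pM2r // leNgt => /negP; apply.
by have := modc_ge0 x; nra.
Qed.

(** By [poly_fejer] a value of modulus [M] at the centre leaves no room for the
    other Taylor coefficients. *)
Lemma approx_max f a r M : 0 < r -> approx f a r ->
  (forall x, modc x <= r -> modc (f (a + x)) <= M) -> modc (f a) = M ->
  forall x, modc x <= r / 2 -> f (a + x) = f a.
Proof.
move=> r0 hf hM fa x xr.
have fc0 k : tc f a r k.+1 = 0.
  apply/eqP; rewrite -modc_eq0 eq_le modc_ge0 andbT.
  have rk : 0 < r ^+ k.+1 by rewrite exprn_gt0.
  rewrite -(ler_pM2r rk) mul0r.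
  apply: (@le_lin_eps _ _ _ 8) => // e e0.
  have [P hP] := hf _ e0.
  have hPM := approx_poly_bound hM hP.
  have h1 : modc (tc f a r k.+1) * r ^+ k.+1 <= modc P`_k.+1 * r ^+ k.+1 + e.
    have := tc_near k.+1 r0 hM hP; rewrite -ler_pdivlMr // => h.
    have := modcD (tc f a r k.+1 - P`_k.+1) P`_k.+1; rewrite subrK => h'.
    rewrite -ler_pdivlMr // mulrDl mulfK ?gt_eqF //; lra.
  have h2 : M - e <= modc P`_0.
    have h0 : modc 0 <= r by rewrite modc0 ltW.
    have := hP 0 h0; rewrite addr0 horner_coef0 => h.
    by have := modcD (f a - P`_0) P`_0; rewrite subrK fa; lra.
  have h3 : modc P`_0 + modc P`_k.+1 * r ^+ k.+1 / 2 <= M + e.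
    exact: (poly_fejer lam_mod lam_irr).
  lra.
have h0 : modc 0 <= r / 2 by rewrite modc0; lra.
have t0 : f a = tc f a r 0.
  have := taylor 1 r0 hf hM h0; rewrite addr0 big_ord1 expr0 mulr1 modc0 mul0r expr1 mulr0.
  move=> h; apply: modc_le_eps => e e0; exact: le_trans h (ltW e0).
apply: modc_le_eps => e e0.
have [m hm] := half_small (2 * M) e0.
have M0 : 0 <= M by rewrite -fa modc_ge0.
have := taylor m.+1 r0 hf hM xr; rewrite big_ord_recl /= big1 => [|i _]; last first.
  by rewrite fc0 mul0r.
rewrite addr0 expr0 mulr1 -t0 => h; apply: (le_trans h); apply: le_trans hm.
have q0 : 0 <= modc x / r by rewrite divr_ge0 ?modc_ge0 ?ltW.
have q1 : modc x / r <= 2^-1 by rewrite ler_pdivrMr // mulrC.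
have h5 : (modc x / r) ^+ m <= 2^-1 ^+ m by exact: ratio_le_half.
have h6 : 0 <= (modc x / r) ^+ m by rewrite exprn_ge0.
rewrite exprS; apply: ler_wpM2l; first lra.
by apply: le_trans h5; rewrite ler_piMl //; lra.
Qed.

(** Connectedness in the form in which it is used: a predicate that is locally
    constant on [V] and holds somewhere holds everywhere. *)
Definition econn (V : set R[i]) := forall S : set R[i],
  (exists2 a, V a & S a) ->
  (forall a, V a -> S a -> exists2 r : R, 0 < r & forall x, modc x <= r -> V (a + x) -> S (a + x)) ->
  (forall a, V a -> ~ S a -> exists2 r : R, 0 < r & forall x, modc x <= r -> V (a + x) -> ~ S (a + x)) ->
  V `<=` S.

(** The set of points around which [f] vanishes identically is open, and so is its
    complement, because zeros are isolated. *)
Lemma approx_identity (V : set R[i]) f a0 r0 : econn V ->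
  (forall a, V a -> exists2 r : R, 0 < r & (forall x, modc x <= r -> V (a + x)) /\ approx f a r) ->
  V a0 -> 0 < r0 -> (forall x, modc x <= r0 -> f (a0 + x) = 0) ->
  forall a, V a -> f a = 0.
Proof.
move=> cV hf Va0 r00 fa0.
pose S := [set a | exists2 r : R, 0 < r & forall x, modc x <= r -> f (a + x) = 0].
suff sub : V `<=` S.
  by move=> a /sub [r r1 h]; rewrite -[a]addr0; apply: h; rewrite modc0 ltW.
apply: cV; first by exists a0 => //; exists r0.
- move=> a _ [r r1 h]; exists (r / 2); first lra.
  move=> x xr _; exists (r / 2); first lra.
  by move=> y yr; rewrite -addrA; apply: h; have := modcD x y; lra.
- move=> a Va nSa; have [r r1 [rV fr]] := hf a Va.
  have [h|[s s0 h]] := approx_zero_dichotomy r1 fr.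
    by exfalso; apply: nSa; exists (r / 2) => //; lra.
  exists s => // x xs _ [t t0 ht].
  have [x0|x0] := eqVneq x 0.
    by apply: nSa; exists t => // y yt; have := ht y yt; rewrite x0 addr0.
  have := h x x0 xs; rewrite -[a + x]addr0 ht ?eqxx // modc0; lra.
Qed.

End Taylor.

(** * Linearization by averaging *)

Section Linearization.
Variable R : realType.
Variable lam : R[i].
Hypothesis lam_mod : modc lam = 1.
Hypothesis lam_irr : forall k, lam ^+ k.+1 != 1.
Implicit Types (x y z a xi : R[i]) (r e M K : R) (f g : R[i] -> R[i]).
Variable P : {poly R[i]}.
Hypothesis P0 : P.[0] = 0.
Hypothesis P1 : P`_1 = lam.

Let p := horner P.
Definition iterpoly n := iter n (fun Q => P \Po Q) 'X.

Lemma iterpolyE n z : iter n p z = (iterpoly n).[z].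
Proof. by elim: n => [|n IH] /=; rewrite ?hornerX // horner_comp -IH. Qed.

Lemma iter_p0 n : iter n p 0 = 0.
Proof. by elim: n => //= n ->; exact: P0. Qed.

Lemma iterpoly_coef1 n : (iterpoly n)`_1 = lam ^+ n.
Proof.
have d (Q : {poly R[i]}) : Q`_1 = Q^`().[0] by rewrite horner_coef0 coef_deriv.
rewrite d; elim: n => [|n IH] /=; first by rewrite derivX hornerC.
rewrite deriv_comp hornerM horner_comp IH -iterpolyE iter_p0 -d P1.
by rewrite exprS.
Qed.

(** If [phi] conjugates [p] to the rotation by [lam] and the identity is a power
    series [\sum_m b_m * phi ^+ m], then this mean extracts the term of index [m]. *)
Definition cm m z := mean (fun n => (lam ^- m) ^+ n * iter n p z).

Lemma cm_bdd m z (B : R) : (forall n, modc (iter n p z) <= B) ->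
  bdd (fun n => (lam ^- m) ^+ n * iter n p z).
Proof.
move=> h; exists B => n.
by rewrite modcM modcX (lamXV_mod lam_mod) expr1n mul1r.
Qed.

Lemma cm_semiconj m z (B : R) : (forall n, modc (iter n p z) <= B) ->
  cm m (p z) = lam ^+ m * cm m z.
Proof.
move=> h; rewrite /cm -(mean_shift (cm_bdd m h)) -meanZ.
  congr mean; apply/funext => n; rewrite exprS -iterSr -!mulrA [RHS]mulrA.
  by rewrite divff ?mul1r //; apply: lamX_neq0.
have [M hM] := cm_bdd m h; by exists M => n; exact: hM.
Qed.

Lemma order_le0 (A K s : R) k : 0 < s -> 
  (forall t, 0 < t -> t <= s -> A * t ^+ k <= K * t ^+ k.+1) -> A <= 0.
Proof.
move=> s0 h; rewrite leNgt; apply/negP => A0.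
have K1 : 0 < 2 * (`|K| + 1) by have := normr_ge0 K; lra.
pose t := Num.min s (A / (2 * (`|K| + 1))).
have t0 : 0 < t by rewrite lt_min s0 divr_gt0.
have ts : t <= s by rewrite ge_min lexx.
have tA : t * (2 * (`|K| + 1)) <= A by rewrite -ler_pdivlMr // ge_min lexx orbT.
have := h t t0 ts; rewrite exprS mulrA ler_pM2r ?exprn_gt0 // => hh.
have := ler_norm K; nra.
Qed.

Section Local.
Variables (r0 B : R).
Hypothesis r0_gt0 : 0 < r0.
Hypothesis orbB : forall n x, modc x <= r0 -> modc (iter n p x) <= B.

Lemma B_ge0 : 0 <= B.
Proof.
have h0 : modc (0 : R[i]) <= r0 by rewrite modc0 ltW.
exact: le_trans (modc_ge0 _) (orbB 0 h0).
Qed.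

(** All the iterates satisfy the same bound on the disc of radius [r0], so they are
    uniformly close to their linear parts. *)
Lemma iter_p_lin n x y (t : R) : modc x <= t -> modc y <= t -> t <= r0 / 4 ->
  modc (iter n p x - iter n p y - lam ^+ n * (x - y)) <=
    4 * B * t / r0 ^+ 2 * modc (x - y).
Proof.
move=> xt yt tr; rewrite !iterpolyE -iterpoly_coef1.
apply: (poly_diff lam_mod lam_irr) => // z zr; rewrite -iterpolyE; exact: orbB.
Qed.

Lemma iter_p_lin0 n x : modc x <= r0 / 4 ->
  modc (iter n p x - lam ^+ n * x) <= 4 * B / r0 ^+ 2 * modc x ^+ 2.
Proof.
move=> xr; have x0 : modc (0 : R[i]) <= modc x by rewrite modc0 modc_ge0.
have := iter_p_lin n (lexx _) x0 xr; rewrite iter_p0 !subr0.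
by move/le_trans; apply; rewrite le_eqVlt; apply/orP; left; apply/eqP; ring.
Qed.

(** [cm 1] averages [lam ^- n] times the iterates, whose linear part is the
    identity; it inherits the uniform bound of [iter_p_lin]. *)
Lemma phi_near x y (t : R) : modc x <= t -> modc y <= t -> t <= r0 / 4 ->
  modc (cm 1 x - cm 1 y - (x - y)) <= 4 * B * t / r0 ^+ 2 * modc (x - y).
Proof.
move=> xt yt tr; rewrite -[x - y in X in modc X](mean_cst (x - y)) /cm.
have xr : modc x <= r0 by have := modc_ge0 x; lra.
have yr : modc y <= r0 by have := modc_ge0 x; lra.
have bx := cm_bdd 1 (fun n => orbB n xr); have by_ := cm_bdd 1 (fun n => orbB n yr).
rewrite -meanB // -meanB; first 1 last.
- by apply: bddD => //; exact: bddN.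
- exact: bdd_cst.
apply: mean_bound => n; have := iter_p_lin n xt yt tr; apply: le_trans.
rewrite -[X in _ <= X]mul1r -(lamXV_mod lam_mod n) -modcM.
rewrite le_eqVlt; apply/orP; left; apply/eqP; congr modc.
have e1 : lam ^- n * lam ^+ n = 1 by rewrite mulVf // lamX_neq0.
rewrite expr1 exprVn; set u := iter n p x; set v := iter n p y.
transitivity (lam ^- n * (u - v) - (lam ^- n * lam ^+ n) * (x - y)).
  by rewrite e1 mul1r mulrBr.
by move: (lam ^- n) => c; ring.
Qed.

Lemma cm0 m : cm m 0 = 0.
Proof.
rewrite /cm -[RHS](mean_cst 0); congr mean; apply/funext => n.
by rewrite iter_p0 mulr0.
Qed.

Lemma phi_near0 x : modc x <= r0 / 4 -> modc (cm 1 x - x) <= 4 * B / r0 ^+ 2 * modc x ^+ 2.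
Proof.
move=> xr; have x0 : modc (0 : R[i]) <= modc x by rewrite modc0 modc_ge0.
have := phi_near (lexx _) x0 xr; rewrite cm0 !subr0.
by move/le_trans; apply; rewrite le_eqVlt; apply/orP; left; apply/eqP; ring.
Qed.

(** Along the orbit of a small [x] the function [f] is [c * (lam ^+ n * x) ^+ k] up
    to terms of higher order, so the mean of [lam ^- (k * n) * f (p ^ n x)] is
    [c * x ^+ k] up to higher order. It cannot vanish unless [c] does. *)
Lemma order_mean f k c K s : 0 < s -> c != 0 ->
  (forall x, modc x <= s -> modc (f x - c * x ^+ k) <= K * modc x ^+ k.+1) ->
  (forall x, modc x <= s -> mean (fun n => (lam ^- k) ^+ n * f (iter n p x)) = 0) ->
  False.
Proof.
move=> s0 c0 hf hm.
have K0 : 0 <= K.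
  have := hf s%:C; rewrite modc_real gtr0_norm // => /(_ (lexx _)) h.
  have sk : 0 < s ^+ k.+1 by rewrite exprn_gt0.
  by rewrite -(pmulr_lge0 _ sk); exact: le_trans (modc_ge0 _) h.
have B0 := B_ge0.
have [L LE] : exists L, L = 4 * B / r0 ^+ 2 by eexists.
have L0 : 0 <= L by rewrite LE !mulr_ge0 ?invr_ge0 ?exprn_ge0 // ltW.
have L1 : 0 < L + 1 by lra.
pose s1 := Num.min (Num.min (r0 / 4) (s / 2)) (L + 1)^-1.
have s1_gt0 : 0 < s1 by rewrite !lt_min invr_gt0 L1 !divr_gt0.
have s1r : s1 <= r0 / 4 by rewrite !ge_min lexx.
have s1s : s1 <= s / 2 by rewrite !ge_min lexx orbT.
have s1L : s1 * (L + 1) <= 1 by rewrite -ler_pdivlMr // div1r !ge_min lexx orbT.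
suff : modc c <= 0 by rewrite leNgt modc_gt0 c0.
pose K' := K * 2 ^+ k.+1 + modc c * L * 4 ^+ k.
apply: (@order_le0 _ K' s1 k s1_gt0) => t t0 ts1.
have mt : modc t%:C = t by rewrite modc_real gtr0_norm.
have key n : modc ((lam ^- k) ^+ n * f (iter n p t%:C) - c * t%:C ^+ k) <= K' * t ^+ k.+1.
  have tr : modc t%:C <= r0 / 4 by rewrite mt; lra.
  have h1 := iter_p_lin0 n tr; rewrite mt -LE in h1.
  set y := iter n p t%:C in h1 *.
  have ml : modc (lam ^+ n * t%:C) = t by rewrite modcM (lamX_mod lam_mod) mul1r mt.
  have h2 : modc y <= 2 * t.
    have := modcD (y - lam ^+ n * t%:C) (lam ^+ n * t%:C); rewrite subrK ml.
    have : L * t ^+ 2 <= t by rewrite expr2; nra.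
    by lra.
  have h3 : modc (f y - c * y ^+ k) <= K * (2 * t) ^+ k.+1.
    have ys : modc y <= s by lra.
    apply: (le_trans (hf y ys)); rewrite ler_wpM2l // lerXn2r ?nnegrE ?modc_ge0 //.
    lra.
  have h4 : modc (y ^+ k - (lam ^+ n * t%:C) ^+ k) <= L * 4 ^+ k * t ^+ k.+1.
    case: (k) => [|j]; first by rewrite !expr0 subrr modc0 !mulr_ge0 ?exprn_ge0 // ltW.
    have ml2 : modc (lam ^+ n * t%:C) <= 2 * t by rewrite ml; lra.
    apply: (le_trans (diffX_le j h2 ml2)).
    apply: (@le_trans _ _ (L * t ^+ 2 * (2 * (2 * t)) ^+ j)).
      by rewrite ler_wpM2r // exprn_ge0 //; lra.
    rewrite mulrA (_ : 2 * 2 = 4 :> R) ?exprMn; last by ring.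
    have -> : L * t ^+ 2 * (4 ^+ j * t ^+ j) = L * 4 ^+ j * t ^+ j.+2.
      by rewrite [t ^+ j.+2]exprS [t ^+ j.+1]exprS; ring.
    apply: ler_wpM2r; first by rewrite exprn_ge0 // ltW.
    apply: ler_wpM2l => //; rewrite exprS.
    have : (0 : R) <= 4 ^+ j by exact: exprn_ge0.
    by lra.
  have -> : (lam ^- k) ^+ n * f y - c * t%:C ^+ k =
     (lam ^- k) ^+ n * ((f y - c * y ^+ k) + c * (y ^+ k - (lam ^+ n * t%:C) ^+ k)).
    have e1 : (lam ^- k) ^+ n * (lam ^+ n) ^+ k = 1.
      by rewrite exprVn -!exprM mulnC mulVf // lamX_neq0.
    rewrite exprMn mulrDr mulrBr.
    have -> : (lam ^- k) ^+ n * (c * (y ^+ k - (lam ^+ n) ^+ k * t%:C ^+ k)) =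
      (lam ^- k) ^+ n * (c * y ^+ k) - ((lam ^- k) ^+ n * (lam ^+ n) ^+ k) * (c * t%:C ^+ k).
      by ring.
    by rewrite e1 mul1r addrA subrK.
  rewrite modcM modcX (lamXV_mod lam_mod) expr1n mul1r.
  apply: (le_trans (modcD _ _)); rewrite modcM /K' mulrDl; apply: lerD.
    by apply: (le_trans h3); rewrite exprMn mulrA.
  by rewrite -!mulrA ler_wpM2l ?modc_ge0 // mulrA.
have ts : modc t%:C <= s by rewrite mt; lra.
have bf : bdd (fun n => (lam ^- k) ^+ n * f (iter n p t%:C)).
  exists (K' * t ^+ k.+1 + modc (c * t%:C ^+ k)) => n.
  have := modcD ((lam ^- k) ^+ n * f (iter n p t%:C) - c * t%:C ^+ k) (c * t%:C ^+ k).
  by rewrite subrK; have := key n; lra.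
have := mean_bound key; rewrite meanB //; last exact: bdd_cst.
by rewrite hm // mean_cst sub0r modcN modcM modcX mt.
Qed.

End Local.

End Linearization.

(** * Density of the orbits of an irrational rotation *)

Section Density.
Variable R : realType.
Variable lam : R[i].
Hypothesis lam_mod : modc lam = 1.
Hypothesis lam_irr : forall k, lam ^+ k.+1 != 1.

(** If all [lam ^+ n] had distance at least [e] to [zeta], the geometric sums
    [Q (lam ^+ n) = \sum_(j < M.+1) (lam ^+ n / zeta) ^+ j] would be bounded by [2 / e]
    for every [M]. The coefficient of degree [M] of [Q ^+ 2], being a mean over the
    orbit, would then be at most [(2 / e) ^+ 2], but its modulus is [M.+1]. *)
Lemma lam_dense (zeta : R[i]) (e : R) : modc zeta = 1 -> 0 < e ->
  exists n, modc (lam ^+ n - zeta) <= e.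
Proof.
move=> z1 e0; apply: contrapT => nex.
have far n : e < modc (lam ^+ n - zeta).
  by rewrite ltNge; apply/negP => h; apply: nex; exists n.
have z0 : zeta != 0 by rewrite -modc_gt0 z1.
have [M hM] := harmonic_small (2 / e * (2 / e) + 1) (@ltr01 R).
pose Q : {poly R[i]} := \poly_(j < M.+1) zeta ^- j.
have QE x : Q.[x] = \sum_(j < M.+1) (x / zeta) ^+ j.
  by rewrite horner_poly; apply: eq_bigr => j _; rewrite expr_div_n mulrC.
have QB n : modc Q.[lam ^+ n] <= 2 / e.
  have l1 : modc (lam ^+ n / zeta) = 1 by rewrite modcM modcV z1 (lamX_mod lam_mod) invr1 mulr1.
  have h : modc (lam ^+ n / zeta - 1) * modc Q.[lam ^+ n] <= 2.
    rewrite QE -modcM -subrX1; apply: (le_trans (modc_sub _ _)).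
    by rewrite modcX l1 expr1n modc1.
  have e1 : modc (lam ^+ n / zeta - 1) = modc (lam ^+ n - zeta).
    have -> : lam ^+ n / zeta - 1 = (lam ^+ n - zeta) / zeta by field.
    by rewrite modcM modcV z1 invr1 mulr1.
  rewrite e1 in h; rewrite ler_pdivlMr //.
  by have := far n; have := modc_ge0 Q.[lam ^+ n]; nra.
have QM : (Q ^+ 2)`_M = M.+1%:R * zeta ^- M.
  rewrite expr2 coefM (eq_bigr (fun=> zeta ^- M)) => [|j _].
    by rewrite sumr_const card_ord mulr_natl.
  have jM : (j <= M)%N by rewrite -ltnS.
  rewrite !coef_poly ltn_ord ltnS leq_subr -invfM -exprD.
  by rewrite addnC subnK.
have : modc (fc lam (horner (Q ^+ 2)) 1 M) <= 2 / e * (2 / e).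
  apply: mean_bound => n; rewrite modcM modcX (lamXV_mod lam_mod) expr1n mulr1.
  by rewrite mul1r horner_exp expr2 modcM; apply: ler_pM; rewrite ?modc_ge0 ?QB.
rewrite (fc_poly lam_mod lam_irr) QM expr1n mulr1 modcM modc_nat modcV modcX z1.
rewrite expr1n invr1 mulr1 => h.
have := hM M (leqnn M); rewrite ler_pdivrMr ?ltr0n // mul1r => h'.
by have := le_trans h' h; lra.
Qed.

End Density.

(** * Siegel discs *)

Section Siegel.
Variable R : realType.
Variable lam : R[i].
Hypothesis lam_mod : modc lam = 1.
Hypothesis lam_irr : forall k, lam ^+ k.+1 != 1.
Implicit Types (x y z a xi : R[i]) (r e K : R) (f g : R[i] -> R[i]).
Variable P : {poly R[i]}.
Hypothesis P0 : P.[0] = 0.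
Hypothesis P1 : P`_1 = lam.
Let p := horner P.

Variables (V : set R[i]) (B r0 : R).
Hypothesis r0_gt0 : 0 < r0.
Hypothesis V_disc : forall x, modc x <= r0 -> V x.
Hypothesis V_open : forall a, V a -> exists2 r : R, 0 < r & forall x, modc x <= r -> V (a + x).
Hypothesis V_conn : econn V.
Hypothesis V_stable : forall z, V z -> V (p z).
Hypothesis V_bounded : forall z, V z -> modc z <= B.

Lemma V_iter n z : V z -> V (iter n p z).
Proof. by move=> Vz; elim: n => //= n; exact: V_stable. Qed.

Let orbB n x : V x -> modc (iter n p x) <= B.
Proof. by move=> Vx; apply/V_bounded/V_iter. Qed.

Let orbB0 n x : modc x <= r0 -> modc (iter n p x) <= B.
Proof. by move=> xr; apply/orbB/V_disc. Qed.

Local Notation cm := (cm lam P).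
Local Notation phi := (cm 1).

Lemma cm_bound m z : V z -> modc (cm m z) <= B.
Proof.
move=> Vz; apply: mean_bound => n.
by rewrite modcM modcX (lamXV_mod lam_mod) expr1n mul1r; exact: orbB.
Qed.

Lemma cm_semiconj_V m z : V z -> cm m (p z) = lam ^+ m * cm m z.
Proof. by move=> Vz; exact: (cm_semiconj lam_mod m (fun n => orbB n Vz)). Qed.

Lemma phi_iter n z : V z -> phi (iter n p z) = lam ^+ n * phi z.
Proof.
move=> Vz; elim: n => [|n IH] /=; first by rewrite mul1r.
by rewrite cm_semiconj_V ?IH ?expr1 ?exprS ?mulrA //; exact: V_iter.
Qed.

Lemma cm_iter m n z : V z -> cm m (iter n p z) = (lam ^+ m) ^+ n * cm m z.
Proof.
move=> Vz; elim: n => [|n IH] /=; first by rewrite mul1r.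
by rewrite cm_semiconj_V ?IH ?exprS ?mulrA //; exact: V_iter.
Qed.

Lemma cm_approx m a : V a ->
  exists2 r : R, 0 < r & (forall x, modc x <= r -> V (a + x)) /\ approx (cm m) a r.
Proof.
move=> Va; have [r r_gt0 hr] := V_open Va.
exists (r / 2); first lra; split; first by move=> x xr; apply: hr; lra.
apply: (@approx_mean _ _ _ _ B) => //; first by exists lam.
  move=> n; exists ((lam ^- m) ^+ n *: (iterpoly P n \Po ('X + a%:P))) => x.
  rewrite hornerZ horner_comp hornerD hornerX hornerC [x + a]addrC -iterpolyE //.
move=> n x xr; rewrite modcM modcX (lamXV_mod lam_mod) expr1n mul1r.
by apply/orbB/hr.
Qed.

Lemma cm_approx0 m : approx (cm m) 0 (r0 / 2).
Proof.
apply: (@approx_mean _ _ _ _ B) => //; first by exists lam.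
  move=> n; exists ((lam ^- m) ^+ n *: iterpoly P n) => x.
  by rewrite hornerZ add0r -iterpolyE.
move=> n x xr; rewrite modcM modcX (lamXV_mod lam_mod) expr1n mul1r add0r.
by apply: orbB0.
Qed.

Lemma V_0 : V 0.
Proof. by apply: V_disc; rewrite modc0 ltW. Qed.

Lemma mean_lam_scaled i k a : mean (fun n => (lam ^- k) ^+ n * ((lam ^+ i) ^+ n * a)) = (i == k)%:R * a.
Proof.
rewrite -(mean_lam lam_mod lam_irr i k) mulrC -meanZ.
  congr mean; apply/funext => n; rewrite exprMn; ring.
by apply: bddX; rewrite modcM (lamX_mod lam_mod) (lamXV_mod lam_mod) mulr1.
Qed.

(** By [order_mean], averaging kills a leading term of any other degree. *)
Lemma eigen_order f m s : 0 < s -> approx f 0 s -> s <= r0 ->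
  (forall n z, modc z <= s -> f (iter n p z) = (lam ^+ m) ^+ n * f z) ->
  exists b K, 0 <= K /\
    forall x, modc x <= s / 2 -> modc (f x - b * x ^+ m) <= K * modc x ^+ m.+1.
Proof.
move=> s0 hf sr hfm; have s2 : 0 < s / 2 by lra.
have [f0|[k [c [K [c0 K0 h]]]]] := approx_order lam_mod lam_irr s0 hf.
  exists 0, 0; split => // x xs; have := f0 x xs; rewrite add0r => ->.
  by rewrite !mul0r subr0 modc0.
have [km|km] := eqVneq m k.
  by exists c, K; split => // x xs; have := h x xs; rewrite add0r km.
exfalso; apply: (order_mean lam_mod lam_irr P0 P1 r0_gt0 orbB0 s2 c0 (k := k) (K := K) (f := f)).
  by move=> x xs; have := h x xs; rewrite add0r.
move=> x xs; have xs' : modc x <= s by lra.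
by under eq_fun do rewrite hfm //; rewrite mean_lam_scaled (negbTE km) mul0r.
Qed.

Lemma phi_nearK : exists2 K : R, 0 <= K & forall x, modc x <= r0 / 4 ->
  modc (phi x - x) <= K * modc x ^+ 2.
Proof.
exists (4 * B / r0 ^+ 2).
  have := B_ge0 r0_gt0 orbB0 => B0.
  by rewrite !mulr_ge0 // invr_ge0 exprn_ge0 // ltW.
exact: (phi_near0 lam_mod lam_irr P0 P1 r0_gt0 orbB0).
Qed.

Lemma phiX_near m : exists K s : R, [/\ 0 <= K, 0 < s & forall x, modc x <= s ->
  modc (phi x ^+ m - x ^+ m) <= K * modc x ^+ m.+1].
Proof.
have [K K0 hK] := phi_nearK; have K1 : 0 < K + 1 by lra.
exists (K * 4 ^+ m), (Num.min (r0 / 4) (K + 1)^-1); split.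
- by rewrite mulr_ge0 // exprn_ge0.
- by rewrite lt_min invr_gt0 K1 divr_gt0.
move=> x; rewrite le_min => /andP [xr]; rewrite -div1r ler_pdivlMr // => xK.
have h := hK x xr; have x0 := modc_ge0 x.
case: m => [|m]; first by rewrite !expr0 subrr modc0 !mulr_ge0.
have h2 : modc (phi x) <= 2 * modc x.
  have := modcD (phi x - x) x; rewrite subrK.
  have : K * modc x ^+ 2 <= modc x by rewrite expr2; nra.
  lra.
have h3 : modc x <= 2 * modc x by lra.
apply: (le_trans (diffX_le m h2 h3)).
apply: (@le_trans _ _ (K * modc x ^+ 2 * (2 * (2 * modc x)) ^+ m)).
  by rewrite ler_wpM2r // exprn_ge0 //; lra.
rewrite mulrA (_ : 2 * 2 = 4 :> R) ?exprMn; last by ring.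
have -> : K * modc x ^+ 2 * (4 ^+ m * modc x ^+ m) = K * 4 ^+ m * modc x ^+ m.+2.
  by rewrite [modc x ^+ m.+2]exprS [modc x ^+ m.+1]exprS; ring.
apply: ler_wpM2r; first exact: exprn_ge0.
apply: ler_wpM2l => //; rewrite exprS.
have : (0 : R) <= 4 ^+ m by exact: exprn_ge0.
lra.
Qed.

(** For a suitable [b] the difference [cm m - b * phi ^+ m] vanishes at 0 to an
    order larger than [m]; it is multiplied by [lam ^+ m] under [p], so that
    [order_mean] forces it to vanish near 0, hence on the connected set [V]. *)
Lemma cm_power m : exists b, forall z, V z -> cm m z = b * phi z ^+ m.
Proof.
have r2 : 0 < r0 / 2 by rewrite divr_gt0.
have r2r : r0 / 2 <= r0 by lra.
have [b [K [K0 hb]]] : exists b K, 0 <= K /\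
    forall x, modc x <= r0 / 2 / 2 -> modc (cm m x - b * x ^+ m) <= K * modc x ^+ m.+1.
  apply: (eigen_order r2 (cm_approx0 m) r2r) => n z zr.
  by apply/cm_iter/V_disc; lra.
exists b; pose g z := cm m z - b * phi z ^+ m.
have ga0 : approx g 0 (r0 / 2).
  apply: approxB; [exact: ltW|exact: cm_approx0|].
  by apply/approxZ/approxX/cm_approx0; apply: ltW.
have gm n z : V z -> g (iter n p z) = (lam ^+ m) ^+ n * g z.
  move=> Vz; rewrite /g cm_iter // phi_iter // exprMn -!exprM [(n * m)%N]mulnC; ring.
have [K2 [s [K20 s0 hs]]] := phiX_near m.
suff [g0|] : (forall x, modc x <= r0 / 2 / 2 -> g (0 + x) = 0) \/ False.
- have ident z : V z -> g z = 0.
    apply: (approx_identity lam_mod lam_irr (V := V) (f := g) (a0 := 0) (r0 := r0 / 2 / 2)).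
    + exact: V_conn.
    + move=> a Va; have [r r_gt0 [hr ha]] := cm_approx m Va.
      have [r' r'_gt0 [hr' ha']] := cm_approx 1 Va.
      have m_gt0 : 0 < Num.min r r' by rewrite lt_min r_gt0.
      exists (Num.min r r') => //; split.
        by move=> x; rewrite le_min => /andP [xr _]; exact: hr.
      apply: approxB; first exact: ltW.
        by apply: approxS ha _; rewrite ge_min lexx.
      apply: approxZ; first exact: ltW.
      apply: approxX; first exact: ltW.
      by apply: approxS ha' _; rewrite ge_min lexx orbT.
    + exact: V_0.
    + lra.
    + exact: g0.
  by move=> z /ident /eqP; rewrite subr_eq0 => /eqP.
- by [].
have [f0|[k [c [K' [c0 K'0 h]]]]] := approx_order lam_mod lam_irr r2 ga0; first by left.
right.
have [km|km] := eqVneq m k; last first.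
  apply: (order_mean lam_mod lam_irr P0 P1 r0_gt0 orbB0 (s := r0 / 2 / 2) (k := k) (K := K') (f := g) _ c0).
  - lra.
  - by move=> x xs; have := h x xs; rewrite add0r.
  - move=> x xs; have Vx : V x by apply: V_disc; lra.
    by under eq_fun do rewrite gm //; rewrite mean_lam_scaled (negbTE km) mul0r.
move: h; rewrite -km => h {km}.
suff : modc c <= 0 by rewrite leNgt modc_gt0 c0.
have s1 : 0 < Num.min s (r0 / 2 / 2) by rewrite lt_min s0 !divr_gt0.
apply: (@order_le0 _ _ (K' + K + modc b * K2) _ m s1) => t t0.
rewrite le_min => /andP [ts tr].
have mt : modc t%:C = t by rewrite modc_real gtr0_norm.
rewrite -mt in ts tr.
have h1 := h _ tr; have h2 := hb _ tr; have h3 := hs _ ts.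
rewrite add0r mt in h1; rewrite mt in h2 h3.
have -> : modc c * t ^+ m = modc (c * t%:C ^+ m) by rewrite modcM modcX mt.
have -> : c * t%:C ^+ m = (cm m t%:C - b * t%:C ^+ m) - b * (phi t%:C ^+ m - t%:C ^+ m)
   - (g t%:C - c * t%:C ^+ m) by rewrite /g; ring.
have := modc_sub ((cm m t%:C - b * t%:C ^+ m) - b * (phi t%:C ^+ m - t%:C ^+ m)) (g t%:C - c * t%:C ^+ m).
have := modc_sub (cm m t%:C - b * t%:C ^+ m) (b * (phi t%:C ^+ m - t%:C ^+ m)).
rewrite modcM !mulrDl.
have : modc b * modc (phi t%:C ^+ m - t%:C ^+ m) <= modc b * K2 * t ^+ m.+1.
  by rewrite -mulrA ler_wpM2l ?modc_ge0.
lra.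
Qed.

Lemma phi_nonconst c : ~ (forall z, V z -> phi z = c).
Proof.
move=> h; have [K K0 hK] := phi_nearK.
have K1 : 0 < 2 * (K + 1) by lra.
have c0 : c = 0 by rewrite -(h 0 V_0) (cm0 lam P0).
pose t := Num.min (r0 / 4) (2 * (K + 1))^-1.
have t0 : 0 < t by rewrite lt_min invr_gt0 K1 divr_gt0.
have mt : modc t%:C = t by rewrite modc_real gtr0_norm.
have tr : t <= r0 / 4 by rewrite ge_min lexx.
have tK : t * (2 * (K + 1)) <= 1 by rewrite -ler_pdivlMr // div1r ge_min lexx orbT.
have Vt : V t%:C by apply: V_disc; rewrite mt; lra.
have := hK t%:C; rewrite mt (h _ Vt) c0 sub0r modcN mt => /(_ tr).
rewrite expr2; nra.
Qed.

(** At a maximum of its modulus [phi] would be locally constant, hence constant on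
    [V], whereas it is close to the identity near 0. *)
Lemma phi_max a : V a -> exists2 z, V z & modc (phi a) < modc (phi z).
Proof.
move=> Va; apply: contrapT => nex.
have hle z : V z -> modc (phi z) <= modc (phi a).
  by move=> Vz; rewrite leNgt; apply/negP => h; apply: nex; exists z.
apply: (@phi_nonconst (phi a)) => z Vz.
have [r r_gt0 [hr ha]] := cm_approx 1 Va.
have hM x : modc x <= r -> modc (phi (a + x)) <= modc (phi a) by move=> xr; apply/hle/hr.
have hc := approx_max lam_mod lam_irr r_gt0 ha hM erefl.
apply/eqP; rewrite -subr_eq0; apply/eqP; move: z Vz.
apply: (approx_identity lam_mod lam_irr (f := fun z => phi z - phi a) (a0 := a) (r0 := r / 2) V_conn) => //.
- move=> b Vb; have [s s_gt0 [hs hb]] := cm_approx 1 Vb.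
  exists s => //; split => //; apply: approxB => //; [exact: ltW|exact: approx_cst].
- lra.
- by move=> x xr; rewrite hc // subrr.
Qed.

(** The coefficients of the power series of the inverse of [phi]: the [m]-th
    component of [z] under the rotation is [cm m z], a multiple of [phi z ^+ m]. *)
Definition bcoef m : R[i] := projT1 (cid (cm_power m)).

Lemma bcoefE m z : V z -> cm m z = bcoef m * phi z ^+ m.
Proof. by rewrite /bcoef; case: cid => b /=; exact. Qed.

(** The ultrafilter limit gives a total function; it is the sum of the power series
    wherever [psi_tail] applies. *)
Definition psi xi : R[i] :=
  xget 0 [set l | tends ultra_nat (fun M => \sum_(m < M) bcoef m * xi ^+ m) l].

Lemma q_small (q c e : R) : 0 <= q -> q < 1 -> 0 < e -> exists n, c * q ^+ n <= e.
Proof.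
move=> q0 q1 e0.
have bern n : q ^+ n * (1 + n%:R * (1 - q)) <= 1.
  elim: n => [|n IH]; first by rewrite mul0r addr0 mulr1.
  apply: le_trans IH; rewrite exprS [q * _]mulrC -mulrA.
  apply: ler_wpM2l; first exact: exprn_ge0.
  have n0 := ler0n R n; have := mulr_ge0 n0 (sqr_ge0 (1 - q)).
  by have := sqr_ge0 (1 - q); rewrite -natr1 !expr2; lra.
have [N hN] := harmonic_small (`|c| / (1 - q)) e0.
exists N.+1; have {hN} := hN N (leqnn N); have := bern N.+1.
have h1 : 0 < 1 - q by lra.
have h2 : 0 < N.+1%:R :> R by rewrite ltr0n.
have h3 : 0 <= q ^+ N.+1 by exact: exprn_ge0.
rewrite -mulrA -invfM => hb; apply: le_trans.
have h4 : 0 < (1 - q) * N.+1%:R by rewrite mulr_gt0.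
rewrite ler_pdivlMr //.
apply: (@le_trans _ _ (`|c| * (q ^+ N.+1 * ((1 - q) * N.+1%:R)))).
  rewrite -mulrA ler_wpM2r ?ler_norm // mulr_ge0 // ltW //.
rewrite -[X in _ <= X]mulr1 ler_wpM2l //.
by move: hb; rewrite mulrDr mulr1 [N.+1%:R * _]mulrC; lra.
Qed.

Lemma bcoef_bound m z : V z -> modc (bcoef m) * modc (phi z) ^+ m <= B.
Proof. by move=> Vz; rewrite -modcX -modcM -bcoefE //; exact: cm_bound. Qed.

(** The uniform bound on [cm m z] makes the series converge geometrically on the
    discs smaller than [|phi z|]. *)
Lemma psi_tail (q : R) M z xi : V z -> 0 <= q -> q < 1 -> modc xi <= q * modc (phi z) ->
  modc (psi xi - \sum_(m < M) bcoef m * xi ^+ m) <= B / (1 - q) * q ^+ M.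
Proof.
move=> Vz q0 q1 hxi.
have B0 : 0 <= B := B_ge0 r0_gt0 orbB0.
have q2 : 0 < 1 - q by lra.
have term m : modc (bcoef m * xi ^+ m) <= B * q ^+ m.
  rewrite modcM modcX; apply: (@le_trans _ _ (modc (bcoef m) * (q * modc (phi z)) ^+ m)).
    apply: ler_wpM2l; first exact: modc_ge0.
    by apply: lerXn2r; rewrite ?nnegrE ?modc_ge0 ?mulr_ge0 ?modc_ge0.
  by rewrite exprMn mulrCA mulrC ler_wpM2r ?exprn_ge0 // bcoef_bound.
have tail N : modc (\sum_(m < M + N) bcoef m * xi ^+ m - \sum_(m < M) bcoef m * xi ^+ m)
     <= B / (1 - q) * q ^+ M.
  rewrite big_split_ord /= addrAC subrr add0r; apply: (le_trans (modc_sum _ _ _)).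
  apply: (@le_trans _ _ (\sum_(i < N) B * q ^+ M * q ^+ i)).
    by apply: ler_sum => i _; apply: (le_trans (term _)); rewrite exprD mulrA.
  have -> : B / (1 - q) * q ^+ M = B * q ^+ M / (1 - q) by rewrite mulrAC.
  rewrite -mulr_sumr; apply: ler_wpM2l; first by rewrite mulr_ge0 // exprn_ge0.
  rewrite -[_^-1]div1r.
  rewrite ler_pdivlMr //; have := subrX1 q N; have := exprn_ge0 N q0.
  by move: (\sum_(i < N) _) => S; lra.
have ex : exists l, tends ultra_nat (fun M => \sum_(m < M) bcoef m * xi ^+ m) l.
  apply: (@ultra_cvg _ _ _ _ _ (B / (1 - q) * q ^+ M + modc (\sum_(m < M) bcoef m * xi ^+ m))).
  apply: (@ultra_nat_ge M) => n Mn /=.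
  have := tail (n - M)%N; rewrite subnKC // => h.
  have := modcD (\sum_(m < n) bcoef m * xi ^+ m - \sum_(m < M) bcoef m * xi ^+ m)
    (\sum_(m < M) bcoef m * xi ^+ m).
  by rewrite subrK; lra.
have hl : tends ultra_nat (fun M => \sum_(m < M) bcoef m * xi ^+ m) (psi xi).
  by rewrite /psi; case: xgetP => // h; case: ex => l hl; have := h l.
set S := \sum_(m < M) bcoef m * xi ^+ m.
have hc : tends ultra_nat (fun=> S) S by exact: tends_cst.
apply: (tends_le _ (tendsB hl hc)).
by apply: (@ultra_nat_ge M) => n Mn /=; have := tail (n - M)%N; rewrite subnKC.
Qed.

Lemma psi_approx z (rho : R) : V z -> 0 <= rho -> rho < modc (phi z) -> approx psi 0 rho.
Proof.
move=> Vz rho0 hrho e e0.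
have s0 : 0 < modc (phi z) by lra.
pose q := rho / modc (phi z).
have q0 : 0 <= q by rewrite divr_ge0 // modc_ge0.
have q1 : q < 1 by rewrite ltr_pdivrMr // mul1r.
have [M hM] := q_small (B / (1 - q)) q0 q1 e0.
exists (\poly_(m < M) bcoef m) => x xr; rewrite add0r horner_poly.
apply: le_trans hM; apply: psi_tail Vz q0 q1 _.
by rewrite /q mulfVK // gt_eqF.
Qed.

Lemma mean_psi k z xi : V z -> modc xi < modc (phi z) ->
  mean (fun n => (lam ^- k) ^+ n * psi (lam ^+ n * xi)) = bcoef k * xi ^+ k.
Proof.
move=> Vz hxi; pose f x := psi (x * xi).
have fcE : mean (fun n => (lam ^- k) ^+ n * psi (lam ^+ n * xi)) = fc lam f 1 k.
  by rewrite /fc /f; congr mean; apply/funext => n; rewrite mulrC mul1r.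
have B0 : 0 <= B := B_ge0 r0_gt0 orbB0.
have s0 : 0 < modc (phi z) by have := modc_ge0 xi; lra.
pose q := modc xi / modc (phi z).
have q0 : 0 <= q by rewrite divr_ge0 // modc_ge0.
have q1 : q < 1 by rewrite ltr_pdivrMr // mul1r.
have hx x : modc x <= 1 -> modc (x * xi) <= q * modc (phi z).
  by move=> x1; rewrite /q mulfVK ?gt_eqF // modcM ler_piMl ?modc_ge0.
rewrite fcE; apply: modc_le_eps => e e0.
have [M0 hM0] := q_small (B / (1 - q)) q0 q1 e0.
pose M := maxn M0 k.+1.
have hM : B / (1 - q) * q ^+ M <= e.
  apply: le_trans hM0; apply: ler_wpM2l; first by rewrite divr_ge0 //; lra.
  by apply: ler_wiXn2l => //; [exact: ltW|exact: leq_maxl].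
pose Q := \poly_(m < M) (bcoef m * xi ^+ m).
have hQ x : modc x <= 1 -> modc (f x - Q.[x]) <= e.
  move=> x1; apply: le_trans hM; rewrite /f horner_poly.
  have := psi_tail M Vz q0 q1 (hx x x1).
  congr (modc (_ - _) <= _); apply: eq_bigr => m _; rewrite exprMn; ring.
have hB x : modc x <= 1 -> modc (f x) <= B / (1 - q) * q ^+ 0.
  by move=> x1; have := psi_tail 0 Vz q0 q1 (hx x x1); rewrite big_ord0 subr0.
have := fc_near lam_mod k ler01 hB hQ.
rewrite (fc_poly lam_mod lam_irr) expr1n mulr1 coef_poly.
by rewrite leq_maxr.
Qed.

(** Since [|phi|] has no maximum, [phi a] lies strictly inside a disc where [psi]
    converges. *)
Lemma comp_approx a : V a -> exists2 r : R, 0 < r &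
  (forall x, modc x <= r -> V (a + x)) /\ approx (fun z => psi (phi z)) a r.
Proof.
move=> Va; have [z Vz az] := phi_max Va.
pose rho := (modc (phi a) + modc (phi z)) / 2.
have a0 := modc_ge0 (phi a).
have rho0 : 0 <= rho by rewrite /rho; lra.
have rho1 : rho < modc (phi z) by rewrite /rho; lra.
have [r r_gt0 [hr ha]] := cm_approx 1 Va.
have e0 : 0 < rho - modc (phi a) by rewrite /rho; lra.
have [d d0 hd] := approx_cont r_gt0 ha e0.
have m_gt0 : 0 < Num.min r d by rewrite lt_min r_gt0.
exists (Num.min r d) => //; split.
  by move=> x; rewrite le_min => /andP [xr _]; exact: hr.
apply: (approx_comp (ltW m_gt0) (psi_approx Vz rho0 rho1)).
  by apply: approxS ha _; rewrite ge_min lexx.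
move=> x; rewrite le_min subr0 => /andP [_ xd].
by have := modcD (phi (a + x) - phi a) (phi a); have := hd x xd; rewrite subrK; lra.
Qed.

(** The defect [z - psi (phi z)] has no leading term at 0: averaging along an orbit
    gives [cm k] for the first part and [bcoef k * phi ^+ k] for the second, and these
    agree. By the identity theorem it vanishes on [V]. *)
Lemma psi_phi z : V z -> psi (phi z) = z.
Proof.
pose d z := z - psi (phi z).
have dA a : V a -> exists2 r : R, 0 < r & (forall x, modc x <= r -> V (a + x)) /\ approx d a r.
  move=> /comp_approx [r r_gt0 [hr ha]]; exists r => //; split => //.
  by apply: approxB => //; [exact: ltW|exact: approx_id].
suff [s s0 hs] : exists2 s : R, 0 < s & forall x, modc x <= s -> d (0 + x) = 0.
  move=> Vz; have : d z = 0 by apply: (approx_identity lam_mod lam_irr V_conn dA V_0 s0 hs).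
  by move/eqP; rewrite subr_eq0 => /eqP.
have [r r_gt0 [hr ha]] := dA 0 V_0.
have [d0|[k [c [K [c0 K0 h]]]]] := approx_order lam_mod lam_irr r_gt0 ha.
  by exists (r / 2) => //; lra.
exfalso; have [z1 Vz1 hz1] := phi_max V_0.
rewrite (cm0 lam P0) modc0 in hz1.
have e0 : 0 < modc (phi z1) / 2 by lra.
have r2 : 0 < r0 / 2 by rewrite divr_gt0.
have [s s0 hs] := approx_cont r2 (cm_approx0 1) e0.
have m_gt0 : 0 < Num.min (r / 2) s by rewrite lt_min s0 divr_gt0.
apply: (order_mean lam_mod lam_irr P0 P1 r0_gt0 orbB0 (s := Num.min (r / 2) s) (k := k) (K := K) (f := d) m_gt0 c0).
  by move=> x; rewrite le_min => /andP [xr _]; have := h x xr; rewrite add0r.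
move=> x; rewrite le_min => /andP [xr xs].
have Vx : V x by rewrite -[x]add0r; apply: hr; lra.
have hx : modc (phi x) < modc (phi z1).
  by have := hs x xs; rewrite add0r (cm0 lam P0) subr0; lra.
rewrite (_ : (fun n => _) = fun n => (lam ^- k) ^+ n * iter n p x -
   (lam ^- k) ^+ n * psi (lam ^+ n * phi x)); last first.
  by apply/funext => n; rewrite /d phi_iter // mulrBr.
rewrite meanB; first 1 last.
- exact: (cm_bdd lam_mod k (fun n => orbB n Vx)).
- have B0 : 0 <= B := B_ge0 r0_gt0 orbB0.
  have s1 : 0 < modc (phi z1) by have := modc_ge0 (phi x); lra.
  pose q := modc (phi x) / modc (phi z1).
  have q0 : 0 <= q by rewrite divr_ge0 // modc_ge0.
  have q1 : q < 1 by rewrite ltr_pdivrMr // mul1r.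
  exists (B / (1 - q) * q ^+ 0) => n.
  rewrite modcM modcX (lamXV_mod lam_mod) expr1n mul1r.
  have hq : modc (lam ^+ n * phi x) <= q * modc (phi z1).
    by rewrite modcM (lamX_mod lam_mod) mul1r /q mulfVK // gt_eqF.
  by have := psi_tail 0 Vz1 q0 q1 hq; rewrite big_ord0 subr0.
by rewrite (mean_psi k Vz1 hx) -bcoefE // subrr.
Qed.

Lemma psi_cont z xi : V z -> modc xi < modc (phi z) ->
  exists2 r : R, 0 < r & approx psi xi r.
Proof.
move=> Vz hxi; exists ((modc (phi z) - modc xi) / 2); first lra.
have h0 : 0 <= (modc (phi z) + modc xi) / 2 by have := modc_ge0 xi; lra.
have h1 : (modc (phi z) + modc xi) / 2 < modc (phi z) by lra.
by rewrite -[xi]add0r; apply: approx_shift (psi_approx Vz h0 h1) _; rewrite add0r; lra.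
Qed.

Let T := [set xi | V (psi xi) /\ phi (psi xi) = xi].

Lemma phi_T z : V z -> T (phi z).
Proof. by move=> Vz; split; rewrite psi_phi. Qed.

(** [phi (psi x) - x] vanishes at the points [phi (a + y)] for small [y], and these
    accumulate at [xi] without being equal to it; so it vanishes near [xi]. *)
Lemma T_open xi : T xi -> exists2 r : R, 0 < r & forall x, modc x <= r -> T (xi + x).
Proof.
move=> [Vp hp]; set a := psi xi in Vp hp.
have [z Vz az] := phi_max Vp; rewrite hp in az.
have [r1 r1_gt0 h1] := psi_cont Vz az.
have [r2 r2_gt0 [hr2 h2]] := cm_approx 1 Vp.
have [r3 r3_gt0 h3] := approx_cont r1_gt0 h1 r2_gt0.
set r := Num.min r1 r3.
have r_gt0 : 0 < r by rewrite lt_min r1_gt0.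
have inV x : modc x <= r -> V (psi (xi + x)).
  rewrite le_min => /andP [_ xr]; have := hr2 _ (h3 x xr).
  by rewrite (addrC a) subrK.
have hG : approx (fun x => phi (psi x) - x) xi r.
  apply: approxB; [exact: ltW| |exact: approx_id].
  apply: (approx_comp (ltW r_gt0) h2).
    by apply: approxS h1 _; rewrite ge_min lexx.
  by move=> x; rewrite le_min => /andP [_ xr]; exact: h3.
have [G0|[s s0 hs]] := approx_zero_dichotomy lam_mod lam_irr r_gt0 hG.
  exists (r / 2); first lra.
  move=> x xr; split; first by apply: inV; lra.
  by apply/eqP; rewrite -subr_eq0; apply/eqP/G0.
exfalso; have [d d0 hd] := approx_cont r2_gt0 h2 s0.
pose y : R[i] := (Num.min d r2)%:C.
have my : modc y = Num.min d r2.
  by rewrite modc_real gtr0_norm // lt_min d0.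
have y0 : y != 0 by rewrite -modc_gt0 my lt_min d0.
have Vy : V (a + y) by apply: hr2; rewrite my ge_min lexx orbT.
have yd : modc y <= d by rewrite my ge_min lexx.
have ne : phi (a + y) - xi != 0.
  rewrite subr_eq0; apply: contraNneq y0 => e.
  have := psi_phi Vy; rewrite e -/a => /eqP.
  by rewrite -subr_eq0 opprD addrA subrr sub0r oppr_eq0.
have := hd y yd; rewrite hp => le.
have := hs _ ne le; rewrite (addrC xi) subrK psi_phi // subrr eqxx //.
Qed.

Lemma T_rot n xi : T xi -> T (lam ^+ n * xi).
Proof.
move=> [Vp hp]; have := phi_iter n Vp; rewrite hp => <-; exact/phi_T/V_iter.
Qed.

(** As [V] is connected, [|phi|] takes the value [|xi|] at some [w]. The points in
    the image of [phi] form an open set invariant under the rotation by [lam], and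
    [phi w] can be rotated by powers of [lam] arbitrarily close to [xi]. *)
Lemma phi_onto xi z : V z -> modc xi < modc (phi z) -> T xi.
Proof.
move=> Vz hxi; have [->|xi0] := eqVneq xi 0.
  by rewrite -(cm0 lam P0 1); apply/phi_T/V_0.
have [w [Vw hw]] : exists w, V w /\ modc (phi w) = modc xi.
  apply: contrapT => nex.
  have cont a : V a -> modc (phi a) != modc xi -> exists2 d : R, 0 < d &
      forall x, modc x <= d -> (modc (phi (a + x)) < modc xi) = (modc (phi a) < modc xi).
    move=> Va ne; have [r r_gt0 [hr ha]] := cm_approx 1 Va.
    have e0 : 0 < `|modc (phi a) - modc xi| / 2.
      by rewrite divr_gt0 // normr_gt0 subr_eq0.
    have [d d0 hd] := approx_cont r_gt0 ha e0.
    exists d => // x xd; have := hd x xd.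
    have := modc_dist (phi (a + x)) (phi a).
    move: (modc (phi (a + x))) (modc (phi a)) (modc xi) (modc (_ - _)) ne => A C D E ne.
    case: (ltgtP C D) ne => // CD _.
      rewrite (ltr0_norm (_ : C - D < 0)); last by lra.
      rewrite ler_norml => /andP [_ h1] h2; apply/idP; lra.
    rewrite (gtr0_norm (_ : 0 < C - D)); last by lra.
    rewrite ler_norml => /andP [h1 _] h2; apply/negP/negP; rewrite -leNgt; lra.
  have ne a : V a -> modc (phi a) != modc xi.
    by move=> Va; apply/eqP => e; apply: nex; exists a.
  have /(_ z Vz) /= : V `<=` [set a | modc (phi a) < modc xi].
    apply: V_conn.
    - by exists 0; [exact: V_0|rewrite /= (cm0 lam P0) modc0 modc_gt0].
    - move=> a Va /= Sa; have [d d0 hd] := cont a Va (ne a Va).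
      by exists d => // x xd _; rewrite hd.
    - move=> a Va /= Sa; have [d d0 hd] := cont a Va (ne a Va).
      by exists d => // x xd _; rewrite hd.
  by rewrite ltNge ltW.
have pw0 : phi w != 0 by rewrite -modc_gt0 hw modc_gt0.
pose zeta := xi / phi w.
have z1 : modc zeta = 1 by rewrite modcM modcV hw divff // modc_eq0.
have [r r_gt0 hr] := T_open (phi_T Vw).
have mpos : 0 < modc (phi w) by rewrite modc_gt0.
have [n hn] := lam_dense lam_mod lam_irr z1 (divr_gt0 r_gt0 mpos).
have l0 := lamX_neq0 lam_mod n.
have := hr ((zeta / lam ^+ n - 1) * phi w).
have -> : phi w + (zeta / lam ^+ n - 1) * phi w = zeta / lam ^+ n * phi w by ring.
have -> : zeta / lam ^+ n - 1 = (zeta - lam ^+ n) / lam ^+ n by field.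
rewrite modcM [modc (_ / _)]modcM (lamXV_mod lam_mod) mulr1 modcB -ler_pdivlMr //.
move=> /(_ hn) /(T_rot n).
have -> // : lam ^+ n * (zeta / lam ^+ n * phi w) = xi.
by rewrite /zeta; field; rewrite l0 pw0.
Qed.

(** The radius is the supremum of [|phi|], which by [phi_max] is not attained. *)
Theorem siegel_disk : exists (s : R) (f g : R[i] -> R[i]),
  [/\ 0 < s, f 0 = 0,
      forall z, V z -> [/\ modc (f z) < s, g (f z) = z & f (p z) = lam * f z],
      forall xi, modc xi < s -> V (g xi) /\ f (g xi) = xi &
      (forall a, V a -> exists2 r : R, 0 < r & approx f a r) /\
      (forall xi, modc xi < s -> exists2 r : R, 0 < r & approx g xi r)].
Proof.
pose E := [set t : R | exists2 z, V z & t = modc (phi z)].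
have supE : has_sup E.
  split; first by exists (modc (phi 0)), 0 => //; exact: V_0.
  by exists B => t [z Vz ->]; exact: cm_bound.
have lts z : V z -> modc (phi z) < sup E.
  move=> Vz; have [z' Vz' h] := phi_max Vz; apply: lt_le_trans h _.
  by apply: ub_le_sup; [exact: supE.2|exists z'].
have lte xi : modc xi < sup E -> exists2 z, V z & modc xi < modc (phi z).
  by move=> h; have [t [z Vz ->] ht] := sup_gt supE.1 h; exists z.
exists (sup E), phi, psi; split.
- by apply: le_lt_trans (lts 0 V_0); exact: modc_ge0.
- exact: cm0.
- move=> z Vz; split; [exact: lts|exact: psi_phi|].
  by rewrite cm_semiconj_V // expr1.
- by move=> xi /lte [z Vz h]; exact: phi_onto h.
- split; first by move=> a Va; have [r r_gt0 [_ ha]] := cm_approx 1 Va; exists r.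
  by move=> xi /lte [z Vz h]; exact: psi_cont h.
Qed.

End Siegel.

(** * Stability of linearizable germs *)

Section Stability.
Variable R : realType.
Implicit Types (x y z a w : R[i]) (r e K : R) (f g : R[i] -> R[i]).

Lemma nbhs_modcP (a : (R[i] : numClosedFieldType)) (A : set R[i]) :
  nbhs a A <-> exists2 d : R, 0 < d & forall x, modc (x - a) <= d -> A x.
Proof.
split.
- move=> /nbhs_ballP [e /= e0 h].
  have eE : e = (complex.Re e)%:C by rewrite RRe_real // realE ltW.
  have d0 : 0 < complex.Re e by rewrite -ltcR -eE.
  exists (complex.Re e / 2); first by rewrite divr_gt0.
  move=> x hx; apply: h; rewrite -ball_normE /= distrC modcE eE ltcR.
  by apply: le_lt_trans hx _; lra.
- move=> [d d0 h]; apply/nbhs_ballP; exists d%:C => /=; first by rewrite ltcR.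
  move=> x; rewrite -ball_normE /= distrC modcE ltcR => hx; apply: h; exact: ltW.
Qed.

Lemma derivable_cont (f : (R[i] : numClosedFieldType) -> (R[i] : numClosedFieldType)) : derivable f 0 1 -> forall e : R, 0 < e ->
  exists2 d : R, 0 < d & forall x, modc x <= d -> modc (f x - f 0) <= e.
Proof.
move=> /derivable1_diffP/differentiable_continuous hc e e0.
have : nbhs (f 0 : (R[i] : numClosedFieldType)) [set y | modc (y - f 0) <= e] by apply/nbhs_modcP; exists e.
move=> /hc /nbhs_modcP [d d0 h]; exists d => // x xd; apply: h; by rewrite subr0.
Qed.

(** Orbits lie on circles in the coordinate [phi]. They stay small because [psi] is
    continuous at 0, as long as [psi] inverts [phi] at the next point; the bound on [f]
    ensures this. *)
Lemma linearizable_stable f mu : modc mu = 1 ->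
  (forall x, modc x <= 1 -> modc (f x) <= 2 * modc x) ->
  linearizable f mu -> forall e, 0 < e ->
  exists2 d : R, 0 < d & forall x, modc x <= d -> forall n, modc (iter n f x) <= e.
Proof.
move=> mu1 f2 [phi [psi [[phi0 psi0] hd hK hf]]] e' e'0.
have [dphi dpsi] := nbhs_singleton hd.
have /nbhs_modcP [r r0 hr] : nbhs (0 : (R[i] : numClosedFieldType)) [set z | phi (f z) = mu * phi z].
  exact: hf.
have /nbhs_modcP [s s0 hs] : nbhs (0 : (R[i] : numClosedFieldType)) [set z | psi (phi z) = z].
  by apply: filterS hK => z [].
pose e := Num.min (Num.min e' r) (Num.min (s / 2) 1).
have e0 : 0 < e by rewrite !lt_min e'0 r0 ltr01 divr_gt0.
have ee' : e <= e' by rewrite !ge_min lexx.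
have er : e <= r by rewrite !ge_min lexx orbT.
have es : 2 * e <= s by have : e <= s / 2 by [rewrite !ge_min lexx !orbT]; lra.
have e1 : e <= 1 by rewrite !ge_min lexx !orbT.
have [k k0 hk] := derivable_cont dpsi e0; rewrite psi0 in hk.
have [d d0 hd'] := derivable_cont dphi k0; rewrite phi0 in hd'.
have d1 : 0 < Num.min d e by rewrite lt_min d0.
exists (Num.min d e) => // x; rewrite le_min => /andP [xd xe] n.
suff : modc (iter n f x) <= e /\ modc (phi (iter n f x)) <= k by move=> [h _]; lra.
elim: n => [|n [IH1 IH2]] /=.
  by split => //; have := hd' x xd; rewrite subr0.
set y := iter n f x in IH1 IH2 *.
have h1 : modc (phi (f y)) <= k.
  by rewrite hr ?subr0 ?modcM ?mu1 ?mul1r //; lra.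
split => //.
have y1 : modc y <= 1 by lra.
have h2 := f2 y y1.
have <- : psi (phi (f y)) = f y by apply: hs; rewrite subr0; lra.
by have := hk _ h1; rewrite subr0.
Qed.

End Stability.

(** * The skew product *)

Section SkewMap.
Variable R : realType.
Variable lam : R[i].
Implicit Types (x y z w : R[i]).

Definition pz z := lam * z + z ^+ 3.
Definition qw z w := lam^-1 * (w + z * w ^+ 2) + w ^+ 3.
Definition skew (x : R[i] * R[i]) := (pz x.1, qw x.1 x.2).

Definition ppoly : {poly R[i]} := lam *: 'X + 'X^3.
Definition qpoly : {poly R[i]} := lam^-1 *: 'X + 'X^3.

Lemma ppolyE z : ppoly.[z] = pz z.
Proof. by rewrite /ppoly hornerD hornerZ hornerXn hornerX. Qed.

Lemma qpolyE w : qpoly.[w] = qw 0 w.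
Proof. by rewrite /qpoly hornerD hornerZ hornerXn hornerX /qw mul0r addr0. Qed.

Lemma iter_skew1 n (x : R[i] * R[i]) : (iter n skew x).1 = iter n pz x.1.
Proof. by elim: n => //= n ->. Qed.

Lemma iter_skew20 n z : (iter n skew (z, 0)).2 = 0.
Proof. by elim: n => //= n ->; rewrite /qw expr0n mulr0 addr0 mulr0 expr0n addr0. Qed.

Lemma iter_skew02 n w : (iter n skew (0, w)).2 = iter n (qw 0) w.
Proof.
elim: n => //= n ->; congr qw; rewrite iter_skew1 /=.
by elim: n => //= n ->; rewrite /pz mulr0 expr0n addr0.
Qed.

End SkewMap.

(** * The parabolic basin *)

Section Basin.
Variable R : realType.
Implicit Types (x y z w : R[i]).

Definition near1 (s : R) x := modc (x - 1) <= s.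

Lemma near1M s t x y : near1 s x -> near1 t y -> near1 (s + t + s * t) (x * y).
Proof.
rewrite /near1 => hx hy.
have -> : x * y - 1 = (x - 1) + (y - 1) + (x - 1) * (y - 1) by ring.
have := modcD ((x - 1) + (y - 1)) ((x - 1) * (y - 1)).
have := modcD (x - 1) (y - 1).
have : modc ((x - 1) * (y - 1)) <= s * t by rewrite modcM ler_pM ?modc_ge0.
lra.
Qed.

Lemma near1V (s t : R) x : s < 1 -> s <= t * (1 - s) -> near1 s x -> x != 0 /\ near1 t x^-1.
Proof.
rewrite /near1 => s1 st hx.
have h : 1 - s <= modc x.
  by have := modcD (1 - x) x; rewrite subrK modc1 (modcB 1); lra.
have x0 : x != 0 by rewrite -modc_gt0; lra.
split => //.
have -> : x^-1 - 1 = (1 - x) / x by field.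
rewrite modcM modcV modcB ler_pdivrMr ?modc_gt0 //.
have s0 := le_trans (modc_ge0 _) hx.
have t0 : 0 <= t by nra.
nra.
Qed.

Lemma near1_le s t x : s <= t -> near1 s x -> near1 t x.
Proof. by rewrite /near1 => st h; exact: le_trans st. Qed.

(** The map [U |-> U * (1 + U * Y)] has a parabolic fixed point at 0: in the
    coordinate [- 1 / U] it is nearly the translation by 1. *)
Lemma parabolic_step (U Y : R[i]) : U != 0 -> modc U <= 1 / 10 -> near1 (1 / 10) Y ->
  exists d, near1 (1 / 4) d /\ - (U * (1 + U * Y))^-1 = - U^-1 + d.
Proof.
rewrite /near1 => U0 hU hY.
have hY' : modc Y <= 11 / 10 by have := modcD (Y - 1) 1; rewrite subrK modc1; lra.
have hUY : modc (U * Y) <= 11 / 100.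
  rewrite modcM; apply: (@le_trans _ _ (1 / 10 * (11 / 10))); last lra.
  by apply: ler_pM; rewrite ?modc_ge0.
have D : 89 / 100 <= modc (1 + U * Y).
  have := modc_sub (1 + U * Y) (U * Y).
  by rewrite (_ : 1 + U * Y - U * Y = 1) ?modc1; [lra|ring].
have D0 : 1 + U * Y != 0 by rewrite -modc_gt0; lra.
exists (Y / (1 + U * Y)); split; last by field; rewrite U0 D0.
have -> : Y / (1 + U * Y) - 1 = ((Y - 1) - U * Y) / (1 + U * Y) by field.
rewrite modcM modcV ler_pdivrMr ?modc_gt0 //.
have := modc_sub (Y - 1) (U * Y); lra.
Qed.

Definition near_id (f : R[i] -> R[i]) (eps : R) :=
  forall x y, modc x <= 2 * eps -> modc y <= 2 * eps ->
    modc (f x - f y - (x - y)) <= 1 / 100 * modc (x - y).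

Lemma near_id_ratio f (eps : R) z : 0 < eps -> near_id f eps -> f 0 = 0 ->
  z != 0 -> modc z <= 2 * eps -> near1 (1 / 100) (f z / z).
Proof.
move=> e0 hf f0 z0 hz; have h0 : modc (0 : R[i]) <= 2 * eps by rewrite modc0; lra.
have := hf _ _ hz h0; rewrite f0 !subr0 /near1.
have -> : f z / z - 1 = (f z - z) / z by field.
by rewrite modcM modcV ler_pdivrMr ?modc_gt0.
Qed.

Lemma near_id_lower f (eps : R) w : 0 < eps -> near_id f eps -> f 0 = 0 ->
  modc w <= 2 * eps -> modc w * (99 / 100) <= modc (f w).
Proof.
move=> e0 hf f0 hw; have h0 : modc (0 : R[i]) <= 2 * eps by rewrite modc0; lra.
have := hf _ _ hw h0; rewrite f0 !subr0 => h.
by have := modcD (w - f w) (f w); rewrite subrK (modcB w); lra.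
Qed.

Variable lam : R[i].
Hypothesis lam_mod : modc lam = 1.
Variables (phi chi : R[i] -> R[i]) (eps : R).
Hypothesis eps0 : 0 < eps.
Hypothesis eps1 : eps <= 1 / 10.
Hypothesis phi0 : phi 0 = 0.
Hypothesis chi0 : chi 0 = 0.
Hypothesis phi_near : near_id phi eps.
Hypothesis chi_near : near_id chi eps.
Hypothesis phi_eq : forall z, modc z <= eps -> phi (pz lam z) = lam * phi z.
Hypothesis chi_eq : forall w, modc w <= eps -> chi (qw lam 0 w) = lam^-1 * chi w.

Lemma qw_small z w : modc z <= eps -> modc w <= eps -> modc (qw lam z w) <= 2 * eps.
Proof.
have e0 := eps0; have e1' := eps1.
move=> hz hw; rewrite /qw; have z0 := modc_ge0 z; have w0 := modc_ge0 w.
have := modcD (lam^-1 * (w + z * w ^+ 2)) (w ^+ 3).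
have := modcD w (z * w ^+ 2).
rewrite !modcX !modcM (lamV_mod lam_mod) mul1r.
have h2 : modc w ^+ 2 <= eps / 10 by rewrite expr2; nra.
have h4 : 0 <= modc w ^+ 2 by rewrite exprn_ge0.
have h3 : modc w ^+ 3 <= eps / 10 * eps by rewrite exprSr ler_pM.
have h5 : modc z * modc w ^+ 2 <= eps * (eps / 10) by rewrite ler_pM.
nra.
Qed.

(** The multipliers of the two coordinates cancel in [phi z * chi w], and the
    resonant term [z * w ^+ 2] contributes the square of this product. *)
Lemma product_step z w : z != 0 -> w != 0 -> modc z <= eps -> modc w <= eps ->
  exists Y, near1 (1 / 10) Y /\
    phi (pz lam z) * chi (qw lam z w) = phi z * chi w * (1 + phi z * chi w * Y).
Proof.
have e0 := eps0; have e1' := eps1.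
move=> z0 w0 hz hw.
have hz2 : modc z <= 2 * eps by lra.
have hw2 : modc w <= 2 * eps by lra.
have [pz0 hphi] : phi z / z != 0 /\ near1 (1 / 50) (phi z / z)^-1.
  by apply: near1V (near_id_ratio eps0 phi_near phi0 z0 hz2); lra.
have [cw0 hchi] : chi w / w != 0 /\ near1 (1 / 50) (chi w / w)^-1.
  by apply: near1V (near_id_ratio eps0 chi_near chi0 w0 hw2); lra.
have p0 : phi z != 0 by apply: contraNneq pz0 => ->; rewrite mul0r.
have c0 : chi w != 0 by apply: contraNneq cw0 => ->; rewrite mul0r.
have hsm0 : modc (0 : R[i]) <= eps by rewrite modc0; lra.
have hb := qw_small hsm0 hw; have ha := qw_small hz hw.
have e1 : qw lam z w - qw lam 0 w = lam^-1 * (z * w ^+ 2).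
  by rewrite /qw mul0r addr0; ring.
have mE : modc (lam^-1 * (z * w ^+ 2)) = modc (z * w ^+ 2) by rewrite [LHS]modcM (lamV_mod lam_mod) mul1r.
have := chi_near ha hb; rewrite e1 chi_eq // mE.
set E := (X in modc X) => hE.
have m0 : z * w ^+ 2 != 0 by rewrite mulf_neq0 // expf_neq0.
(* [E] is the deviation of [chi] from the translation by the resonant term. *)
exists ((1 + lam * E / (z * w ^+ 2)) * (phi z / z)^-1 * (chi w / w)^-1 * (chi w / w)^-1).
split.
  have h1 : near1 (1 / 100) (1 + lam * E / (z * w ^+ 2)).
    rewrite /near1 addrAC subrr add0r modcM modcV modcM lam_mod mul1r.
    by rewrite ler_pdivrMr ?modc_gt0.
  apply: near1_le (near1M (near1M (near1M h1 hphi) hchi) hchi); lra.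
have -> : chi (qw lam z w) = lam^-1 * chi w + lam^-1 * (z * w ^+ 2) + E by rewrite /E; ring.
by rewrite phi_eq //; field; rewrite ?w0 ?z0 ?p0 ?c0 ?(lam_neq0 lam_mod).
Qed.

(** In the coordinate [X = - 1 / (phi z * chi w)] every step is within 1/4 of 1, so
    [X] stays within [(c + n) / 2] of [c + n] at time [n]. The modulus of [phi z] is
    constant along the orbit; hence [w] is [O(1 / n)], and this keeps the orbit in the
    domain of the coordinates. *)
Lemma basin_orbit z w (c : R) : (forall n, modc (iter n (pz lam) z) <= eps) ->
  modc w <= eps -> phi z != 0 -> 20 <= c -> 4 <= eps * c * modc (phi z) ->
  modc (- (phi z * chi w)^-1 - c%:C) <= c / 2 ->
  forall n, modc ((iter n (skew lam) (z, w)).2) <= eps /\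
    modc ((iter n (skew lam) (z, w)).2) * modc (phi z) <= 4 / (c + n%:R).
Proof.
have e0 := eps0; have e1' := eps1.
move=> hz hw p0 c20 hc hX.
have z0 : z != 0 by apply: contraNneq p0 => ->; rewrite phi0.
have phi_it n : phi (iter n (pz lam) z) = lam ^+ n * phi z.
  by elim: n => [|n IH] /=; rewrite ?mul1r // phi_eq // IH exprS mulrA.
have phi_mod n : modc (phi (iter n (pz lam) z)) = modc (phi z).
  by rewrite phi_it modcM modcX lam_mod expr1n mul1r.
have pp : 0 < modc (phi z) by rewrite modc_gt0.
pose ph n := phi (iter n (pz lam) z).
pose wn n := (iter n (skew lam) (z, w)).2.
pose X n := - (ph n * chi (wn n))^-1.
have cons n : modc (wn n) <= 2 * eps ->
    modc (X n - (c + n%:R)%:C) <= (c + n%:R) / 2 ->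
    [/\ modc (ph n * chi (wn n)) <= 2 / (c + n%:R), ph n * chi (wn n) != 0 &
        modc (wn n) * modc (phi z) <= 4 / (c + n%:R)].
  move=> hwn hXn; set t := c + n%:R in hXn *.
  have t20 : 20 <= t by have := ler0n R n; rewrite /t; lra.
  have hXt : t / 2 <= modc (X n).
    have := modcD (t%:C - X n) (X n); rewrite subrK modcB modc_real.
    by rewrite ger0_norm; lra.
  have U0 : ph n * chi (wn n) != 0.
    apply: contraTneq hXt; rewrite /X => ->; rewrite invr0 oppr0 modc0 -ltNge; lra.
  have hU : modc (ph n * chi (wn n)) <= 2 / t.
    move: hXt; rewrite /X modcN modcV => h.
    rewrite ler_pdivlMr; last lra.
    have Up : 0 < modc (ph n * chi (wn n)) by rewrite modc_gt0.
    move: h Up; set m := modc (_ * _) => h Up.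
    by move: h; rewrite -[m^-1]mul1r ler_pdivlMr //; lra.
  split => //.
  have := near_id_lower eps0 chi_near chi0 hwn; move: hU; rewrite modcM /ph phi_mod => hU hchi.
  have h : modc (wn n) * (99 / 100) * modc (phi z) <= 2 / t.
    by apply: le_trans hU; rewrite mulrC ler_wpM2l // ltW.
  have : 4 / t = 2 * (2 / t) by ring.
  have : 0 <= modc (wn n) * modc (phi z) by rewrite mulr_ge0 ?modc_ge0.
  by rewrite mulrAC in h; lra.
suff main n : modc (wn n) <= eps /\ modc (X n - (c + n%:R)%:C) <= (c + n%:R) / 2.
  move=> n; have [h1 h2] := main n; split; first exact: h1.
  have h3 : modc (wn n) <= 2 * eps by apply: (le_trans h1); rewrite -[X in X <= _]mul1r ler_wpM2r ?ler1n // ltW.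
  by have [_ _ h] := cons n h3 h2.
elim: n => [|n [IH1 IH2]]; first by split => //; rewrite addr0.
have IH1' : modc (wn n) <= 2 * eps by lra.
have [hU U0 hwp] := cons n IH1' IH2.
set t := c + n%:R in IH2 hU hwp.
have t20 : 20 <= t by have := ler0n R n; rewrite /t; lra.
have wn0 : wn n != 0 by apply: contraNneq U0 => ->; rewrite chi0 mulr0.
have zn0 : iter n (pz lam) z != 0 by apply: contraNneq U0; rewrite /ph => ->; rewrite phi0 mul0r.
have wS : wn n.+1 = qw lam (iter n (pz lam) z) (wn n) by rewrite /wn /= iter_skew1.
have [Y [hY e1]] := product_step zn0 wn0 (hz n) IH1.
have hU10 : modc (ph n * chi (wn n)) <= 1 / 10.
  apply: (le_trans hU); rewrite ler_pdivrMr; lra.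
have [d [hd e2]] := parabolic_step U0 hU10 hY.
have XS : X n.+1 = X n + d by rewrite /X -e2 wS /ph /= e1.
have w2 : modc (wn n.+1) <= 2 * eps by rewrite wS; apply: qw_small.
have hXS : modc (X n.+1 - (c + n.+1%:R)%:C) <= (c + n.+1%:R) / 2.
  rewrite XS -natr1 addrA -/t rmorphD /= rmorph1.
  have -> : X n + d - (t%:C + 1) = (X n - t%:C) + (d - 1) by ring.
  have := modcD (X n - t%:C) (d - 1); move: hd; rewrite /near1; lra.
split => //.
have [_ _ h] := cons n.+1 w2 hXS.
rewrite -(ler_pM2r pp); apply: (le_trans h).
have tc : c <= c + n.+1%:R by rewrite lerDl.
rewrite ler_pdivrMr; last lra.
apply: (le_trans hc); rewrite mulrAC -!mulrA ler_wpM2l ?ler_wpM2l ?modc_ge0 //; exact: ltW.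
Qed.

(** For [w] close to [- conj z] the product [phi z * chi w] is close to [- |z|^2], on
    the attracting side of the parabolic point. *)
Lemma basin_start z w : z != 0 -> modc z <= eps / 10 ->
  (forall n, modc (iter n (pz lam) z) <= eps) -> modc (w + (conjc z)) <= modc z / 10 ->
  forall n, modc ((iter n (skew lam) (z, w)).2) <= eps /\
    modc ((iter n (skew lam) (z, w)).2) * modc z <= 5 / n.+1%:R.
Proof.
have e0 := eps0; have e1' := eps1.
move=> z0 hz hit hw.
have zp : 0 < modc z by rewrite modc_gt0.
have wz : modc w <= 11 / 10 * modc z.
  have := modc_sub (w + (conjc z)) (conjc z); rewrite addrK modc_conj; lra.
have weps : modc w <= eps by lra.
have zc0 : (conjc z) != 0 by rewrite -modc_gt0 modc_conj.
have w0 : w != 0.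
  apply: contraTneq hw => ->; rewrite add0r modc_conj -ltNge; lra.
have hz2 : modc z <= 2 * eps by lra.
have hw2 : modc w <= 2 * eps by lra.
have plow := near_id_lower eps0 phi_near phi0 hz2.
have p0 : phi z != 0 by rewrite -modc_gt0; lra.
(* [- 1 / (phi z * chi w)] is close to [1 / |z|^2] when [w] is close to [- conj z]. *)
pose c := (modc z ^+ 2)^-1.
have z2p : 0 < modc z ^+ 2 by rewrite exprn_gt0.
have cz2 : c * modc z ^+ 2 = 1 by rewrite /c mulVf // gt_eqF.
have c20 : 20 <= c.
  rewrite /c -div1r ler_pdivlMr // expr2; nra.
have hc : 4 <= eps * c * modc (phi z).
  have h1 : 10 * modc z <= eps by lra.
  have h2 : eps * c * (modc z * (99 / 100)) <= eps * c * modc (phi z).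
    by rewrite ler_wpM2l // mulr_ge0 ?ltW //; lra.
  apply: le_trans h2.
  have : 10 * modc z * (c * modc z) <= eps * (c * modc z).
    by rewrite ler_wpM2r // mulr_ge0 //; lra.
  have : 10 * modc z * (c * modc z) = 10 by rewrite -[RHS]mulr1 -cz2 expr2; ring.
  lra.
have near_w : near1 (1 / 10) (- (w / (conjc z))).
  rewrite /near1 (_ : - (w / (conjc z)) - 1 = - (w + (conjc z)) / (conjc z)); last by field.
  by rewrite modcM modcV modcN modc_conj ler_pdivrMr //; lra.
have start : modc (- (phi z * chi w)^-1 - c%:C) <= c / 2.
  have zz : z * (conjc z) = (modc z ^+ 2)%:C by rewrite -sqr_normc modcE rmorphXn.
  have h := near1M (near1M near_w (near_id_ratio eps0 phi_near phi0 z0 hz2)) (near_id_ratio eps0 chi_near chi0 w0 hw2).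
  have h8 : near1 (1 / 8) (- (w / (conjc z)) * (phi z / z) * (chi w / w)).
    by apply: near1_le h; lra.
  have [_ h'] : - (w / (conjc z)) * (phi z / z) * (chi w / w) != 0 /\
      near1 (1 / 7) (- (w / (conjc z)) * (phi z / z) * (chi w / w))^-1.
    by apply: near1V h8; lra.
  have -> : - (phi z * chi w)^-1 - c%:C =
     c%:C * ((- (w / (conjc z)) * (phi z / z) * (chi w / w))^-1 - 1).
    have -> : c%:C = (z * (conjc z))^-1 by rewrite zz /c fmorphV.
    have cw0 : chi w != 0.
      have wp : 0 < modc w by rewrite modc_gt0.
      by rewrite -modc_gt0; have := near_id_lower eps0 chi_near chi0 hw2; lra.
    by field; rewrite ?z0 ?w0 ?zc0 ?p0 ?cw0.
  rewrite modcM modc_real ger0_norm; last lra.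
  apply: ler_wpM2l; first lra.
  by apply: (le_trans h'); lra.
move=> n; have [h1 h2] := basin_orbit hit weps p0 c20 hc start n; split => //.
have := modc_ge0 ((iter n (skew lam) (z, w)).2); move: h1 h2; set v := modc _ => h1 h2 v0.
have h3 : v * (modc z * (99 / 100)) <= 4 / (c + n%:R) by apply: le_trans h2; rewrite ler_wpM2l.
have h4 : 4 / (c + n%:R) <= 4 / n.+1%:R.
  have n0 := ler0n R n; have n1 : n%:R + 1 = n.+1%:R :> R by rewrite natr1.
  have le1 : n.+1%:R <= c + n%:R by rewrite -n1; lra.
  have cn : 0 < c + n%:R by lra.
  by apply: ler_wpM2l => //; rewrite lef_pV2 ?posrE ?ltr0n.
have : 0 <= n.+1%:R^-1 :> R by rewrite invr_ge0.
move: h4 h3; move: (n.+1%:R^-1) (4 / (c + n%:R)) => u k; lra.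
Qed.

End Basin.

(** * The affine chart of the projective plane *)

Section Chart.
Variable R : realType.
Local Notation C := (R[i] : numClosedFieldType).
Local Notation P2 := (P2 C).
Implicit Types (x y a : R[i] * R[i]) (p q : P2) (e r M : R).

Definition chordc p (i j : 'I_3) : R[i] := P2_chord p i j.

(** Closeness in the entries of the orthogonal projectors, which define the uniform
    structure of [P2]. *)
Definition cclose e p q := forall i j, modc (chordc p i j - chordc q i j) <= e.

Lemma P2_entourageP (A : set (P2 * P2)) :
  entourage A <-> exists2 e : R, 0 < e & forall p q, cclose e p q -> A (p, q).
Proof.
split.
- move=> [B /= entB sBA].
  move: entB; rewrite -entourage_ballE => -[eps /= eps0 hB].
  have eE : eps = (complex.Re eps)%:C by rewrite RRe_real // realE ltW.
  have d0 : 0 < complex.Re eps by rewrite -ltcR -eE.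
  exists (complex.Re eps / 2); first by rewrite divr_gt0.
  move=> p q hpq; apply: sBA; apply: hB => /=; split=> // i j.
  rewrite -ball_normE /= modcE eE ltcR.
  by apply: le_lt_trans (hpq i j) _; lra.
- move=> [e e0 h]; exists [set MN : 'M[C]_3 * 'M[C]_3 | ball MN.1 e%:C MN.2].
    by rewrite -entourage_ballE; exists e%:C => //=; rewrite ltcR.
  move=> [p q] [/= _ hb]; apply: h => i j.
  by have := hb i j; rewrite -ball_normE /= modcE ltcR => /ltW.
Qed.

Lemma P2_nbhsP p (A : set P2) :
  nbhs p A <-> exists2 e : R, 0 < e & forall q, cclose e p q -> A q.
Proof.
rewrite -nbhs_entourageE; split.
- move=> [V /P2_entourageP [e e0 he] sV]; exists e => // q hq.
  by apply: sV; apply/mem_set; exact: he.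
- move=> [e e0 he]; exists [set pq | cclose e pq.1 pq.2].
    by apply/(P2_entourageP _).2; exists e; [exact: e0|move=> p' q' h; exact: h].
  by move=> q /set_mem hq; exact: he q hq.
Qed.

Definition vec x : 'rV[C]_3 := \row_j tnth [tuple x.1; x.2; 1] j.

Lemma vec_neq0 x : vec x != 0.
Proof.
apply/eqP => /rowP /(_ (2 : 'I_3)); rewrite !mxE (tnth_nth 0) /= => /eqP.
by rewrite oner_eq0.
Qed.

(** The affine chart [z : w : 1]. *)
Definition E x : P2 := P2_of (vec_neq0 x).

Lemma E_inj x y : E x = E y -> x = y.
Proof.
move=> /P2_of_eq [c c0 /rowP h].
have := h (2 : 'I_3); have := h (1 : 'I_3); have := h (0 : 'I_3).
rewrite !mxE !(tnth_nth 0) /= mulr1 => h0 h1 c1.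
by move: h0 h1; rewrite -c1 !mul1r; case: x {h} => u v; case: y => u' v' /= -> ->.
Qed.

Lemma Fmap_E (lam : R[i]) x : Fmap (lam : C) (E x) = E (skew lam x).
Proof.
rewrite /E Fmap_of; apply/P2_of_eq; exists 1; first exact: oner_neq0.
rewrite scale1r; apply/rowP => j; rewrite !mxE !(tnth_nth 0).
by case: j => -[|[|[|//]]] hj /=; rewrite ?expr1n ?mulr1.
Qed.

Lemma iter_Fmap_E (lam : R[i]) n x : iter n (Fmap (lam : C)) (E x) = E (iter n (skew lam) x).
Proof. by elim: n => //= n ->; rewrite Fmap_E. Qed.

(** The squared length of the lift [(z, w, 1)]; it is large near the line at
    infinity. *)
Definition sqn x : R := 1 + modc x.1 ^+ 2 + modc x.2 ^+ 2.

Lemma sqn_ge1 x : 1 <= sqn x.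
Proof.
rewrite /sqn; have := exprn_ge0 2 (modc_ge0 x.1).
have := exprn_ge0 2 (modc_ge0 x.2); lra.
Qed.

Definition hcoord x (i : 'I_3) : R[i] := nth 0 [:: x.1; x.2; 1] i.

Lemma vec_coord x i : vec x 0 i = hcoord x i.
Proof. by rewrite mxE (tnth_nth 0). Qed.

Lemma sum_vec x : \sum_k `|vec x 0 k| ^+ 2 = (sqn x)%:C :> C.
Proof.
rewrite !big_ord_recl big_ord0 !vec_coord /hcoord /= normr1 expr1n addr0.
rewrite !modcE /sqn !rmorphD !rmorphXn rmorph1 /=; ring.
Qed.

Lemma chord_E x i j : chordc (E x) i j = conjc (hcoord x i) * hcoord x j / (sqn x)%:C.
Proof. by rewrite /chordc P2_chord_of mxE sum_vec !vec_coord. Qed.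

Lemma affine_of_chord p : chordc p 2 2 != 0 -> exists x, p = E x.
Proof.
pose v := val (repr p); rewrite /chordc /P2_chord mxE -/v => h.
have v2 : v 0 2 != 0 by apply: contraNneq h => ->; rewrite mulr0 mul0r.
exists (v 0 0 / v 0 2, v 0 1 / v 0 2); rewrite [LHS]P2_ofE; apply/P2_of_eq.
exists (v 0 2) => //; apply/rowP => j; rewrite !mxE !(tnth_nth 0).
case: j => -[|[|[|//]]] hj /=; rewrite -/v.
- by rewrite mulrC divfK //; congr (v _ _); exact: val_inj.
- by rewrite mulrC divfK //; congr (v _ _); exact: val_inj.
- by rewrite mulr1; congr (v _ _); exact: val_inj.
Qed.

Lemma P2_chord_inj p q : (forall i j, chordc p i j = chordc q i j) -> p = q.
Proof.
move=> h; have {}h : line_proj (val (repr p)) = line_proj (val (repr q)) by apply/matrixP.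
rewrite [LHS]P2_ofE [RHS]P2_ofE; apply/P2_of_eq.
have hp := valP (repr p).
have := mul_line_projK hp; rewrite h mul_line_proj => e.
eexists; last by symmetry; exact: e.
by apply: contraNneq hp => h0; rewrite -e h0 scale0r.
Qed.

Opaque E chordc.

Lemma vec_bound x M i : 1 <= M -> modc x.1 <= M -> modc x.2 <= M -> modc (hcoord x i) <= M.
Proof.
move=> M1 h1 h2; rewrite /hcoord.
by case: i => -[|[|[|//]]] hj /=; rewrite ?modc1.
Qed.

Lemma vec_dist x y e i : 0 <= e -> modc (x.1 - y.1) <= e -> modc (x.2 - y.2) <= e ->
  modc (hcoord x i - hcoord y i) <= e.
Proof.
move=> M1 h1 h2; rewrite /hcoord.
by case: i => -[|[|[|//]]] hj /=; rewrite ?subrr ?modc0.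
Qed.

Lemma E_unif M e : 0 < e -> exists2 d : R, 0 < d & forall x y,
  modc x.1 <= M -> modc x.2 <= M -> modc y.1 <= M -> modc y.2 <= M ->
  modc (x.1 - y.1) <= d -> modc (x.2 - y.2) <= d -> cclose e (E x) (E y).
Proof.
move=> e0; pose N := `|M| + 1.
have N1 : 1 <= N by rewrite /N; have := normr_ge0 M; lra.
have MN : M <= N by rewrite /N; have := ler_norm M; lra.
have K0 : 0 < 2 * N + N * N * (4 * N).
  by rewrite addr_gt0 // !mulr_gt0 //; lra.
exists (e / (2 * N + N * N * (4 * N))); first by rewrite divr_gt0.
set d := e / _ => x y x1 x2 y1 y2 h1 h2 i j.
have dE : d * (2 * N + N * N * (4 * N)) = e by rewrite /d mulfVK // gt_eqF.
have d0 : 0 <= d by rewrite /d divr_ge0 // ltW.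
have xi k : modc (hcoord x k) <= N by apply: vec_bound => //; exact: le_trans MN.
have yi k : modc (hcoord y k) <= N by apply: vec_bound => //; exact: le_trans MN.
have di k : modc (hcoord x k - hcoord y k) <= d by exact: vec_dist.
rewrite (chord_E x) (chord_E y).
set s := sqn x; set t := sqn y.
have s1 : 1 <= s := sqn_ge1 x.
have t1 : 1 <= t := sqn_ge1 y.
have st : `|s - t| <= d * (4 * N).
  have sq u v : 0 <= u -> 0 <= v -> u <= N -> v <= N -> `|u - v| <= d ->
      `|u ^+ 2 - v ^+ 2| <= d * (2 * N).
    move=> u0 v0 uN vN uv; rewrite subr_sqr normrM; apply: ler_pM => //.
    by rewrite ger0_norm; lra.
  have -> : s - t = (modc x.1 ^+ 2 - modc y.1 ^+ 2) + (modc x.2 ^+ 2 - modc y.2 ^+ 2).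
    by rewrite /s /t /sqn; ring.
  have h3 : `|modc x.1 ^+ 2 - modc y.1 ^+ 2| <= d * (2 * N).
    apply: sq; rewrite ?modc_ge0 //; try lra.
    by apply: le_trans h1; exact: modc_dist.
  have h4 : `|modc x.2 ^+ 2 - modc y.2 ^+ 2| <= d * (2 * N).
    apply: sq; rewrite ?modc_ge0 //; try lra.
    by apply: le_trans h2; exact: modc_dist.
  apply: (le_trans (ler_normD _ _)).
  have -> : d * (4 * N) = d * (2 * N) + d * (2 * N) by ring.
  exact: lerD.
set a := conjc (hcoord x i) * hcoord x j; set b := conjc (hcoord y i) * hcoord y j.
have ab : modc (a - b) <= d * (2 * N).
  have -> : a - b = conjc (hcoord x i - hcoord y i) * hcoord x j +
      conjc (hcoord y i) * (hcoord x j - hcoord y j).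
    by rewrite (rmorphB (@conjc R)) /a /b; ring.
  apply: (le_trans (modcD _ _)).
  rewrite [modc (_ * _)]modcM [X in _ + X]modcM !modc_conj.
  have -> : d * (2 * N) = d * N + N * d by ring.
  by apply: lerD; apply: ler_pM; rewrite ?modc_ge0.
have bN : modc b <= N * N by rewrite /b [modc _]modcM modc_conj; apply: ler_pM; rewrite ?modc_ge0.
have s0 : (s%:C : R[i]) != 0 by rewrite (inj_eq (@complexI R)) gt_eqF //; lra.
have t0 : (t%:C : R[i]) != 0 by rewrite (inj_eq (@complexI R)) gt_eqF //; lra.
have -> : a / s%:C - b / t%:C = ((a - b) - b / t%:C * (s%:C - t%:C)) / s%:C.
  by field; rewrite s0 t0.
rewrite modcM modcV modc_real ger0_norm; last lra.
rewrite ler_pdivrMr; last lra.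
apply: (le_trans (modc_sub _ _)).
rewrite [modc (b / _ * _)]modcM [modc (b / _)]modcM modcV -rmorphB !modc_real (ger0_norm (_ : 0 <= t)); last lra.
have h5 : modc b / t <= N * N.
  rewrite ler_pdivrMr; last lra.
  by apply: (le_trans bN); rewrite ler_peMr // mulr_ge0 //; lra.
have h6 : modc b / t * `|s - t| <= N * N * (d * (4 * N)).
  by apply: ler_pM => //; rewrite divr_ge0 ?modc_ge0 //; lra.
have h7 : e <= e * s by rewrite ler_peMr // ltW.
have : d * (2 * N) + N * N * (d * (4 * N)) = e by rewrite -dE; ring.
lra.
Qed.

Lemma chord22 x : chordc (E x) 2 2 = (sqn x)^-1%:C.
Proof. by rewrite chord_E (_ : hcoord x 2 = 1) // conjc1 !mul1r fmorphV. Qed.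

Lemma coord_of_chord x : x.1 = chordc (E x) 2 0 / chordc (E x) 2 2 /\
  x.2 = chordc (E x) 2 1 / chordc (E x) 2 2.
Proof.
have s0 : ((sqn x)%:C : R[i]) != 0.
  by rewrite (inj_eq (@complexI R)) gt_eqF //; have := sqn_ge1 x; lra.
rewrite (chord_E x 2 0) (chord_E x 2 1) (chord_E x 2 2) (_ : hcoord x 2 = 1) // conjc1 !mul1r.
by split; field.
Qed.

(** The coordinates are quotients of entries of the projector, hence continuous where
    the denominator, the entry of index (2, 2), stays away from 0. *)
Lemma E_open a r : 0 < r -> exists2 e : R, 0 < e & forall q, cclose e (E a) q ->
  exists x, [/\ q = E x, modc (x.1 - a.1) <= r & modc (x.2 - a.2) <= r].
Proof.
move=> r0; pose c := (sqn a)^-1.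
have s1 := sqn_ge1 a.
have c0 : 0 < c by rewrite invr_gt0; lra.
pose K := 1 + modc a.1 + modc a.2.
have a1 := modc_ge0 a.1; have a2 := modc_ge0 a.2.
have K1 : 1 <= K by rewrite /K; lra.
pose e := Num.min (c / 2) (r * (c / 2) / K).
have e0 : 0 < e by rewrite lt_min; rewrite !divr_gt0 ?mulr_gt0 //; lra.
have ec : e <= c / 2 by rewrite ge_min lexx.
have eK : e * K <= r * (c / 2).
  by rewrite -ler_pdivlMr ?ge_min ?lexx ?orbT //; lra.
exists e => // q hq.
have h22 := hq 2 2; rewrite chord22 -/c in h22.
have c2 : c / 2 <= modc (chordc q 2 2).
  have := modcD (c%:C - chordc q 2 2) (chordc q 2 2).
  by rewrite subrK modc_real ger0_norm; lra.
have q22 : chordc q 2 2 != 0 by rewrite -modc_gt0; lra.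
have [x qx] := affine_of_chord q22; rewrite qx in h22 hq c2 q22 *.
have [x1 x2] := coord_of_chord x; have [b1 b2] := coord_of_chord a.
have a22 : chordc (E a) 2 2 != 0.
  by rewrite chord22 (inj_eq (@complexI R)) gt_eqF.
have hA : modc (chordc (E a) 2 2 - chordc (E x) 2 2) <= e := hq 2 2.
have key (A A' b b' z z' : R[i]) : A != 0 -> c / 2 <= modc A' ->
    modc (A - A') <= e -> z = b / A -> z' = b' / A' ->
    modc (b - b') <= e -> modc z <= K - 1 -> modc (z' - z) <= r.
  move=> A0 cA AA hz hz' hb zK; have A'0 : A' != 0 by rewrite -modc_gt0; lra.
  have -> : z' - z = ((b' - b) - z * (A' - A)) / A'.
    by rewrite hz hz'; field; rewrite A0 A'0.
  rewrite modcM modcV ler_pdivrMr ?modc_gt0 //.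
  apply: (le_trans (modc_sub _ _)); rewrite modcM.
  have h4 : modc z * modc (A' - A) <= (K - 1) * e.
    by apply: ler_pM; rewrite ?modc_ge0 // modcB.
  have h5 : r * (c / 2) <= r * modc A' by rewrite ler_wpM2l // ltW.
  rewrite (modcB b'); lra.
exists x; split => //.
- by apply: (key _ _ _ _ _ _ a22 c2 hA b1 x1 (hq 2 0)); rewrite /K; lra.
- by apply: (key _ _ _ _ _ _ a22 c2 hA b2 x2 (hq 2 1)); rewrite /K; lra.
Qed.

Lemma cclose_eq p q : (forall e, 0 < e -> cclose e p q) -> p = q.
Proof.
by move=> h; apply: P2_chord_inj => i j; apply: modc_le_eps => e e0; exact: h.
Qed.

Lemma cclose_refl e p : 0 <= e -> cclose e p p.
Proof. by move=> e0 i j; rewrite subrr modc0. Qed.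

Lemma cclose_sym e p q : cclose e p q -> cclose e q p.
Proof. by move=> h i j; rewrite modcB. Qed.

Lemma cclose_trans e e' p q s : cclose e p q -> cclose e' q s -> cclose (e + e') p s.
Proof.
move=> h h' i j; apply: (le_trans (modc_triangle _ (chordc q i j) _)).
exact: lerD.
Qed.

End Chart.
Arguments E {R} _.

(** * The Fatou set in the chart *)

Section FatouChart.
Variable R : realType.
Local Notation C := (R[i] : numClosedFieldType).
Local Notation P2 := (P2 C).
Implicit Types (x y a : R[i] * R[i]) (p q : P2) (e r M : R) (f : P2 -> P2).
Opaque E chordc.

Definition polydisc a r := [set x : R[i] * R[i] | modc (x.1 - a.1) <= r /\ modc (x.2 - a.2) <= r].

Lemma polydisc_center a r : 0 <= r -> polydisc a r a.
Proof. by move=> r0; split; rewrite subrr modc0. Qed.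

Lemma polydiscS a r s x : r <= s -> polydisc a r x -> polydisc a s x.
Proof. by move=> rs [h1 h2]; split; lra. Qed.

Lemma polydisc_trans a r s x y : polydisc a r x -> polydisc x s y -> polydisc a (r + s) y.
Proof.
move=> [h1 h2] [h3 h4]; split.
  by have := modc_triangle y.1 x.1 a.1; lra.
by have := modc_triangle y.2 x.2 a.2; lra.
Qed.

Lemma E_openP a r : 0 < r -> exists2 e : R, 0 < e &
  forall q, cclose e (E a) q -> exists2 x, polydisc a r x & q = E x.
Proof.
move=> /(E_open a) [e e0 h]; exists e => // q /h [x [qx h1 h2]].
by exists x.
Qed.

Lemma E_cont a e : 0 < e -> exists2 d : R, 0 < d & forall x, polydisc a d x -> cclose e (E a) (E x).
Proof.
move=> e0; have [d d0 h] := E_unif (modc a.1 + modc a.2 + 1) e0.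
have a1 := modc_ge0 a.1; have a2 := modc_ge0 a.2.
exists (Num.min d 1) => [|x [h1 h2]]; first by rewrite lt_min d0 ltr01.
have [m1 m2] : Num.min d 1 <= d /\ Num.min d 1 <= 1 by rewrite !ge_min !lexx orbT.
have := modcD (x.1 - a.1) a.1; have := modcD (x.2 - a.2) a.2.
rewrite !subrK => h3 h4.
by apply: h; rewrite ?(modcB a.1) ?(modcB a.2); lra.
Qed.

Lemma open_P2P (U : set P2) : open U <->
  forall p, U p -> exists2 e : R, 0 < e & forall q, cclose e p q -> U q.
Proof.
rewrite openE; split.
  by move=> h p /h /P2_nbhsP.
by move=> h p /h he; apply/P2_nbhsP.
Qed.

Lemma open_image (O : set (R[i] * R[i])) :
  (forall a, O a -> exists2 r : R, 0 < r & polydisc a r `<=` O) -> open (E @` O).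
Proof.
move=> hO; apply/open_P2P => _ [a Oa <-].
have [r r0 hr] := hO a Oa; have [e e0 he] := E_openP a r0.
by exists e => // q /he [x hx ->]; exists x => //; exact: hr.
Qed.

Lemma compact_image a r : compact (E @` polydisc a r).
Proof.
rewrite compact_ultra => G UG GA.
pose u q := xget a [set x | polydisc a r x /\ q = E x].
have hu q : (E @` polydisc a r) q -> polydisc a r (u q) /\ q = E (u q).
  move=> [x hx qx]; rewrite /u; case: xgetP => [y _ //|/(_ x)]; by case.
have Gu : G [set q | polydisc a r (u q) /\ q = E (u q)] by apply: filterS GA => q; exact: hu.
have [l1 hl1] : exists l, tends G (fun q => (u q).1) l.
  apply: (@ultra_cvg _ _ _ _ _ (r + modc a.1)); apply: filterS Gu => q [[h1 _] _] /=.
  by have := modcD ((u q).1 - a.1) a.1; rewrite subrK; lra.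
have [l2 hl2] : exists l, tends G (fun q => (u q).2) l.
  apply: (@ultra_cvg _ _ _ _ _ (r + modc a.2)); apply: filterS Gu => q [[_ h1] _] /=.
  by have := modcD ((u q).2 - a.2) a.2; rewrite subrK; lra.
exists (E (l1, l2)); split.
  exists (l1, l2) => //; split => /=.
    apply: (tends_le _ (tendsB hl1 (tends_cst (G := G) a.1))).
    by apply: filterS Gu => q [[]].
  apply: (tends_le _ (tendsB hl2 (tends_cst (G := G) a.2))).
  by apply: filterS Gu => q [[]].
move=> A /P2_nbhsP [e e0 he]; have [d d0 hd] := E_cont (l1, l2) e0.
have h1 := hl1 d d0; have h2 := hl2 d d0.
have h12 : G ([set t | modc ((u t).1 - l1) <= d] `&` [set t | modc ((u t).2 - l2) <= d]).
  exact: filterI.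
by apply: filterS2 Gu h12 => q [_ qE] [h3 h4]; apply: he; rewrite qE; apply: hd.
Qed.

Lemma family_cvgP (U : set P2) (f : nat -> P2 -> P2) (h : P2 -> P2) :
  {family compactly_in U, f @ \oo --> h} <->
  forall A, compact A -> A `<=` U -> forall e : R, 0 < e ->
    exists N, forall n, (N <= n)%N -> forall p, A p -> cclose e (h p) (f n p).
Proof.
split.
- move=> /fam_cvgP hf A cA AU e e0.
  have /hf : compactly_in U A by [].
  move=> /(_ [set g : P2 -> P2 | forall p, A p -> cclose e (h p) (g p)]) [].
    apply/uniform_nbhs; exists [set pq | cclose e pq.1 pq.2]; split => //.
    by apply/(P2_entourageP _).2; exists e; [exact: e0|move=> p' q' h'; exact: h'].
  by move=> N _ hN; exists N => n Nn; exact: hN.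
- move=> hf; apply/fam_cvgP => A [AU cA] B /uniform_nbhs [V [/P2_entourageP [e e0 he] sB]].
  have [N hN] := hf A cA AU e e0.
  exists N => //= n Nn; apply: sB => y Ay /=; apply: he; exact: hN.
Qed.

Lemma extract (Q : nat -> nat -> Prop) : (forall i N, exists j, (N <= j)%N /\ Q i j) ->
  exists k : nat -> nat, {homo k : i j / (i < j)%N} /\ forall i, Q i (k i).
Proof.
move=> h; pose g i N := projT1 (cid (h i N)).
have gP i N : (N <= g i N)%N /\ Q i (g i N) by rewrite /g; case: cid.
pose k := fix k i := match i with 0%N => g 0%N 0%N | i'.+1 => g i'.+1 (k i').+1 end.
exists k; split.
  apply: homo_ltn => [x y z|i]; first exact: ltn_trans.
  exact: (gP i.+1 (k i).+1).1.
by case=> [|i]; [exact: (gP _ _).2|exact: (gP _ _).2].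
Qed.

Lemma homo_ge (k : nat -> nat) : {homo k : i j / (i < j)%N} -> forall n, (n <= k n)%N.
Proof. by move=> hk; elim=> // n IH; apply: leq_ltn_trans IH (hk _ _ (ltnSn n)). Qed.

Lemma homo_comp (k l : nat -> nat) : {homo k : i j / (i < j)%N} ->
  {homo l : i j / (i < j)%N} -> {homo k \o l : i j / (i < j)%N}.
Proof. by move=> hk hl i j /hl /hk. Qed.

Definition unif_on (S : set P2) (g : nat -> P2 -> P2) (h : P2 -> P2) :=
  forall e : R, 0 < e -> exists N, forall j, (N <= j)%N ->
    forall p, S p -> cclose e (h p) (g j p).

(** A sequence of exponents has either a subsequence tending to infinity or a
    constant one, and iterates of constant order converge trivially; so normality
    has to be tested only on sequences with [n j >= j]. *)
Lemma Fatou_intro f a r : 0 < r ->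
  (forall n : nat -> nat, (forall j, (j <= n j)%N) -> exists2 k : nat -> nat,
    {homo k : i j / (i < j)%N} & exists h,
      unif_on (E @` polydisc a r) (fun j => iter (n (k j)) f) h) ->
  Fatou_set f (E a).
Proof.
move=> r0 H.
pose O := [set x : R[i] * R[i] | modc (x.1 - a.1) < r /\ modc (x.2 - a.2) < r].
exists (E @` O); split.
- apply: open_image => x [h1 h2].
  exists (Num.min ((r - modc (x.1 - a.1)) / 2) ((r - modc (x.2 - a.2)) / 2)).
    by rewrite lt_min; apply/andP; split; lra.
  move=> y [h3 h4]; move: h3 h4; rewrite !le_min => /andP [h3 _] /andP [_ h4].
  by split; [have := modc_triangle y.1 x.1 a.1|have := modc_triangle y.2 x.2 a.2]; lra.
- by exists a => //; split; rewrite subrr modc0.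
move=> n; have [hinf|hfin] := pselect (forall i N, exists j, (N <= j)%N /\ (i <= n j)%N).
  have [k [kinc hk]] := extract hinf.
  have [l linc [h hh]] := H (n \o k) hk.
  exists (k \o l); first exact: homo_comp.
  exists h; apply/family_cvgP => A _ AU e e0; have [N hN] := hh e e0.
  exists N => j Nj p Ap; apply: hN => //.
  by have [x [h1 h2] <-] := AU p Ap; exists x => //; split; exact: ltW.
(* Otherwise the exponents are bounded from some rank on, and one value recurs. *)
have [v hv] : exists v, forall N, exists j, (N <= j)%N /\ n j = v.
  have [i [N0 hN0]] : exists i N, forall j, (N <= j)%N -> (n j < i)%N.
    move: hfin => /existsNP [i /existsNP [N hN]]; exists i, N => j Nj.
    by rewrite ltnNge; apply/negP => ij; apply: hN; exists j.
  elim: i N0 hN0 => [|i IH] N0 hN0; first by have := hN0 N0 (leqnn _).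
  have [h|h] := pselect (forall N, exists j, (N <= j)%N /\ n j = i); first by exists i.
  move: h => /existsNP [N1 h1]; apply: (IH (maxn N0 N1)) => j; rewrite geq_max => /andP [j0 j1].
  have := hN0 j j0; rewrite ltnS leq_eqVlt => /orP [/eqP e|//].
  by exfalso; apply: h1; exists j.
have [k [kinc hk]] := extract (fun _ N => hv N).
exists k => //; exists (iter v f); apply/family_cvgP => A _ _ e e0.
by exists 0%N => j _ p _; rewrite hk; exact/cclose_refl/ltW.
Qed.

Lemma Fatou_elim f a : Fatou_set f (E a) -> exists2 r : R, 0 < r &
  (forall x, polydisc a r x -> Fatou_set f (E x)) /\
  (forall n : nat -> nat, exists2 k : nat -> nat, {homo k : i j / (i < j)%N} &
    exists h, unif_on (E @` polydisc a r) (fun j => iter (n (k j)) f) h).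
Proof.
move=> [U [oU Ua hU]].
have [e e0 he] := (open_P2P U).1 oU _ Ua.
have [d d0 hd] := E_cont a e0.
have sub : E @` polydisc a d `<=` U by move=> _ [x hx <-]; apply/he/hd.
exists d => //; split.
  by move=> x hx; exists U; split => //; apply: sub; exists x.
move=> n; have [k kinc [h hh]] := hU n; exists k => //; exists h => e' e'0.
have [N hN] := (family_cvgP _ _ _).1 hh _ (@compact_image a d) sub _ e'0.
by exists N => j Nj p Ap; exact: hN.
Qed.

Definition segpt a b (t : R) : R[i] * R[i] :=
  (a.1 + t%:C * (b.1 - a.1), a.2 + t%:C * (b.2 - a.2)).

Lemma segment_component (S : set P2) p0 a b :
  (forall t : R, 0 <= t -> t <= 1 -> S (E (segpt a b t))) ->
  connected_component S p0 (E a) -> connected_component S p0 (E b).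
Proof.
move=> hS hpa.
apply: (connected_component_trans hpa).
pose g (t : R) := E (segpt a b t).
have g0 : g 0 = E a by rewrite /g /segpt !mul0r !addr0; case: (a).
have g1 : g 1 = E b by rewrite /g /segpt !mul1r ![_ + (_ - _)]addrC !subrK; case: (b).
have gc : continuous g.
  move=> t A /P2_nbhsP [e e0 he].
  have [d d0 hd] := E_cont (segpt a b t) e0.
  pose K := modc (b.1 - a.1) + modc (b.2 - a.2) + 1.
  have k1 := modc_ge0 (b.1 - a.1); have k2 := modc_ge0 (b.2 - a.2).
  have K0 : 0 < K by rewrite /K; lra.
  apply/nbhs_ballP; exists (d / K); first exact: divr_gt0.
  move=> s; rewrite -ball_normE /= ltr_pdivlMr // => hs; apply: he; apply: hd.
  have n0 := normr_ge0 (t - s).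
  by split; rewrite /segpt /= opprD addrACA subrr add0r -mulrBl -rmorphB modcM modc_real distrC;
    apply: le_trans (ltW hs); rewrite ler_wpM2l // /K; lra.
have cg : connected (g @` `[0, 1]%classic).
  apply: connected_continuous_connected; first exact: segment_connected.
  exact: continuous_subspaceT.
apply: (connected_component_max _ _ cg).
- by exists 0 => //; rewrite /= in_itv /= lexx ler01.
- by move=> _ [t /= /andP [t0 t1] <-]; exact: hS.
- by exists 1 => //; rewrite /= in_itv /= lexx ler01.
Qed.

Lemma polydisc_convex a r x y t : polydisc a r x -> polydisc a r y ->
  0 <= t -> t <= 1 -> polydisc a r (segpt x y t).
Proof.
have key (u v w : R[i]) : modc (u - w) <= r -> modc (v - w) <= r -> 0 <= t -> t <= 1 ->
    modc (u + t%:C * (v - u) - w) <= r.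
  move=> h1 h2 t0 t1.
  have -> : u + t%:C * (v - u) - w = (1 - t)%:C * (u - w) + t%:C * (v - w).
    by rewrite rmorphB rmorph1; ring.
  apply: (le_trans (modcD _ _)); rewrite !modcM !modc_real !ger0_norm //; last lra.
  have : t * modc (v - w) <= t * r by rewrite ler_wpM2l.
  have : (1 - t) * modc (u - w) <= (1 - t) * r by rewrite ler_wpM2l //; lra.
  lra.
by move=> [h1 h2] [h3 h4] t0 t1; split; exact: key.
Qed.

Lemma polydisc_component f p0 a r x y :
  (forall x, polydisc a r x -> Fatou_set f (E x)) -> polydisc a r x -> polydisc a r y ->
  connected_component (Fatou_set f) p0 (E x) -> connected_component (Fatou_set f) p0 (E y).
Proof.
move=> hF hx hy; apply: segment_component => t t0 t1.
by apply: hF; exact: polydisc_convex.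
Qed.

End FatouChart.

(** * Roots near a point where a polynomial is small *)

Section Roots.
Variable R : realType.

Lemma nearest_root (s : seq R[i]) z : s != [::] ->
  exists2 r, r \in s & modc (z - r) ^+ size s <= \prod_(t <- s) modc (z - t).
Proof.
elim: s => // b [|c s] IH _.
  by exists b; rewrite ?mem_head // big_cons big_nil mulr1 expr1.
have [//|r rs hr] := IH _.
rewrite big_cons; set p := \prod_(t <- _) _ in hr *; set m := (size (b :: _)).
have b0 := modc_ge0 (z - b); have r0 := modc_ge0 (z - r).
have [le|le] := leP (modc (z - b)) (modc (z - r)).
  exists b; rewrite ?mem_head // /m /= exprS ler_wpM2l //.
  by apply: le_trans hr; rewrite lerXn2r ?nnegrE.
exists r; first by rewrite in_cons rs orbT.
rewrite /m /= exprS; apply: (@le_trans _ _ (modc (z - r) * p)).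
  by rewrite ler_wpM2l.
by rewrite ler_wpM2r ?(ltW le) //; apply: prodr_ge0 => t _; exact: modc_ge0.
Qed.

(** [|P z|] is the product of the distances from [z] to the roots. *)
Lemma monic_near_root (P : {poly R[i]}) n z : P \is monic -> size P = n.+2 ->
  exists2 r, P.[r] = 0 & modc (z - r) ^+ n.+1 <= modc P.[z].
Proof.
move=> mP sP; have [s Ps] := closed_field_poly_normal (P : {poly (R[i] : numClosedFieldType)}).
rewrite (monicP mP) scale1r in Ps.
have ss : size s = n.+1.
  by have := sP; rewrite Ps size_prod_XsubC => -[].
have s0 : s != [::] by rewrite -size_eq0 ss.
have [r rs hr] := nearest_root z s0; exists r.
  by apply/eqP; rewrite -/(root P r) Ps root_prod_XsubC.
have Pz : P.[z] = \prod_(t <- s) (z - t).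
  by rewrite Ps horner_prod; apply: eq_bigr => t _; rewrite hornerXsubC.
rewrite -ss Pz; apply: (le_trans hr).
rewrite (_ : modc _ = \prod_(t <- s) modc (z - t)) //.
elim: (s) => [|t u IH]; first by rewrite !big_nil modc1.
by rewrite !big_cons modcM IH.
Qed.

End Roots.

(** * Escaping orbits and Fatou components *)

Section SkewDynamics.
Variable R : realType.
Variable lam : R[i].
Hypothesis lam_mod : modc lam = 1.
Implicit Types (x y a : R[i] * R[i]) (z w : R[i]) (e r M : R).
Opaque E chordc.

Let F : P2 R[i] -> P2 R[i] := Fmap lam.
Local Notation Fc := (skew lam).

Lemma F_E x : F (E x) = E (Fc x).
Proof. exact: Fmap_E. Qed.

Lemma iter_F_E n x : iter n F (E x) = E (iter n Fc x).
Proof. exact: iter_Fmap_E. Qed.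

Lemma Fc_cont a e : 0 < e -> exists2 r : R, 0 < r & forall x, polydisc a r x -> polydisc (Fc a) e (Fc x).
Proof.
move=> e0; pose M := modc a.1 + modc a.2 + 1.
have a1 := modc_ge0 a.1; have a2 := modc_ge0 a.2.
have M1 : 1 <= M by rewrite /M; lra.
have K0 : 0 < 8 * (M * M) by rewrite mulr_gt0 // mulr_gt0; lra.
exists (Num.min 1 (e / (8 * (M * M)))); first by rewrite lt_min ltr01 divr_gt0.
set d := Num.min _ _; have d1 : d <= 1 by rewrite ge_min lexx.
have dK : d * (8 * (M * M)) <= e by rewrite -ler_pdivlMr // ge_min lexx orbT.
move=> x [h1 h2].
have m1 : modc x.1 <= M by have := modcD (x.1 - a.1) a.1; rewrite subrK /M; lra.
have m2 : modc x.2 <= M by have := modcD (x.2 - a.2) a.2; rewrite subrK /M; lra.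
have n1 : modc a.1 <= M by rewrite /M; lra.
have n2 : modc a.2 <= M by rewrite /M; lra.
have d0 : 0 <= d by have := modc_ge0 (x.1 - a.1); lra.
have M0 : 0 <= M by lra.
have cube u v : modc u <= M -> modc v <= M -> modc (u - v) <= d ->
    modc (u ^+ 3 - v ^+ 3) <= d * (4 * (M * M)).
  move=> hu hv huv; apply: (le_trans (diffX_le 2 hu hv)).
  have -> : 4 * (M * M) = (2 * M) ^+ 2 by rewrite expr2; ring.
  by rewrite ler_wpM2r // exprn_ge0 // mulr_ge0.
have sqr u v : modc u <= M -> modc v <= M -> modc (u - v) <= d ->
    modc (u ^+ 2 - v ^+ 2) <= d * (2 * M).
  move=> hu hv huv; apply: (le_trans (diffX_le 1 hu hv)).
  by rewrite expr1 ler_wpM2r // mulr_ge0.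
have dMM : d <= d * (M * M).
  by rewrite ler_peMr // -[1]mulr1; apply: ler_pM.
split; rewrite /= /pz /qw.
- have -> : lam * x.1 + x.1 ^+ 3 - (lam * a.1 + a.1 ^+ 3) = lam * (x.1 - a.1) + (x.1 ^+ 3 - a.1 ^+ 3) by ring.
  apply: (le_trans (modcD _ _)); rewrite modcM lam_mod mul1r.
  have := cube _ _ m1 n1 h1; lra.
- have -> : lam^-1 * (x.2 + x.1 * x.2 ^+ 2) + x.2 ^+ 3 - (lam^-1 * (a.2 + a.1 * a.2 ^+ 2) + a.2 ^+ 3)
     = lam^-1 * ((x.2 - a.2) + ((x.1 - a.1) * (x.2 * x.2) + a.1 * (x.2 ^+ 2 - a.2 ^+ 2))) + (x.2 ^+ 3 - a.2 ^+ 3).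
    by ring.
  apply: (le_trans (modcD _ _)); rewrite modcM (lamV_mod lam_mod) mul1r.
  have := modcD (x.2 - a.2) ((x.1 - a.1) * (x.2 * x.2) + a.1 * (x.2 ^+ 2 - a.2 ^+ 2)).
  have := modcD ((x.1 - a.1) * (x.2 * x.2)) (a.1 * (x.2 ^+ 2 - a.2 ^+ 2)).
  have t1 : modc ((x.1 - a.1) * (x.2 * x.2)) <= d * (M * M).
    by rewrite [modc _]modcM [modc (x.2 * _)]modcM; apply: ler_pM; rewrite ?mulr_ge0 ?modc_ge0 //; apply: ler_pM; rewrite ?modc_ge0.
  have t2 : modc (a.1 * (x.2 ^+ 2 - a.2 ^+ 2)) <= M * (d * (2 * M)).
    by rewrite modcM; apply: ler_pM; rewrite ?modc_ge0 // sqr.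
  have t3 := cube _ _ m2 n2 h2.
  have : M * (d * (2 * M)) = 2 * (d * (M * M)) by ring.
  lra.
Qed.

Lemma iter_skew_cont n a e : 0 < e -> exists2 r : R, 0 < r &
  forall x, polydisc a r x -> polydisc (iter n Fc a) e (iter n Fc x).
Proof.
elim: n e => [|n IH] e e0; first by exists e.
have [d d0 hd] := Fc_cont (iter n Fc a) e0; have [r r0 hr] := IH d d0.
by exists r => // x /hr /hd.
Qed.

Lemma cubic_monic (P : {poly R[i]}) : (size P <= 3)%N -> 'X^3 + P \is monic /\ size ('X^3 + P) = 4.
Proof.
move=> sP; have s3 : size ('X^3 : {poly R[i]}) = 4 by rewrite size_polyXn.
have lt : (size P < size ('X^3 : {poly R[i]}))%N by rewrite s3.
by rewrite monicE lead_coefDl // lead_coefXn size_polyDl.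
Qed.

Lemma cube_le_inv (u v : R) : 0 <= u -> 0 <= v -> u ^+ 3 <= v ^+ 3 -> u <= v.
Proof. by move=> u0 v0; rewrite ler_pXn2r ?nnegrE. Qed.

(** A target near [Fc a] determines a cubic equation for [z], with a root near [a.1],
    and then a cubic equation for [w], with a root near [a.2]. *)
Lemma Fc_open a r : 0 < r -> exists2 d : R, 0 < d & forall y, polydisc (Fc a) d y ->
  exists2 x, polydisc a r x & Fc x = y.
Proof.
move=> r0; pose K := modc a.2 ^+ 2 + 1.
have K0 : 0 < K by have := exprn_ge0 2 (modc_ge0 a.2); rewrite /K; lra.
have r3 : 0 < r ^+ 3 by rewrite exprn_gt0.
pose s := Num.min r (r ^+ 3 / 2 / K).
have s0 : 0 < s by rewrite lt_min r0 !divr_gt0.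
have sr : s <= r by rewrite ge_min lexx.
have sK : s * K <= r ^+ 3 / 2 by rewrite -ler_pdivlMr // ge_min lexx orbT.
have s3 : 0 < s ^+ 3 by rewrite exprn_gt0.
exists (Num.min (s ^+ 3) (r ^+ 3 / 2)); first by rewrite lt_min s3 divr_gt0.
move=> y [h1 h2]; move: h1 h2; rewrite !le_min => /andP [h1 _] /andP [_ h2].
have [m1 z1] : 'X^3 + (lam *: 'X - y.1%:P) \is monic /\ size ('X^3 + (lam *: 'X - y.1%:P)) = 4.
  apply: cubic_monic; apply: (leq_trans (size_polyD _ _)); rewrite geq_max size_polyN.
  by rewrite (leq_trans (size_scale_leq _ _)) ?size_polyX // (leq_trans (size_polyC_leq1 _)).
have [z hz hza] := monic_near_root a.1 m1 z1.
have zs : modc (a.1 - z) <= s.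
  apply: cube_le_inv; [exact: modc_ge0|exact: ltW|].
  apply: (le_trans hza); apply: le_trans h1.
  have -> : ('X^3 + (lam *: 'X - y.1%:P)).[a.1] = (Fc a).1 - y.1 by rewrite !hornerE /= /pz; ring.
  by rewrite modcB.
have [m2 z2] : 'X^3 + ((lam^-1 * z) *: 'X^2 + (lam^-1 *: 'X - y.2%:P)) \is monic /\
    size ('X^3 + ((lam^-1 * z) *: 'X^2 + (lam^-1 *: 'X - y.2%:P))) = 4.
  apply: cubic_monic; apply: (leq_trans (size_polyD _ _)); rewrite geq_max; apply/andP; split.
    by rewrite (leq_trans (size_scale_leq _ _)) // size_polyXn.
  apply: (leq_trans (size_polyD _ _)); rewrite geq_max size_polyN.
  by rewrite (leq_trans (size_scale_leq _ _)) ?size_polyX // (leq_trans (size_polyC_leq1 _)).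
have [w hw hwa] := monic_near_root a.2 m2 z2.
exists (z, w).
  split => /=; first by rewrite modcB; lra.
  rewrite modcB; apply: cube_le_inv; [exact: modc_ge0|exact: ltW|].
  apply: (le_trans hwa).
  have -> : ('X^3 + ((lam^-1 * z) *: 'X^2 + (lam^-1 *: 'X - y.2%:P))).[a.2] =
      lam^-1 * (z - a.1) * a.2 ^+ 2 + ((Fc a).2 - y.2) by rewrite !hornerE /= /qw; ring.
  apply: (le_trans (modcD _ _)); rewrite (modcB (Fc a).2) [modc (_ * _ ^+ 2)]modcM modcX modcM (lamV_mod lam_mod) mul1r (modcB z).
  have : modc (a.1 - z) * modc a.2 ^+ 2 <= s * K.
    by apply: ler_pM; rewrite ?modc_ge0 ?exprn_ge0 ?modc_ge0 // /K; lra.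
  lra.
have e1 : pz lam z = y.1.
  apply/eqP; rewrite -subr_eq0; apply/eqP; rewrite -[RHS]hz !hornerE /pz /=; ring.
have e2 : qw lam z w = y.2.
  apply/eqP; rewrite -subr_eq0; apply/eqP; rewrite -[RHS]hw !hornerE /qw /=; ring.
by rewrite /skew /= e1 e2; case: (y).
Qed.

(** The bounds 2 and 3 are escape radii ([escape1], [escape2]): this is the set of
    points with bounded orbit. *)
Definition Kset x := forall n, modc (iter n Fc x).1 <= 2 /\ modc (iter n Fc x).2 <= 3.

Lemma escape1 z : 2 < modc z -> modc z + 1 <= modc (pz lam z).
Proof.
move=> h; rewrite /pz; have := modc_sub (lam * z + z ^+ 3) (lam * z).
rewrite addrAC subrr add0r modcX modcM lam_mod mul1r.
have : modc z * 3 <= modc z ^+ 3 - modc z.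
  have h4 : 4 <= modc z * modc z by nra.
  by rewrite !exprS expr0 mulr1; nra.
lra.
Qed.

Lemma escape2 z w : modc z <= 2 -> 3 < modc w -> modc w + 1 <= modc (qw lam z w).
Proof.
move=> hz h; rewrite /qw; have z0 := modc_ge0 z.
have := modc_sub (lam^-1 * (w + z * w ^+ 2) + w ^+ 3) (lam^-1 * (w + z * w ^+ 2)).
rewrite addrAC subrr add0r modcX modcM (lamV_mod lam_mod) mul1r.
have := modcD w (z * w ^+ 2); rewrite modcM modcX.
have h1 : modc z * modc w ^+ 2 <= 2 * modc w ^+ 2 by rewrite ler_wpM2r // exprn_ge0 // modc_ge0.
have : 2 * modc w <= modc w ^+ 3 - 2 * modc w ^+ 2 - modc w.
  rewrite !exprS expr0 mulr1; have : 9 <= modc w * modc w by nra.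
  nra.
lra.
Qed.

(** Any bound larger than that of [Kset_sqn] would do; the ratio 4 between them leaves
    room for the approximations in [Fatou_Kset_open]. *)
Lemma escape x : ~ Kset x -> exists N, forall n, (N <= n)%N -> 56 < sqn (iter n Fc x).
Proof.
move=> nK.
have big (v : R) n : n%:R <= v -> (8 <= n)%N -> 56 < v ^+ 2.
  move=> nv n8; have v8 : 8 <= v by apply: le_trans nv; rewrite ler_nat.
  by rewrite expr2; nra.
have [all1|] := pselect (forall n, modc (iter n Fc x).1 <= 2); last first.
  move=> /existsNP [m hm]; exists (m + 8)%N => n mn.
  have gr k : k%:R <= modc (iter (m + k) Fc x).1 /\ 2 < modc (iter (m + k) Fc x).1.
    elim: k => [|k [IH1 IH2]]; first by rewrite addn0 modc_ge0 ltNge; split => //; apply/negP.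
    by rewrite addnS /= -natr1; have := escape1 IH2; split; lra.
  have := gr (n - m)%N; rewrite subnKC; last by rewrite (leq_trans _ mn) // leq_addr.
  move=> [h _]; have := big _ _ h; rewrite leq_subRL; last by rewrite (leq_trans _ mn) // leq_addr.
  move=> /(_ mn); have := exprn_ge0 2 (modc_ge0 (iter n Fc x).2); rewrite /sqn; lra.
have [m hm] : exists m, ~ modc (iter m Fc x).2 <= 3.
  by apply/existsNP => all2; apply: nK => n; split.
exists (m + 8)%N => n mn.
have gr k : k%:R <= modc (iter (m + k) Fc x).2 /\ 3 < modc (iter (m + k) Fc x).2.
  elim: k => [|k [IH1 IH2]]; first by rewrite addn0 modc_ge0 ltNge; split => //; apply/negP.
  by rewrite addnS /= -natr1; have := escape2 (all1 (m + k)%N) IH2; split; lra.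
have := gr (n - m)%N; rewrite subnKC; last by rewrite (leq_trans _ mn) // leq_addr.
move=> [h _]; have := big _ _ h; rewrite leq_subRL; last by rewrite (leq_trans _ mn) // leq_addr.
move=> /(_ mn); have := exprn_ge0 2 (modc_ge0 (iter n Fc x).1); rewrite /sqn; lra.
Qed.

Lemma Kset_sqn x n : Kset x -> sqn (iter n Fc x) <= 14.
Proof.
move=> /(_ n) [h1 h2]; have z0 := modc_ge0 (iter n Fc x).1; have w0 := modc_ge0 (iter n Fc x).2.
by rewrite /sqn !expr2; nra.
Qed.

(** A continuous function on [P2] that equals [1 / sqn] in the chart and vanishes on
    the line at infinity; it distinguishes bounded orbits from escaping ones. *)
Definition tau (p : P2 R[i]) : R := modc (chordc p 2 2).

Lemma tau_E x : tau (E x) = (sqn x)^-1.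
Proof.
rewrite /tau chord22 modc_real ger0_norm // invr_ge0.
by have := sqn_ge1 x; lra.
Qed.

Lemma tau_close e p q : cclose e p q -> tau p <= tau q + e.
Proof.
move=> /(_ 2 2); rewrite /tau; move: (chordc p 2 2) (chordc q 2 2) => u v h.
by have := modcD (u - v) v; rewrite subrK; lra.
Qed.

Lemma tau_lower x (v : R) : sqn x <= v -> v^-1 <= tau (E x).
Proof.
move=> h; have s1 := sqn_ge1 x.
by rewrite tau_E lef_pV2 ?posrE //; lra.
Qed.

Lemma tau_upper x (v : R) : 0 < v -> v <= sqn x -> tau (E x) <= v^-1.
Proof.
move=> v0 h; have s1 := sqn_ge1 x.
by rewrite tau_E lef_pV2 ?posrE //; lra.
Qed.

Opaque tau.

(** Near a Fatou point some iterate is uniformly close to infinitely many later ones.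
    At [a] this iterate gives [tau] a value of at least 1/14, hence nearly so at nearby
    points, whereas on an escaping orbit the late iterates bring [tau] below 1/56. *)
Lemma Fatou_Kset_open a : Fatou_set F (E a) -> Kset a ->
  exists2 r : R, 0 < r & polydisc a r `<=` Kset.
Proof.
move=> Fa Ka.
(* The gap between 1/14 and 1/56 exceeds three errors of 1/224. *)
have num (A B D G : R) : A <= B + 1 / 224 -> B <= D + 1 / 224 -> D <= G + 1 / 224 ->
    14^-1 <= A -> G <= 56^-1 -> False by lra.
have [r r0 [_ hn]] := Fatou_elim Fa.
have [k kinc [h hh]] := hn id.
have e0 : 0 < 1 / 224 :> R by lra.
have [N hN] := hh _ e0.
have [e1 e10 he1] := E_cont (iter (k N) Fc a) e0.
have [d d0 hd] := iter_skew_cont (k N) a e10.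
exists (Num.min r d) => [|x hx]; first by rewrite lt_min r0.
have xr : polydisc a r x by apply: polydiscS hx; rewrite ge_min lexx.
have xd : polydisc a d x by apply: polydiscS hx; rewrite ge_min lexx orbT.
apply: contrapT => /escape [N' hN'].
have Ex : [set E x | x in polydisc a r] (E x) by exists x.
have c1 := tau_close (he1 _ (hd x xd)).
have c2 := tau_close (cclose_sym (hN N (leqnn N) _ Ex)).
pose j := maxn N N'.
have c3 := tau_close (hN j (leq_maxl _ _) _ Ex).
have j1 : (N' <= k j)%N.
  by apply: leq_trans (homo_ge kinc j); exact: leq_maxr.
have c4 := hN' _ j1.
have c5 := tau_lower (Kset_sqn (k N) Ka).
have c6 := tau_upper (ltr0n _ 56) (ltW c4).
rewrite !iter_F_E in c2 c3.
exact: num c1 c2 c3 c5 c6.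
Qed.

Lemma Kset_closed : closed (E @` Kset : set (P2 R[i])).
Proof.
rewrite -openC; apply/open_P2P => p np.
have [ta|ta] := ltP (tau p) (1 / 14).
  exists ((1 / 14 - tau p) / 2) => [|q hq [x Kx xq]]; first lra.
  have := tau_close (cclose_sym hq); rewrite -xq tau_E.
  have := tau_lower (Kset_sqn 0 Kx); rewrite tau_E /=.
  by move: (tau p) ta (sqn x)^-1 => A ta B; lra.
have c22 : chordc p 2 2 != 0.
  by rewrite -modc_gt0; apply: lt_le_trans ta; rewrite divr_gt0.
have [a pa] := affine_of_chord c22; rewrite pa in np *.
have nK : ~ Kset a by move=> Ka; apply: np; exists a.
have [r r0 hr] : exists2 r : R, 0 < r & forall x, polydisc a r x -> ~ Kset x.
  move: nK => /existsNP [n /not_andP [h|h]].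
    have h' : 0 < (modc (iter n Fc a).1 - 2) / 2 by move/negP: h; rewrite -ltNge; lra.
    have [r r0 hr] := iter_skew_cont n a h'; exists r => // x /hr [h1 _] /(_ n) [h2 _].
    have := modcD ((iter n Fc a).1 - (iter n Fc x).1) (iter n Fc x).1.
    by rewrite subrK modcB; lra.
  have h' : 0 < (modc (iter n Fc a).2 - 3) / 2 by move/negP: h; rewrite -ltNge; lra.
  have [r r0 hr] := iter_skew_cont n a h'; exists r => // x /hr [_ h1] /(_ n) [_ h2].
  have := modcD ((iter n Fc a).2 - (iter n Fc x).2) (iter n Fc x).2.
  by rewrite subrK modcB; lra.
have [e e0 he] := E_openP a r0; exists e => // q /he [x hx ->] [y Ky /E_inj yx].
by apply: (hr x hx); rewrite -yx.
Qed.

(** The limit map is transported through an arbitrary choice of preimages: uniform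
    convergence does not require it to be continuous. *)
Lemma Fatou_Fc a : Fatou_set F (E a) -> Fatou_set F (E (Fc a)).
Proof.
move=> /Fatou_elim [r r0 [_ hn]]; have [d d0 hd] := Fc_open a r0.
apply: (Fatou_intro d0) => n _; have [k kinc [h hh]] := hn (fun j => (n j).+1).
exists k => //.
pose pre p := xget (E a) [set q | (E @` polydisc a r) q /\ F q = p].
have preP p : (E @` polydisc (Fc a) d) p -> (E @` polydisc a r) (pre p) /\ F (pre p) = p.
  move=> [y /hd [x hx xy] <-]; rewrite /pre; case: xgetP => [q _ //|/(_ (E x))].
  by case; split; [exists x|rewrite F_E xy].
exists (h \o pre) => e e0; have [N hN] := hh e e0; exists N => j Nj p /preP [hp Fp].
by have := hN j Nj _ hp; rewrite iterSr Fp.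
Qed.

Lemma Fatou_Fc_inv a : Fatou_set F (E (Fc a)) -> Fatou_set F (E a).
Proof.
move=> /Fatou_elim [r r0 [_ hn]]; have [d d0 hd] := Fc_cont a r0.
apply: (Fatou_intro d0) => n nj; have [k kinc [h hh]] := hn (fun j => (n j.+1).-1).
exists (fun j => (k j).+1); first by move=> i j /kinc.
exists (h \o F) => e e0; have [N hN] := hh e e0; exists N => j Nj _ [x hx <-].
have hFx : (E @` polydisc (Fc a) r) (F (E x)) by exists (Fc x); [exact: hd|rewrite F_E].
have := hN j Nj _ hFx; rewrite -iterSr prednK //.
exact: leq_trans (nj (k j).+1).
Qed.

Section Component.
Variable x0 : R[i] * R[i].
Hypothesis x0_Fatou : Fatou_set F (E x0).
Hypothesis x0_K : Kset x0.
Let Om := connected_component (Fatou_set F) (E x0).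
Hypothesis Fx0 : Om (E (Fc x0)).

Lemma Om_Fatou p : Om p -> Fatou_set F p.
Proof. exact: connected_component_sub. Qed.

Lemma Om_x0 : Om (E x0).
Proof. exact: connected_component_refl. Qed.

(** Inside the Fatou set the points with bounded orbit form a set that is both open
    and closed. *)
Lemma Om_Kset : Om `<=` E @` Kset.
Proof.
have conn : connected Om by exact: component_connected.
have /(_ _ _ _) H := conn (Om `&` (E @` Kset)).
rewrite -H; first by move=> p [].
- by exists (E x0); split; [exact: Om_x0|exists x0].
- exists (E @` Kset)^°; first exact: open_interior.
  rewrite predeqE => p; split; last by move=> [Op /interior_subset].
  move=> [Op [a Ka ap]]; split => //; rewrite -ap in Op *.
  have [r r0 hr] := Fatou_Kset_open (Om_Fatou Op) Ka.
  have [e e0 he] := E_openP a r0; apply/P2_nbhsP; exists e => // q /he [x hx ->].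
  by exists x => //; exact: hr.
- by exists (E @` Kset) => //; exact: Kset_closed.
Qed.

Definition Om_chart := [set x | Om (E x)].

Lemma Om_chart_Kset x : Om_chart x -> Kset x.
Proof. by move=> /Om_Kset [y Ky /E_inj <-]. Qed.

Lemma Om_polydisc a : Om_chart a -> exists2 r : R, 0 < r & polydisc a r `<=` Om_chart.
Proof.
move=> Oa; have [r r0 [hr _]] := Fatou_elim (Om_Fatou Oa).
exists r => // x hx; apply: (polydisc_component hr _ hx Oa).
exact/polydisc_center/ltW.
Qed.

Lemma Om_chart_conn (S : set (R[i] * R[i])) : (exists2 a, Om_chart a & S a) ->
  (forall a, Om_chart a -> S a -> exists2 r : R, 0 < r & polydisc a r `<=` S) ->
  (forall a, Om_chart a -> ~ S a -> exists2 r : R, 0 < r & polydisc a r `<=` ~` S) ->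
  Om_chart `<=` S.
Proof.
move=> [a0 Oa0 Sa0] hS hnS a Oa.
have conn : connected Om by exact: component_connected.
have loc (U : set (R[i] * R[i])) : (forall a, Om_chart a -> U a -> exists2 r : R, 0 < r & polydisc a r `<=` U) ->
    open (E @` (Om_chart `&` U)).
  move=> hU; apply: open_image => b [Ob Ub]; have [r r0 hr] := hU b Ob Ub.
  have [s s0 hs] := Om_polydisc Ob; exists (Num.min r s); first by rewrite lt_min r0.
  by move=> x hx; split; [apply: hs|apply: hr]; apply: polydiscS hx; rewrite ge_min lexx ?orbT.
have eqB : Om `&` (E @` (Om_chart `&` S)) = Om.
  apply: conn.
  - by exists (E a0); split => //; exists a0.
  - by exists (E @` (Om_chart `&` S)) => //; exact: loc.
  - exists (~` (E @` (Om_chart `&` ~` S))); first by rewrite closedC; apply: loc.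
    rewrite predeqE => p; split.
      by move=> [Op [x [Ox Sx] <-]]; split => // -[y [_ nSy] /E_inj yx]; apply: nSy; rewrite yx.
    move=> [Op np]; split => //; have [x Kx xp] := Om_Kset Op.
    exists x => //; split; first by rewrite /Om_chart /= xp.
    by apply: contrapT => nSx; apply: np; exists x => //; split => //; rewrite /Om_chart /= xp.
have : Om (E a) by [].
by rewrite -eqB => -[_ [x [_ Sx] /E_inj <-]].
Qed.

Lemma Om_Fc x : Om_chart x -> Om_chart (Fc x).
Proof.
apply: (Om_chart_conn (S := [set x | Om_chart (Fc x)])).
- by exists x0; [exact: Om_x0|exact: Fx0].
- move=> a _ /= Oa; have [r r0 hr] := Om_polydisc Oa.
  have [d d0 hd] := Fc_cont a r0; exists d => // y /hd; exact: hr.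
- move=> a Oa /= nO; have [r r0 [hr _]] := Fatou_elim (Fatou_Fc (Om_Fatou Oa)).
  have [d d0 hd] := Fc_cont a r0; exists d => // y /hd hy /= Oy.
  apply: nO; apply: (polydisc_component hr hy _ Oy).
  exact/polydisc_center/ltW.
Qed.

(** If points [Fc (u j)] with [u j] in [Om] converge to [a], the [u j] are bounded and
    have a limit point [l] with [Fc l = a]. The Fatou property pulls back to [l], so a
    whole neighbourhood of [l] belongs to the component of the [u j]. *)
Lemma Om_onto y : Om_chart y -> exists2 x, Om_chart x & Fc x = y.
Proof.
apply: (Om_chart_conn (S := [set y | exists2 x, Om_chart x & Fc x = y])).
- by exists (Fc x0); [exact: Fx0|exists x0 => //; exact: Om_x0].
- move=> _ _ [x Ox <-]; have [r r0 hr] := Om_polydisc Ox.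
  have [d d0 hd] := Fc_open x r0; exists d => // b /hd [u hu <-].
  by exists u => //; exact: hr.
move=> a Oa nS; apply: contrapT => nr.
have hx j : exists x, Om_chart x /\ polydisc a j.+1%:R^-1 (Fc x).
  apply: contrapT => nx; apply: nr; exists j.+1%:R^-1; first by rewrite invr_gt0 ltr0n.
  by move=> b hb [x Ox xb]; apply: nx; exists x; rewrite xb.
pose u j := projT1 (cid (hx j)).
have uP j : Om_chart (u j) /\ polydisc a j.+1%:R^-1 (Fc (u j)) by rewrite /u; case: cid.
have uK j := Om_chart_Kset (uP j).1 0%N.
have [l1 hl1] : exists l, tends ultra_nat (fun j => (u j).1) l.
  by apply: (@ultra_cvg _ _ _ _ _ 2); apply: filterE => j; have [] := uK j.
have [l2 hl2] : exists l, tends ultra_nat (fun j => (u j).2) l.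
  by apply: (@ultra_cvg _ _ _ _ _ 3); apply: filterE => j; have [] := uK j.
pose l := (l1, l2).
have near_l (r : R) N : 0 < r -> exists j, (N <= j)%N /\ polydisc l r (u j).
  move=> r0; have G1 := hl1 r r0; have G2 := hl2 r r0.
  have G3 : ultra_nat [set j | (N <= j)%N] by apply: (@ultra_nat_ge N).
  have G12 : ultra_nat ([set t | modc ((u t).1 - l1) <= r] `&` [set t | modc ((u t).2 - l2) <= r]).
    exact: filterI.
  by have [j [[h1 h2] h3]] := ultra_meet G12 G3; exists j.
have Fl : Fc l = a.
  have small (r : R) : 0 < r -> polydisc a (r + r) (Fc l).
    move=> r0; have [d d0 hd] := Fc_cont l r0.
    have [N hN] := harmonic_small 1 r0.
    have [j [Nj hj]] := near_l d N d0.
    have h1 := hd _ hj; have h2 := (uP j).2.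
    have h3 := hN j Nj; rewrite div1r in h3.
    apply: (polydisc_trans (x := Fc (u j))); first exact: polydiscS h3 h2.
    by case: h1 => h1 h1'; split; rewrite modcB.
  have half (r : R) : 0 < r -> polydisc a r (Fc l).
    move=> r0; have r2 : 0 < r / 2 by lra.
    by apply: polydiscS (small _ r2); lra.
  have e1 : (Fc l).1 = a.1 by apply: modc_le_eps => e /half [].
  have e2 : (Fc l).2 = a.2 by apply: modc_le_eps => e /half [].
  by rewrite [LHS]surjective_pairing e1 e2; case: (a).
apply: nS; exists l => //.
have Fatl : Fatou_set F (E l) by apply: Fatou_Fc_inv; rewrite Fl; exact: Om_Fatou.
have [r r0 [hr _]] := Fatou_elim Fatl.
have [j [_ hj]] := near_l r 0%N r0.
apply: (polydisc_component hr hj _ (uP j).1).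
exact/polydisc_center/ltW.
Qed.

Lemma F_Om : F @` Om = Om.
Proof.
rewrite predeqE => p; split.
  move=> [q Oq <-]; have [x Kx xq] := Om_Kset Oq; rewrite -xq F_E.
  by apply: Om_Fc; rewrite /Om_chart /= xq.
move=> Op; have [y Ky yp] := Om_Kset Op.
have [x Ox xy] : exists2 x, Om_chart x & Fc x = y by apply: Om_onto; rewrite /Om_chart /= yp.
by exists (E x) => //; rewrite F_E xy.
Qed.

End Component.

End SkewDynamics.

(** * The second coordinate of the iterates *)

Section FiberPolynomials.
Variable R : realType.
Variable lam : R[i].
Implicit Types (z w : R[i]).
Local Notation Fc := (skew lam).

(** The second coordinate of the iterates as a polynomial in [w] for fixed [z]; the
    polynomial [wzpoly] below is the same function of [z] for fixed [w]. *)
Fixpoint wpoly z n : {poly R[i]} := match n with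
  | 0%N => 'X
  | m.+1 => lam^-1 *: (wpoly z m + (iter m (pz lam) z) *: wpoly z m ^+ 2) + wpoly z m ^+ 3
  end.

Lemma wpolyE z n w : (iter n Fc (z, w)).2 = (wpoly z n).[w].
Proof.
elim: n => [|n IH] /=; first by rewrite hornerX.
by rewrite iter_skew1 IH /qw !hornerE.
Qed.

Lemma wpoly0 z n : (wpoly z n).[0] = 0.
Proof. by rewrite -wpolyE iter_skew20. Qed.

Lemma wpoly_coef1 z n : (wpoly z n)`_1 = lam ^- n.
Proof.
have d (Q : {poly R[i]}) : Q`_1 = Q^`().[0] by rewrite horner_coef0 coef_deriv.
rewrite d; elim: n => [|n IH]; first by rewrite derivX hornerC invr1.
rewrite /= derivD derivZ derivD derivZ !deriv_exp /=.
rewrite !(hornerD, hornerZ, hornerMn, hornerM, horner_exp) wpoly0 IH !expr0n /= !(mulr0, mul0rn, addr0, add0r).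
by rewrite exprS invfM.
Qed.

Fixpoint zpoly n : {poly R[i]} := match n with
  | 0%N => 'X
  | m.+1 => lam *: zpoly m + zpoly m ^+ 3
  end.

Lemma zpolyE n z : iter n (pz lam) z = (zpoly n).[z].
Proof. by elim: n => [|n IH] /=; rewrite ?hornerX // IH /pz !hornerE. Qed.

Fixpoint wzpoly w n : {poly R[i]} := match n with
  | 0%N => w%:P
  | m.+1 => lam^-1 *: (wzpoly w m + zpoly m * wzpoly w m ^+ 2) + wzpoly w m ^+ 3
  end.

Lemma wzpolyE z n w : (iter n Fc (z, w)).2 = (wzpoly w n).[z].
Proof.
elim: n => [|n IH] /=; first by rewrite hornerC.
by rewrite iter_skew1 IH zpolyE /qw !hornerE.
Qed.

End FiberPolynomials.

Section Vitali.
Variable R : realType.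
Variable lam : R[i].
Hypothesis lam_mod : modc lam = 1.
Hypothesis lam_irr : forall k, lam ^+ k.+1 != 1.
Implicit Types (x a : R[i] * R[i]) (z w : R[i]) (e r M : R).
Local Notation Fc := (skew lam).

Definition wzero a := exists2 r : R, 0 < r & forall e : R, 0 < e ->
  exists N, forall n, (N <= n)%N -> forall x, polydisc a r x -> modc (iter n Fc x).2 <= e.

Lemma wzero_open a : wzero a -> exists2 r : R, 0 < r & polydisc a r `<=` wzero.
Proof.
move=> [r r0 h]; exists (r / 2); first lra.
move=> x hx; exists (r / 2); first lra.
move=> e /h [N hN]; exists N => n Nn y hy; apply: hN => //.
have -> : r = r / 2 + r / 2 by lra.
exact: polydisc_trans hx hy.
Qed.

Lemma shift_poly (P : {poly R[i]}) b z : (P \Po ('X + b%:P)).[z] = P.[b + z].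
Proof. by rewrite horner_comp hornerD hornerX hornerC addrC. Qed.

(** [poly_vitali] is applied in the variable [w] for [z] near [s.1], and then in the
    variable [z] for each [w]. *)
Lemma wzero_spread a s r : 0 < r -> polydisc a r s ->
  (forall n x, polydisc a (4 * r) x -> modc (iter n Fc x).2 <= 3) ->
  wzero s -> wzero a.
Proof.
move=> r0 has hB [e0 e00 hs].
(* The polydisc of radius [3 / 2 * r] around [s] contains one of radius [r / 2] around [a]. *)
suff [d d0 hd] : exists2 d : R, 0 < d & forall e : R, 0 < e ->
    exists N, forall n, (N <= n)%N -> forall x, polydisc s (3 / 2 * r) x -> modc (iter n Fc x).2 <= e.
  exists (r / 2); first lra.
  move=> e /hd [N hN]; exists N => n Nn x hx; apply: hN => //.
  have -> : 3 / 2 * r = r + r / 2 by lra.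
  by apply: (polydisc_trans (x := a)) hx; case: has => h1 h2; split; rewrite modcB.
exists 1 => // e e_gt0.
have r3 : 0 < 3 * r by lra.
pose e1 := Num.min e0 (3 * r).
have e10 : 0 < e1 by rewrite lt_min e00.
have [eta1 eta10 h1] := poly_vitali lam_mod lam_irr 3 r3 e10 e_gt0.
have [eta2 eta20 h2] := poly_vitali lam_mod lam_irr 3 r3 e10 eta10.
have [N hN] := hs eta2 eta20; exists N => n Nn x [hx1 hx2].
have hB' (u v : R[i]) : modc u <= 3 * r -> modc v <= 3 * r ->
    modc (iter n Fc (s.1 + u, s.2 + v)).2 <= 3.
  move=> hu hv; apply: hB; have -> : 4 * r = r + 3 * r by lra.
  by apply: (polydisc_trans has); split; rewrite /= addrC addKr.
have e1e : e1 <= e0 by rewrite ge_min lexx.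
have e1r : e1 <= 3 * r by rewrite ge_min lexx orbT.
have small (u v : R[i]) : modc u <= e1 -> modc v <= 3 * r / 2 ->
    modc (iter n Fc (s.1 + u, s.2 + v)).2 <= eta1.
  move=> hu hv; pose P := wpoly lam (s.1 + u) n \Po ('X + s.2%:P).
  have PE y : P.[y] = (iter n Fc (s.1 + u, s.2 + y)).2 by rewrite shift_poly wpolyE.
  rewrite -PE; apply: h2 hv => y hy; rewrite PE.
    by apply: hB' => //; exact: le_trans e1r.
  by apply: hN => //; split; rewrite /= addrC addKr; [exact: le_trans e1e|exact: le_trans e1e].
pose P := wzpoly lam x.2 n \Po ('X + s.1%:P).
have PE y : P.[y] = (iter n Fc (s.1 + y, x.2)).2 by rewrite shift_poly wzpolyE.
have x2E : x.2 = s.2 + (x.2 - s.2) by rewrite addrC subrK.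
have xE : x = (s.1 + (x.1 - s.1), x.2) by rewrite addrC subrK; case: (x).
rewrite xE -PE; apply: (h1 P _ _ (x.1 - s.1)); last lra.
  by move=> y hy; rewrite PE x2E; apply: hB' => //; lra.
move=> y hy; rewrite PE x2E.
by apply: small => //; lra.
Qed.

End Vitali.

(** * The dynamics near the origin *)

Section NearOrigin.
Variable R : realType.
Variable lam : R[i].
Hypothesis lam_mod : modc lam = 1.
Hypothesis lam_irr : forall k, lam ^+ k.+1 != 1.
Implicit Types (x a : R[i] * R[i]) (z w : R[i]) (e r : R).
Local Notation Fc := (skew lam).
Opaque E chordc.

Definition stable (f : R[i] -> R[i]) := forall e : R, 0 < e ->
  exists2 d : R, 0 < d & forall z, modc z <= d -> forall n, modc (iter n f z) <= e.

Definition follows_rotation r := forall z i j, modc z <= r ->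
  modc (iter i (pz lam) z) <= 1 /\
  modc (iter i (pz lam) z - iter j (pz lam) z) <= modc (lam ^+ i - lam ^+ j).

Definition fibre_decay r := forall z w, z != 0 -> modc z <= r ->
  modc (w + conjc z) <= modc z / 10 ->
  forall n, modc (iter n Fc (z, w)).2 <= 1 /\
    modc (iter n Fc (z, w)).2 * modc z <= 5 / n.+1%:R.

Hypothesis stable_p : stable (pz lam).
Hypothesis stable_q : stable (qw lam 0).

(** Stability bounds all the iterates on one disc, which is what the means [cm]
    require. *)
Lemma local_linearization (mu : R[i]) (P : {poly R[i]}) f : modc mu = 1 ->
  (forall k, mu ^+ k.+1 != 1) -> P.[0] = 0 -> P`_1 = mu -> (forall z, P.[z] = f z) ->
  stable f -> exists phi eps, [/\ 0 < eps, phi 0 = 0,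
    near_id phi eps &
    forall z, modc z <= eps -> phi (f z) = mu * phi z].
Proof.
move=> mu1 muk P0 P1 Pf hst.
have [r0 r00 hr] := hst 1 ltr01.
have iE n z : iter n (horner P) z = iter n f z by elim: n => //= n ->.
have hB n z : modc z <= r0 -> modc (iter n (horner P) z) <= 1.
  by move=> zr; rewrite iE; exact: hr.
exists (cm mu P 1).
have r2 : 0 < r0 ^+ 2 by rewrite exprn_gt0.
pose eps := Num.min (r0 / 8) (r0 ^+ 2 / 30 / 30).
have e0 : 0 < eps by rewrite lt_min !divr_gt0.
have e1 : eps <= r0 / 8 by rewrite ge_min lexx.
have e2 : eps * 30 * 30 <= r0 ^+ 2 by rewrite -!ler_pdivlMr // ge_min lexx orbT.
exists eps; split => //; first exact: cm0.
  move=> z w hz hw; have h4 : 2 * eps <= r0 / 4 by lra.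
  apply: (le_trans (phi_near mu1 muk P0 P1 r00 hB hz hw h4)).
  apply: ler_wpM2r; first exact: modc_ge0.
  rewrite ler_pdivrMr //; lra.
move=> z hz; rewrite -Pf.
rewrite (cm_semiconj mu1 1 (B := 1)) ?expr1 // => n; apply: hB; lra.
Qed.

Lemma ppoly_coef1 : (ppoly lam)`_1 = lam.
Proof. by rewrite /ppoly coefD coefZ coefX coefXn /= mulr1 addr0. Qed.

Lemma qpoly_coef1 : (qpoly lam)`_1 = lam^-1.
Proof. by rewrite /qpoly coefD coefZ coefX coefXn /= mulr1 addr0. Qed.

Lemma pz0 : pz lam 0 = 0.
Proof. by rewrite /pz mulr0 expr0n addr0. Qed.

Lemma lamV_irr k : lam^-1 ^+ k.+1 != 1.
Proof. by rewrite exprVn invr_eq1. Qed.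

(** Two iterates of [p] are as close as the corresponding powers of [lam] because
    the linearizing coordinate is close to the identity; the second bound is
    [basin_start]. *)
Lemma near_origin : exists rb : R,
  [/\ 0 < rb, rb <= 1 / 20, follows_rotation rb & fibre_decay rb].
Proof.
have [phi [ep [ep0 phi0 phin phie]]] := @local_linearization lam (ppoly lam) (pz lam) lam_mod
  lam_irr (etrans (ppolyE lam 0) pz0) ppoly_coef1 (ppolyE lam) stable_p.
have q00 : (qpoly lam).[0] = 0 by rewrite qpolyE /qw expr0n !mul0r addr0 mulr0 expr0n addr0.
have [chi [ec [ec0 chi0 chin chie]]] := @local_linearization lam^-1 (qpoly lam) (qw lam 0)
  (lamV_mod lam_mod) lamV_irr q00 qpoly_coef1 (qpolyE lam) stable_q.
pose eps := Num.min (Num.min ep ec) (1 / 10).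
have eps0 : 0 < eps by rewrite !lt_min ep0 ec0 divr_gt0.
have eps1 : eps <= 1 / 10 by rewrite !ge_min lexx !orbT.
have epsp : eps <= ep by rewrite !ge_min lexx.
have epsc : eps <= ec by rewrite !ge_min lexx !orbT.
have phin' : near_id phi eps.
  by move=> z w hz hw; apply: phin; lra.
have chin' : near_id chi eps.
  by move=> z w hz hw; apply: chin; lra.
have phie' z : modc z <= eps -> phi (pz lam z) = lam * phi z by move=> hz; apply: phie; lra.
have chie' z : modc z <= eps -> chi (qw lam 0 z) = lam^-1 * chi z by move=> hz; apply: chie; lra.
have [d1 d10 hd1] := stable_p eps0.
pose rb := Num.min (Num.min d1 (eps / 10)) (1 / 20).
have rb0 : 0 < rb by rewrite !lt_min d10 !divr_gt0.
have rbd : rb <= d1 by rewrite !ge_min lexx.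
have rbe : rb <= eps / 10 by rewrite !ge_min lexx !orbT.
have rb20 : rb <= 1 / 20 by rewrite !ge_min lexx !orbT.
exists rb; split => //.
- move=> z i j hz.
  have hit n : modc (iter n (pz lam) z) <= eps by apply: hd1; lra.
  have phi_it n : phi (iter n (pz lam) z) = lam ^+ n * phi z.
    by elim: n => [|n IH] /=; rewrite ?mul1r // phie' // IH exprS mulrA.
  split; first by apply: le_trans (hit i) _; lra.
  have hi2 : modc (iter i (pz lam) z) <= 2 * eps by have := hit i; lra.
  have hj2 : modc (iter j (pz lam) z) <= 2 * eps by have := hit j; lra.
  have h0 : modc (0 : R[i]) <= 2 * eps by rewrite modc0; lra.
  have hz2 : modc z <= 2 * eps by lra.
  have := phin' _ _ hi2 hj2; rewrite !phi_it -mulrBl.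
  have := phin' _ _ hz2 h0; rewrite phi0 !subr0.
  set x := iter i _ z - _; set u := (lam ^+ i - lam ^+ j) => h1 h2.
  have h3 := modcD (x - u * phi z) (u * phi z); rewrite subrK (modcB x) in h3.
  have h4 := modcD (phi z - z) z; rewrite subrK in h4.
  have h5 : modc (phi z) <= 1 / 10 by lra.
  rewrite modcM in h3.
  have h6 : modc u * modc (phi z) <= modc u * (1 / 10) by rewrite ler_wpM2l ?modc_ge0.
  have := modc_ge0 u; have := modc_ge0 x; lra.
- move=> z w z0 hz hw n.
  have hit m : modc (iter m (pz lam) z) <= eps by apply: hd1; lra.
  have hz10 : modc z <= eps / 10 by lra.
  have [h1 h2] := basin_start lam_mod eps0 eps1 phi0 chi0 phin' chin' phie' chie' z0 hz10 hit hw n.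
  by split => //; lra.
Qed.

(** In the linearizing coordinate the map is a rotation, so no orbit comes close to 0
    unless it starts there. *)
Lemma q_repel : exists2 ec : R, 0 < ec & forall w, modc w <= ec ->
  forall n, modc w / 4 <= modc (iter n (qw lam 0) w).
Proof.
have q00 : (qpoly lam).[0] = 0 by rewrite qpolyE /qw expr0n !mul0r addr0 mulr0 expr0n addr0.
have [chi [ec [ec0 chi0 chin chie]]] := @local_linearization lam^-1 (qpoly lam) (qw lam 0)
  (lamV_mod lam_mod) lamV_irr q00 qpoly_coef1 (qpolyE lam) stable_q.
have [d d0 hd] := stable_q ec0.
exists (Num.min d ec) => [|w]; first by rewrite lt_min d0.
rewrite le_min => /andP [wd we] n.
have hit m : modc (iter m (qw lam 0) w) <= ec by exact: hd.
have chi_it m : chi (iter m (qw lam 0) w) = lam^-1 ^+ m * chi w.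
  by elim: m => [|m IH] /=; rewrite ?mul1r // chie // IH exprS mulrA.
have h0 : modc (0 : R[i]) <= 2 * ec by rewrite modc0; lra.
have hw2 : modc w <= 2 * ec by lra.
have hn2 : modc (iter n (qw lam 0) w) <= 2 * ec by have := hit n; lra.
have h1 := chin _ _ hw2 h0; have h2 := chin _ _ hn2 h0.
rewrite chi0 !subr0 in h1 h2.
have h3 : modc (chi (iter n (qw lam 0) w)) = modc (chi w).
  by rewrite chi_it modcM modcX (lamV_mod lam_mod) expr1n mul1r.
set v := iter n _ w in h2 h3 *.
have h4 := modcD (w - chi w) (chi w); rewrite subrK (modcB w) in h4.
have h5 := modcD (chi v - v) v; rewrite subrK in h5.
have := modc_ge0 w; lra.
Qed.

(** Any sequence of exponents has a subsequence along which the powers of [lam]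
    converge. Then the iterates of [p] converge uniformly, and [w] tends to 0; the limit
    map takes values in the axis. *)
Lemma basin_Fatou (rb : R) z0 w0 : rb <= 1 / 20 ->
   follows_rotation rb -> fibre_decay rb ->
   z0 != 0 -> modc z0 < rb -> modc (w0 + (conjc z0)) < modc z0 / 10 ->
   Fatou_set (Fmap lam) (E (z0, w0)) /\ wzero lam (z0, w0).
Proof.
move=> rb20 hA hB z00 hz0 hw0.
have z0p : 0 < modc z0 by rewrite modc_gt0.
pose r := Num.min (Num.min (modc z0 / 2) (rb - modc z0)) ((modc z0 / 10 - modc (w0 + (conjc z0))) / 3).
have r0 : 0 < r by rewrite !lt_min; apply/andP; split; first (apply/andP; split); lra.
have r1 : r <= modc z0 / 2 by rewrite !ge_min lexx.
have r2 : r <= rb - modc z0 by rewrite !ge_min lexx !orbT.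
have r3 : r <= (modc z0 / 10 - modc (w0 + (conjc z0))) / 3 by rewrite !ge_min lexx !orbT.
have near x : polydisc (z0, w0) r x ->
    [/\ x.1 != 0, modc z0 / 2 <= modc x.1, modc x.1 <= rb & modc (x.2 + (conjc x.1)) <= modc x.1 / 10].
  move=> [/= h1 h2].
  have h3 := modcD (z0 - x.1) x.1; rewrite subrK modcB in h3.
  have h4 := modcD (x.1 - z0) z0; rewrite subrK in h4.
  have h5 : modc z0 / 2 <= modc x.1 by lra.
  split; [by rewrite -modc_gt0; lra|by []|lra|].
  have -> : x.2 + (conjc x.1) = (w0 + (conjc z0)) + ((x.2 - w0) + (conjc (x.1 - z0))).
    by rewrite (rmorphB (@conjc R)) /=; ring.
  apply: (le_trans (modcD _ _)).
  have := modcD (x.2 - w0) (conjc (x.1 - z0)); rewrite modc_conj; lra.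
have small e : 0 < e -> exists N, forall n, (N <= n)%N -> forall x,
    polydisc (z0, w0) r x -> modc (iter n Fc x).2 <= e.
  move=> e0; have ez : 0 < e * (modc z0 / 2) by rewrite mulr_gt0 // divr_gt0.
  have [N hN] := harmonic_small 5 ez; exists N => n Nn x hx.
  have [x0 xz xr xw] := near x hx.
  have xE : x = (x.1, x.2) by case: (x).
  have [_] := hB x.1 x.2 x0 xr xw n; rewrite -xE => h.
  have xp : 0 < modc x.1 by rewrite modc_gt0.
  rewrite -(ler_pM2r xp); apply: (le_trans h); apply: (le_trans (hN n Nn)).
  by rewrite ler_wpM2l // ltW.
split; last by exists r.
apply: (Fatou_intro r0) => n nj.
have [zeta hz] : exists zeta, tends ultra_nat (fun j => lam ^+ n j) zeta.
  by apply: (@ultra_cvg _ _ _ _ _ 1); apply: filterE => j /=; rewrite modcX lam_mod expr1n.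
have [k [kinc hk]] : exists k : nat -> nat, {homo k : i j / (i < j)%N} /\
    forall i, modc (lam ^+ n (k i) - zeta) <= i.+1%:R^-1.
  apply: (extract (Q := fun i j => modc (lam ^+ n j - zeta) <= i.+1%:R^-1)) => i N.
  have i0 : 0 < i.+1%:R^-1 :> R by rewrite invr_gt0 ltr0n.
  have G2 : ultra_nat [set j | (N <= j)%N] by apply: (@ultra_nat_ge N).
  by have [j [h1 h2]] := ultra_meet (hz _ i0) G2; exists j.
exists k => //.
pose chart p := xget (z0, w0) [set x | p = E x].
have chartE x : chart (E x) = x.
  by rewrite /chart; case: xgetP => [y _ /= /E_inj //|/(_ x)]; case.
pose lim z := xget 0 [set l | tends ultra_nat (fun j => iter (n (k j)) (pz lam) z) l].
have limP z : modc z <= rb -> tends ultra_nat (fun j => iter (n (k j)) (pz lam) z) (lim z).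
  move=> hzr; have [l hl] : exists l, tends ultra_nat (fun j => iter (n (k j)) (pz lam) z) l.
    by apply: (@ultra_cvg _ _ _ _ _ 1); apply: filterE => j /=; exact: (hA z (n (k j)) 0%N hzr).1.
  by rewrite /lim; case: xgetP => [//|/(_ l)]; case.
have lim_close z i : modc z <= rb -> modc (iter (n (k i)) (pz lam) z - lim z) <= 2 / i.+1%:R.
  move=> hzr; have hc : tends ultra_nat (fun=> iter (n (k i)) (pz lam) z) (iter (n (k i)) (pz lam) z).
    exact: tends_cst.
  apply: (tends_le _ (tendsB hc (limP z hzr))).
  apply: (@ultra_nat_ge i) => j ij /=.
  apply: (le_trans (hA z _ _ hzr).2).
  apply: (le_trans (modc_triangle _ zeta _)); rewrite (modcB zeta).
  have -> : 2 / i.+1%:R = i.+1%:R^-1 + i.+1%:R^-1 :> R by ring.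
  apply: lerD (hk i) _; apply: le_trans (hk j) _.
  by rewrite lef_pV2 ?posrE ?ltr0n // ler_nat.
exists (fun p => E (lim (chart p).1, 0)) => e e0.
have [d d0 hd] := E_unif 1 e0.
have [N1 hN1] := harmonic_small 2 d0.
have [N2 hN2] := small d d0.
exists (maxn N1 N2) => j; rewrite geq_max => /andP [j1 j2] _ [x hx <-].
rewrite iter_Fmap_E chartE.
have [x0 xz xr xw] := near x hx.
have nkj : (N2 <= n (k j))%N.
  exact: leq_trans j2 (leq_trans (homo_ge kinc j) (nj (k j))).
have xE : x = (x.1, x.2) by case: (x).
apply: hd => /=.
- apply: (tends_le _ (limP _ xr)); apply: filterE => i /=; exact: (hA _ _ 0%N xr).1.
- by rewrite modc0.
- by rewrite iter_skew1; exact: (hA _ _ 0%N xr).1.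
- by have [+ _] := hB x.1 x.2 x0 xr xw (n (k j)); rewrite -xE.
- by rewrite iter_skew1 modcB; apply: (le_trans (lim_close _ _ xr)); exact: hN1.
- by rewrite sub0r modcN; exact: hN2.
Qed.

End NearOrigin.

(** * Irrational rotations *)

Section Rotation.
Variable R : realType.
Implicit Types x y : R.

Lemma expi2piD x y : expi2pi (x + y) = expi2pi x * expi2pi y.
Proof.
rewrite /expi2pi !mulrDr cosD sinD; apply/eqP; rewrite eq_complex /=.
by apply/andP; split; apply/eqP; ring.
Qed.

Lemma expi2pi0 : expi2pi (0 : R) = 1.
Proof. by rewrite /expi2pi !mulr0 cos0 sin0. Qed.

Lemma expi2piX x n : expi2pi x ^+ n = expi2pi (n%:R * x).
Proof.
elim: n => [|n IH]; first by rewrite expr0 mul0r expi2pi0.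
by rewrite exprS IH -expi2piD -nat1r mulrDl mul1r.
Qed.

Lemma expi2pi_mod x : modc (expi2pi x) = 1.
Proof. by rewrite /modc normc_def /= cos2Dsin2 sqrtr1. Qed.

Lemma expi2pi_eq1 x : expi2pi x = 1 -> exists m : int, x = m%:~R.
Proof.
move=> x1; exists (Num.floor x).
pose t := x - (Num.floor x)%:~R.
have t0 : 0 <= t by rewrite subr_ge0 floor_le.
have t1 : t < 1 by rewrite ltrBlDr addrC -[_ + _]/(_ + 1%:~R) -intrD floorD1_gt.
have em (m : nat) : expi2pi (m%:R : R) = 1.
  rewrite -[m%:R]mulr1 -expi2piX.
  suff -> : expi2pi (1 : R) = 1 by rewrite expr1n.
  by rewrite /expi2pi mulr1 mulr_natl cos2pi sin2pi.
have ez (m : int) : expi2pi (m%:~R : R) = 1.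
  case: m => m; first exact: em.
  rewrite NegzE mulrNz; apply: (@mulfI _ (expi2pi (m.+1%:R : R))).
    by rewrite em oner_neq0.
  by rewrite -expi2piD addrN expi2pi0 em mulr1.
have : expi2pi t = 1.
  by rewrite -x1 -(mulr1 (expi2pi t)) -[X in _ * X](ez (Num.floor x)) -expi2piD subrK.
move=> et; have := congr1 (@complex.Re R) et; rewrite /expi2pi /= => c1.
have s0 : sin (pi * t) = 0.
  apply/eqP; rewrite -norm_cos_eq1 -sqrp_eq1 // real_normK ?num_real //.
  have : cos (2 * pi * t) = cos ((pi * t) *+ 2).
    by congr cos; ring.
  by rewrite c1 cos_mulr2n => h; apply/eqP; lra.
have [tz|tn] := eqVneq t 0; first by apply/eqP; rewrite -subr_eq0 -/t tz.
have tp : 0 < t by rewrite lt_neqAle eq_sym tn.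
have pp := pi_gt0 R.
have : 0 < sin (pi * t).
  apply: sin_gt0_pi; rewrite mulr_gt0 //=.
  by rewrite -[ltRHS]mulr1 ltr_pM2l.
by rewrite s0 ltxx.
Qed.

Lemma expi2pi_irr x : irrational x -> forall k, expi2pi x ^+ k.+1 != 1.
Proof.
move=> xirr k; apply/eqP; rewrite expi2piX => /expi2pi_eq1[m xm]; apply: xirr.
exists (m%:~R / k.+1%:R : rat) => //.
rewrite fmorph_div /= ratr_int ratr_nat -xm mulrC mulKf //.
Qed.

End Rotation.

Section Cubic.
Variable R : realType.
Implicit Types mu x : R[i].

Lemma cubic_stable mu : modc mu = 1 ->
  linearizable (fun z : R[i] => mu * z + z ^+ 3) mu ->
  stable (fun z => mu * z + z ^+ 3).
Proof.
move=> mu1 lin; apply: (linearizable_stable mu1 _ lin) => x x1.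
apply: (le_trans (modcD _ _)); rewrite modcM modcX mu1 mul1r.
have x0 := modc_ge0 x.
have : modc x ^+ 3 <= modc x.
  by rewrite exprS ler_piMr // exprn_ile1.
lra.
Qed.

End Cubic.

(** * Immersed discs *)

Section Immersion.
Variable R : realType.
Variable lam : R[i].
Hypothesis lam_mod : modc lam = 1.
Hypothesis lam_irr : forall k, lam ^+ k.+1 != 1.
Local Notation C := (R[i] : numClosedFieldType).
Implicit Types (f g : R[i] -> R[i]) (a c x y : R[i]) (r : R).
Opaque E.

Lemma approx_quadratic f a r : 0 < r -> approx f a r ->
  exists c, exists2 K : R, 0 <= K &
  forall x, modc x <= r / 4 -> modc (f (a + x) - f a - c * x) <= K * modc x ^+ 2.
Proof.
move=> r0 hf; have [M M0 hM] := approx_bdd (ltW r0) hf.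
exists (tc lam f a r 1), (4 * M / r ^+ 2).
  by rewrite divr_ge0 ?exprn_ge0 ?(ltW r0) // mulr_ge0.
move=> x xr; have z0 : modc (0 : R[i]) <= modc x by rewrite modc0 modc_ge0.
have := approx_diff lam_mod lam_irr r0 hf hM (lexx (modc x)) z0 xr.
by rewrite addr0 subr0 expr2 !mulrA [_ * modc x / r ^+ 2]mulrAC.
Qed.

Lemma dquot_cvg f (a c : C) r K : 0 < r -> 0 <= K ->
  (forall x, modc x <= r -> modc (f (a + x) - f a - c * x) <= K * modc x ^+ 2) ->
  ((h^-1 * (f (h + a) - f a)) @[h --> (0 : C)^'] --> (c : C)).
Proof.
move=> r0 K0 hf A /nbhs_modcP [d d0 hA]; apply/nbhs_modcP.
exists (Num.min r (d / (K + 1))).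
  by rewrite lt_min r0 divr_gt0 //; lra.
move=> h; rewrite subr0 le_min => /andP[hr hd] h0; apply: hA => /=.
have m0 : 0 < modc h by rewrite modc_gt0.
have -> : h^-1 * (f (h + a) - f a) - c = h^-1 * (f (a + h) - f a - c * h).
  by rewrite [h + a]addrC; field.
rewrite modcM modcV mulrC ler_pdivrMr //.
apply: (le_trans (hf h hr)); rewrite expr2 mulrA ler_pM2r //.
move: hd; rewrite ler_pdivlMr; last lra.
by have := modc_ge0 h; nra.
Qed.

Lemma vecE (x : R[i]) : vec (x, 0) = x *: delta_mx 0 0 + delta_mx 0 2 :> 'rV[C]_3.
Proof.
apply/rowP => j; rewrite !mxE (tnth_nth 0) /=.
by case: j => -[|[|[|//]]] hj /=; rewrite ?mulr1 ?mulr0 ?addr0 ?add0r.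
Qed.

Lemma vec_derive f (a c : C) r K : 0 < r -> 0 <= K ->
  (forall x, modc x <= r -> modc (f (a + x) - f a - c * x) <= K * modc x ^+ 2) ->
  derivable (fun x : C => vec (f x, 0) : 'rV[C]_3) a 1 /\
  'D_1 (fun x : C => vec (f x, 0) : 'rV[C]_3) a = c *: delta_mx 0 0.
Proof.
move=> r0 K0 hf; have hc := dquot_cvg r0 K0 hf.
suff h : (h^-1 *: ((vec (f (h *: (1 : C) + a), 0) : 'rV[C]_3) - vec (f a, 0)))
    @[h --> (0 : C)^'] --> (c *: delta_mx 0 0 : 'rV[C]_3).
  by split; [apply/cvg_ex; eexists; exact: h|exact: cvg_lim h].
have -> : (fun h : C => h^-1 *: ((vec (f (h *: (1 : C) + a), 0) : 'rV[C]_3) - vec (f a, 0))) =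
  (fun h : C => (h^-1 * (f (h + a) - f a)) *: delta_mx 0 0).
  apply/funext => h; rewrite !vecE opprD addrACA subrr addr0 -scalerBl scalerA.
  by rewrite [h *: 1]mulr1.
exact: cvgZl hc.
Qed.

Lemma vec_rank (b c : R[i]) : c != 0 ->
  \rank (col_mx (vec (b, 0) : 'rV[C]_3) (c *: delta_mx 0 0 : 'rV[C]_3)) = 2%N.
Proof.
move=> c0; apply/eqP; apply/row_freeP.
exists (row_mx (delta_mx 2 0 : 'cV[C]_3) (c^-1 *: delta_mx 0 0 - (b / c) *: delta_mx 2 0 : 'cV[C]_3)).
rewrite mul_col_row scalar_mx_block; congr block_mx;
  apply/matrixP => i j; rewrite !ord1 !mxE !big_ord_recl big_ord0;
  rewrite !mxE ?(tnth_nth 0) /= ?(mulr1, mulr0, addr0, add0r, mul1r, mul0r, subr0, oppr0) //.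
  by rewrite subrr.
by rewrite divff.
Qed.

(** If the linear coefficient of [g] were 0, [g] would contract distances to [a]
    quadratically, and the locally Lipschitz map [f] could not undo this. *)
Lemma left_inverse_immersed f g a r s : 0 < r -> approx g a r ->
  0 < s -> approx f (g a) s ->
  (exists2 d : R, 0 < d & forall x, modc x <= d -> f (g (a + x)) = a + x) ->
  exists c, exists2 K : R, c != 0 /\ 0 <= K &
  forall x, modc x <= r / 4 -> modc (g (a + x) - g a - c * x) <= K * modc x ^+ 2.
Proof.
move=> r0 hg s0 hf [d d0 fgd].
have [c [K K0 hK]] := approx_quadratic r0 hg.
exists c, K => //; split=> //; apply/eqP => c0.
have [c' [L L0 hL]] := approx_quadratic s0 hf.
have s4 : 0 < s / 4 by lra.
have [d' d'0 hd'] := approx_cont r0 hg s4.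
have f_lip y : modc y <= s / 4 -> modc (f (g a + y) - f (g a)) <= (modc c' + L * (s / 4)) * modc y.
  move=> ys; have h := hL y ys; have y0 := modc_ge0 y.
  have := modcD (f (g a + y) - f (g a) - c' * y) (c' * y); rewrite subrK modcM => h'.
  have : L * modc y ^+ 2 <= L * (s / 4) * modc y.
    by rewrite expr2 mulrA ler_wpM2r // ler_wpM2l.
  lra.
set B := modc c' + L * (s / 4) in f_lip.
have B0 : 0 <= B.
  by rewrite addr_ge0 ?modc_ge0 // mulr_ge0 // ltW.
pose t := Num.min (Num.min d d') (Num.min (r / 4) (1 / (B * K + 1))).
have BK : 0 <= B * K by rewrite mulr_ge0.
have t0 : 0 < t by rewrite !lt_min d0 d'0 !divr_gt0 //; lra.
have tm : modc t%:C = t by rewrite modc_real gtr0_norm.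
have [td td' tr tB] : [/\ t <= d, t <= d', t <= r / 4 & t <= 1 / (B * K + 1)].
  by split; rewrite !ge_min lexx ?orbT.
have xd : modc t%:C <= d by rewrite tm.
have xd' : modc t%:C <= d' by rewrite tm.
have xr : modc t%:C <= r / 4 by rewrite tm.
have h1 := f_lip _ (hd' _ xd').
rewrite [g a + _]addrC subrK fgd // in h1.
have fa : f (g a) = a by have := fgd 0; rewrite addr0 modc0; apply; exact: ltW.
rewrite fa [a + t%:C - a]addrC addKr tm in h1.
have := hK _ xr; rewrite c0 mul0r subr0 tm => h2.
have h3 : B * modc (g (a + t%:C) - g a) <= B * (K * t ^+ 2) by rewrite ler_wpM2l.
have BK1 : 0 < B * K + 1 by lra.
have h4 : t * (B * K + 1) <= 1 by rewrite -ler_pdivlMr.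
have : t * t * (B * K + 1) <= t * 1 by rewrite -mulrA ler_pM2l.
have : B * (K * t ^+ 2) = t * t * (B * K) by rewrite expr2; ring.
have : 0 < t * t by rewrite mulr_gt0.
have := le_trans h1 h3; clear h1 h3; rewrite mulr1 mulrDr mulr1. lra.
Qed.

End Immersion.

Section ConjC.
Variable R : realType.
Implicit Types x y : R[i].

Lemma conjcD x y : conjc (x + y) = conjc x + conjc y.
Proof. exact: (rmorphD (@conjc R)). Qed.

Lemma conjcB x y : conjc (x - y) = conjc x - conjc y.
Proof. exact: (rmorphB (@conjc R)). Qed.

Lemma conjcM x y : conjc (x * y) = conjc x * conjc y.
Proof. exact: (rmorphM (@conjc R)). Qed.

Lemma conjcX x n : conjc (x ^+ n) = conjc x ^+ n.
Proof. exact: (rmorphXn (@conjc R)). Qed.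

End ConjC.

(** * The Fatou component *)

Section MainComponent.
Variable R : realType.
Variable lam : R[i].
Hypothesis lam_mod : modc lam = 1.
Hypothesis lam_irr : forall k, lam ^+ k.+1 != 1.
Hypothesis stable_q : stable (qw lam 0).
Implicit Types (x a : R[i] * R[i]) (z w : R[i]) (e r : R).
Local Notation Fc := (skew lam).
Local Notation F := (Fmap (lam : (R[i] : numClosedFieldType))).
Opaque E chordc tau.

Variable rb : R.
Hypothesis rb0 : 0 < rb.
Hypothesis rb20 : rb <= 1 / 20.
Hypothesis orb_p : follows_rotation lam rb.
Hypothesis orb_q : fibre_decay lam rb.

(** A neighbourhood of the graph [w = - conj z] over a punctured disc. On the graph
    [z * w] is the negative number [- |z|^2], which is the attracting direction. *)
Definition basin x := [/\ x.1 != 0, modc x.1 < rb & modc (x.2 + (conjc x.1)) < modc x.1 / 10].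

Lemma basin_Fat x : basin x -> Fatou_set F (E x) /\ wzero lam x.
Proof.
case: x => z w [z0 hz hw].
exact: (basin_Fatou lam_mod rb20 orb_p orb_q z0 hz hw).
Qed.

Definition base_rad : R := rb / 2.
Definition base_pt : R[i] * R[i] := (base_rad%:C, - base_rad%:C).

Lemma base_rad_gt0 : 0 < base_rad.
Proof. by rewrite divr_gt0. Qed.

Lemma basin_diag z : z != 0 -> modc z < rb -> basin (z, - (conjc z)).
Proof.
move=> z0 hz; split => //=.
by rewrite addNr modc0 divr_gt0 // modc_gt0.
Qed.

Lemma mod_base_rad : modc base_rad%:C = base_rad.
Proof. by rewrite modc_real gtr0_norm // base_rad_gt0. Qed.

Lemma base_rad_lt : base_rad < rb.
Proof. by have h := rb0; rewrite /base_rad; lra. Qed.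

Lemma base_rad_neq0 : (base_rad%:C : R[i]) != 0.
Proof. by rewrite -modc_gt0 mod_base_rad base_rad_gt0. Qed.

Lemma base_diag : base_pt = (base_rad%:C, - (conjc (base_rad%:C))).
Proof. by rewrite conjc_real. Qed.

Lemma basin_base : basin base_pt.
Proof. by rewrite base_diag; apply: basin_diag; rewrite ?base_rad_neq0 // mod_base_rad base_rad_lt. Qed.

Let Om := connected_component (Fatou_set F) (E base_pt).
Let O := Om_chart lam base_pt.

Lemma diag_segment u v : u != 0 -> v != 0 -> modc u < rb -> modc v < rb ->
  (forall t : R, 0 <= t -> t <= 1 -> u + t%:C * (v - u) != 0) ->
  O (u, - (conjc u)) -> O (v, - (conjc v)).
Proof.
move=> u0 v0 hu hv hn; apply: segment_component => t base_rad t1.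
apply: (basin_Fat _).1.
rewrite /segpt /=.
have -> : - (conjc u) + t%:C * (- (conjc v) - - (conjc u)) = - (conjc (u + t%:C * (v - u))).
  rewrite conjcD conjcM conjcB conjc_real; ring.
apply: basin_diag; first exact: hn.
have -> : u + t%:C * (v - u) = (1 - t)%:C * u + t%:C * v by rewrite rmorphB rmorph1; ring.
apply: (le_lt_trans (modcD _ _)); rewrite !modcM !modc_real !ger0_norm //; last lra.
have [t00|tp] := eqVneq t 0; first by rewrite t00 mul0r addr0 subr0 mul1r.
have tgt : 0 < t by rewrite lt_neqAle eq_sym tp.
have : t * modc v < t * rb by rewrite ltr_pM2l.
have : (1 - t) * modc u <= (1 - t) * rb by rewrite ler_wpM2l //; [lra|exact: ltW].
lra.
Qed.

Lemma O_base : O base_pt.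
Proof. by apply: connected_component_refl; exact: (basin_Fat basin_base).1. Qed.

(** A segment of the punctured disc avoids 0 when one of its ends is real and the
    other is not; real points are reached through an imaginary one. *)
Lemma O_diag z : z != 0 -> modc z < rb -> O (z, - (conjc z)).
Proof.
move=> z0 hz; have Ox := O_base; rewrite base_diag in Ox; have tp := base_rad_gt0.
have pos (u v : R[i]) : complex.Im v != 0 -> complex.Im u = 0 -> u != 0 ->
    forall t : R, u + t%:C * (v - u) != 0.
  move=> iv iu u0 t; apply: contraNneq u0 => h.
  have := congr1 (@complex.Im R) h; move: h iu iv; case: u => ur ui; case: v => vr vi /= + ui0 vi0.
  move=> h; rewrite ui0 => /eqP.
  rewrite add0r mul0r oppr0 !addr0 mulf_eq0 (negbTE vi0) orbF => /eqP tz.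
  by move: h; rewrite tz mul0r addr0 ui0 => ->.
have iz (v : R[i]) : complex.Im v != 0 -> modc v < rb -> O (v, - (conjc v)).
  move=> iv hv; apply: (diag_segment base_rad_neq0 _ _ hv _ Ox).
  - by apply: contraNneq iv => ->.
  - by rewrite mod_base_rad base_rad_lt.
  - by move=> t _ _; apply: pos iv _ base_rad_neq0 t.
have [iz0|/iz] := eqVneq (complex.Im z) 0; last exact.
pose v : R[i] := (base_rad%:C * 'i%C).
have iv : complex.Im v != 0 by rewrite /v ImiRe /= gt_eqF.
have mi : modc ('i%C : R[i]) = 1.
  by apply/eqP; rewrite -(eqrXn2 (_ : 0 < 2)%N) ?modc_ge0 // -modcX sqr_i modcN modc1 expr1n.
have hv : modc v < rb by rewrite /v modcM mi mulr1 mod_base_rad base_rad_lt.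
have v0 : v != 0 by apply: contraNneq iv => ->.
apply: (diag_segment v0 z0 hv hz _ (iz v iv hv)) => t base_rad' t1.
have -> : v + t%:C * (z - v) = z + (1 - t)%:C * (v - z) by rewrite rmorphB rmorph1; ring.
exact: pos.
Qed.

Lemma O_basin x : basin x -> O x.
Proof.
case: x => z w [/= z0 hz hw]; apply: segment_component (O_diag z0 hz) => t base_rad' t1.
apply: (basin_Fat _).1; split; rewrite /segpt /= subrr mulr0 addr0 //.
have -> : - (conjc z) + t%:C * (w - - (conjc z)) + (conjc z) = t%:C * (w + (conjc z)) by ring.
rewrite modcM modc_real ger0_norm //; apply: le_lt_trans hw.
by rewrite ler_piMl ?modc_ge0.
Qed.

Lemma basin_Fbase : basin (Fc base_pt).
Proof.
have tp := base_rad_gt0; have tl := base_rad_lt; have tr : base_rad = rb / 2 by []; have r20 := rb20.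
have t2 : base_rad ^+ 2 <= 1 / 1600.
  by rewrite expr2; apply: (@le_trans _ _ (1 / 40 * (1 / 40))); [apply: ler_pM; lra|lra].
have t3 : base_rad ^+ 3 <= base_rad / 1600.
  by rewrite exprS; apply: (@le_trans _ _ (base_rad * (1 / 1600))); [rewrite ler_wpM2l // ltW|lra].
have t3p : 0 < base_rad ^+ 3 by rewrite exprn_gt0.
have m3 : modc (base_rad%:C ^+ 3) = base_rad ^+ 3 by rewrite modcX mod_base_rad.
have ml : modc (lam * base_rad%:C) = base_rad by rewrite modcM lam_mod mul1r mod_base_rad.
have z1 : modc (lam * base_rad%:C + base_rad%:C ^+ 3) <= base_rad + base_rad ^+ 3.
  by apply: (le_trans (modcD _ _)); rewrite ml m3.
have z2 : base_rad - base_rad ^+ 3 <= modc (lam * base_rad%:C + base_rad%:C ^+ 3).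
  have := modc_sub (lam * base_rad%:C + base_rad%:C ^+ 3) (base_rad%:C ^+ 3).
  by rewrite addrK ml m3; lra.
rewrite /basin /skew /= /pz /qw; split; first by rewrite -modc_gt0; lra.
  lra.
have -> : lam^-1 * (- base_rad%:C + base_rad%:C * (- base_rad%:C) ^+ 2) + (- base_rad%:C) ^+ 3 + (conjc (lam * base_rad%:C + base_rad%:C ^+ 3)) =
   lam^-1 * base_rad%:C ^+ 3.
  rewrite conjcD conjcM conjcX conjc_real (conjc_unit lam_mod); ring.
rewrite modcM modcV lam_mod invr1 mul1r m3; lra.
Qed.

Lemma Om_Fbase : Om (E (Fc base_pt)).
Proof. exact: O_basin basin_Fbase. Qed.

Lemma base_Fatou : Fatou_set F (E base_pt).
Proof. exact: (basin_Fat basin_base).1. Qed.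

Lemma base_Kset : Kset lam base_pt.
Proof.
move=> n; have [xn xr xw] := basin_base.
have [h _] := orb_q xn (ltW xr) (ltW xw) n; rewrite iter_skew1.
have [h' _] := orb_p n 0%N (ltW xr).
by split; [lra|apply: (le_trans h); lra].
Qed.

(** The convergence holds near the base point, and [wzero_spread] propagates it
    because the orbits in [Om] are bounded. *)
Lemma Om_wzero x : O x -> wzero lam x.
Proof.
apply: (Om_chart_conn lam_mod base_Fatou base_Kset (S := wzero lam)).
- by exists base_pt; [exact: O_base|exact: (basin_Fat basin_base).2].
- by move=> a _; exact: wzero_open.
- move=> a Oa na; have [r r0 hr] := Om_polydisc Oa.
  have r4 : 0 < r / 4 by lra.
  exists (r / 4) => // s has ws; apply: na; apply: (wzero_spread lam_mod lam_irr r4 has _ ws).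
  move=> n y; rewrite (_ : 4 * (r / 4) = r); last by field.
  by move=> /hr Ox; exact: (Om_chart_Kset lam_mod base_Fatou base_Kset Ox n).2.
Qed.

(** The derivative of the [N]-th iterate in [w] has modulus 1 on the axis, so by
    Cauchy's estimate the iterate cannot be uniformly small around [z]. *)
Lemma Om_not_axis z : ~ O (z, 0).
Proof.
move=> /Om_wzero [r r0 h].
have e0 : 0 < r / 2 by lra.
have [N hN] := h _ e0.
have hP (x : R[i]) : modc x <= r -> modc (wpoly lam z N).[x] <= r / 2.
  by move=> xr; rewrite -wpolyE; apply: hN => //; split; rewrite /= ?subrr ?modc0 ?subr0 // ltW.
have := poly_cauchy lam_mod lam_irr 1 (ltW r0) hP.
rewrite wpoly_coef1 (lamXV_mod lam_mod) mul1r expr1; lra.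
Qed.

(** On the fibre the orbits of the second coordinate follow [q 0]. By [q_repel] they
    reach small values only if they reach 0, so some iterate would vanish on a disc,
    although its derivative at 0 has modulus 1. *)
Lemma Om_not_fiber0 w : ~ O (0, w).
Proof.
move=> /Om_wzero [r r0 h].
have [ec ec0 hec] := q_repel lam_mod lam_irr stable_q.
have [N hN] := h _ ec0.
have pz_0 n : iter n (pz lam) 0 = 0 by elim: n => //= n ->; exact: pz0.
have zero y : modc y <= r -> (wpoly lam 0 N).[w + y] = 0.
  move=> yr; rewrite -wpolyE; set v := (iter N Fc (0, w + y)).2.
  have hy : polydisc (0, w) r (0, w + y).
    by split; [rewrite /= subrr modc0 ltW|rewrite /= addrC addKr].
  have hv : modc v <= ec by apply: hN.
  apply: modc_le_eps => e e0; rewrite subr0.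
  have e4 : 0 < e / 4 by lra.
  have [M hM] := h _ e4.
  have it : (iter (M + N) Fc (0, w + y)).2 = iter M (qw lam 0) v.
    rewrite iterD; have -> : iter N Fc (0, w + y) = (0, v).
      by rewrite [LHS]surjective_pairing iter_skew1 /= pz_0.
    exact: iter_skew02.
  have := hM (M + N)%N (leq_addr _ _) _ hy; rewrite it.
  by have := hec v hv M; lra.
pose Q := wpoly lam 0 N \Po ('X + w%:P).
have Q0 : Q = 0.
  apply/polyP => k; rewrite coef0; apply/eqP; rewrite -modc_eq0 eq_le modc_ge0 andbT.
  have hQ y : modc y <= r -> modc Q.[y] <= 0.
    by move=> yr; rewrite /Q shift_poly zero // modc0.
  have := poly_cauchy lam_mod lam_irr k (ltW r0) hQ.
  by rewrite pmulr_lle0 // exprn_gt0.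
have all0 y : (wpoly lam 0 N).[y] = 0.
  have := shift_poly (wpoly lam 0 N) w (y - w); rewrite -/Q Q0 horner0.
  by rewrite addrC subrK.
have h1 y : modc y <= 1 -> modc (wpoly lam 0 N).[y] <= 0 by move=> _; rewrite all0 modc0.
have := poly_cauchy lam_mod lam_irr 1 ler01 h1.
rewrite wpoly_coef1 (lamXV_mod lam_mod) mul1r expr1; lra.
Qed.

Definition Om_proj : set R[i] := [set z | exists w, O (z, w)].
(** Adding the fixed point 0 turns the projection of [Om] into a domain to which
    [siegel_disk] applies. *)
Definition rot_dom : set R[i] := [set z | z = 0 \/ Om_proj z].

Lemma Om_proj_neq0 z : Om_proj z -> z != 0.
Proof. by move=> [w Ow]; apply/eqP => z0; apply: (@Om_not_fiber0 w); rewrite -z0. Qed.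

Lemma rot_dom_proj z : rot_dom z -> z != 0 -> Om_proj z.
Proof. by move=> [->|//]; rewrite eqxx. Qed.

Lemma Om_proj_disc z : z != 0 -> modc z < rb -> Om_proj z.
Proof. by move=> z0 hz; exists (- (conjc z)); exact: O_diag. Qed.

Lemma rot_dom_disc z : modc z <= base_rad -> rot_dom z.
Proof.
move=> hz; have [->|z0] := eqVneq z 0; first by left.
by right; apply: Om_proj_disc z0 _; have := base_rad_lt; lra.
Qed.

Lemma Om_proj_open (a : R[i]) : Om_proj a -> exists2 r : R, 0 < r & forall x : R[i], modc x <= r -> Om_proj (a + x).
Proof.
move=> [w Ow]; have [r r0 hr] := Om_polydisc Ow.
exists r => // x xr; exists w; apply: hr; split => /=; first by rewrite addrC addKr.
by rewrite subrr modc0 ltW.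
Qed.

Lemma rot_dom_open (a : R[i]) : rot_dom a -> exists2 r : R, 0 < r & forall x : R[i], modc x <= r -> rot_dom (a + x).
Proof.
case=> [->|/Om_proj_open [r r0 hr]].
  by exists base_rad; [exact: base_rad_gt0|move=> x; rewrite add0r; exact: rot_dom_disc].
by exists r => // x /hr; right.
Qed.

Lemma Om_proj_near0 (r : R) : 0 < r -> exists2 y, Om_proj y & modc y <= r.
Proof.
move=> r0; pose m := Num.min r base_rad.
have m0 : 0 < m by rewrite lt_min r0 base_rad_gt0.
have mm : modc m%:C = m by rewrite modc_real gtr0_norm.
exists m%:C; last by rewrite mm ge_min lexx.
apply: Om_proj_disc; first by rewrite -modc_gt0 mm.
by rewrite mm; apply: le_lt_trans base_rad_lt; rewrite ge_min lexx orbT.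
Qed.

Lemma Om_proj_dich (S : set R[i]) :
  (forall a : R[i], rot_dom a -> S a -> exists2 r : R, 0 < r & forall x : R[i], modc x <= r -> rot_dom (a + x) -> S (a + x)) ->
  (forall a : R[i], rot_dom a -> ~ S a -> exists2 r : R, 0 < r & forall x : R[i], modc x <= r -> rot_dom (a + x) -> ~ S (a + x)) ->
  forall a : R[i], Om_proj a -> S a -> Om_proj `<=` S.
Proof.
move=> hS hnS a [w Ow] Sa z [w' Ow'].
have V_1 x : O x -> Om_proj x.1 by move=> Ox; exists x.2; case: x Ox.
have lift (T : set R[i]) b : O b ->
   (exists2 r : R, 0 < r & forall x : R[i], modc x <= r -> rot_dom (b.1 + x) -> T (b.1 + x)) ->
   exists2 r : R, 0 < r & polydisc b r `<=` [set x | T x.1].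
  move=> Ob [r r0 hr]; have [s s0 hs] := Om_polydisc Ob.
  exists (Num.min r s) => [|x hx]; first by rewrite lt_min r0.
  have xO : O x by apply: hs; apply: polydiscS hx; rewrite ge_min lexx orbT.
  have [h1 _] : polydisc b r x by apply: polydiscS hx; rewrite ge_min lexx.
  have := hr _ h1; rewrite addrC subrK; apply; right; exact: V_1.
apply: (Om_chart_conn lam_mod base_Fatou base_Kset (S := [set x | S x.1]) _ _ _ Ow').
- by exists (a, w).
- by move=> b Ob Sb; apply: (lift S b Ob); apply: hS => //; right; exact: V_1.
- by move=> b Ob Sb; apply: (lift (~` S) b Ob); apply: hnS => //; right; exact: V_1.
Qed.

Lemma rot_dom_conn : econn rot_dom.
Proof.
move=> S [a Va Sa] hS hnS.
have [u Vu Su] : exists2 u, Om_proj u & S u.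
  case: Va Sa => [->|Va] Sa; last by exists a.
  have [|r r0 hr] := hS 0 _ Sa; first by left.
  have [y Vy hy] := Om_proj_near0 r0; exists y => //.
  by have := hr y hy; rewrite add0r; apply; right.
have sub := Om_proj_dich hS hnS Vu Su.
move=> z [->|/sub //]; apply: contrapT => nS.
have [|r r0 hr] := hnS 0 _ nS; first by left.
have [y Vy hy] := Om_proj_near0 r0.
by have := hr y hy; rewrite add0r; apply; [right|exact: sub].
Qed.

Lemma Om_proj_stable z : Om_proj z -> Om_proj (pz lam z).
Proof.
move=> [w Ow]; exists (qw lam z w).
exact: (Om_Fc lam_mod base_Fatou base_Kset Om_Fbase Ow).
Qed.

Lemma rot_dom_stable z : rot_dom z -> rot_dom (pz lam z).
Proof. by case=> [->|/Om_proj_stable]; [left; exact: pz0|right]. Qed.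

Lemma rot_dom_bounded z : rot_dom z -> modc z <= 2.
Proof.
case=> [->|[w Ow]]; first by rewrite modc0.
exact: (Om_chart_Kset lam_mod base_Fatou base_Kset Ow 0%N).1.
Qed.

Theorem rotation_domain : exists (s : R) (f g : R[i] -> R[i]),
  [/\ 0 < s, f 0 = 0,
      forall z, rot_dom z -> [/\ modc (f z) < s, g (f z) = z & f (pz lam z) = lam * f z],
      forall xi, modc xi < s -> rot_dom (g xi) /\ f (g xi) = xi &
      (forall a : R[i], rot_dom a -> exists2 r : R, 0 < r & approx f a r) /\
      (forall xi, modc xi < s -> exists2 r : R, 0 < r & approx g xi r)].
Proof.
have hp0 : (ppoly lam).[0] = 0 by rewrite ppolyE pz0.
have st z : rot_dom z -> rot_dom (horner (ppoly lam) z) by move=> /rot_dom_stable; rewrite /horner -ppolyE.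
have [s [f [g [s0 f0 h1 h2 h3]]]] := siegel_disk lam_mod lam_irr hp0 (ppoly_coef1 lam)
  base_rad_gt0 rot_dom_disc rot_dom_open rot_dom_conn st rot_dom_bounded.
exists s, f, g; split => // z /h1 [h4 h5 h6]; split => //.
by rewrite -ppolyE.
Qed.

Lemma rotation_unit_disk : exists f g : R[i] -> R[i],
  [/\ f 0 = 0,
      forall z, rot_dom z -> [/\ modc (f z) < 1, g (f z) = z & f (pz lam z) = lam * f z],
      forall xi, modc xi < 1 -> rot_dom (g xi) /\ f (g xi) = xi,
      forall a : R[i], rot_dom a -> exists2 r : R, 0 < r & approx f a r &
      forall xi, modc xi < 1 -> exists2 r : R, 0 < r & approx g xi r].
Proof.
have [s [f [g [s0 f0 fV gD [fA gA]]]]] := rotation_domain.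
have sn : s%:C != 0 :> R[i] by rewrite -modc_gt0 modc_real normr_gt0 gt_eqF.
have ms : modc s%:C = s by rewrite modc_real gtr0_norm.
have sx xi : modc xi < 1 -> modc (s%:C * xi) < s.
  by move=> x1; rewrite modcM ms gtr_pMr.
exists (fun z => s%:C^-1 * f z), (fun xi => g (s%:C * xi)).
split; first by rewrite f0 mulr0.
- move=> z /fV [f1 gf fl]; rewrite modcM modcV ms mulrC ltr_pdivrMr // mul1r mulVKf // fl.
  by split=> //; ring.
- by move=> xi /sx /gD [Vg fg]; rewrite fg mulKf.
- by move=> a /fA [r r0 hf]; exists r => //; apply: approxZ hf; exact: ltW.
- move=> xi /sx /gA [r r0 hg]; exists (r / s); first by rewrite divr_gt0.
  have rs : 0 <= r / s by rewrite ltW // divr_gt0.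
  apply: (approx_comp rs hg); first by apply: approxZ => //; exact: approx_id.
  by move=> x; rewrite mulrDr addrC addKr modcM ms ler_pdivlMr // mulrC.
Qed.

(** * The rotation disc in the boundary *)

Section RotationDisk.
Local Notation C := (R[i] : numClosedFieldType).
Variables f g : R[i] -> R[i].
Hypothesis f_0 : f 0 = 0.
Hypothesis f_dom : forall z, rot_dom z -> [/\ modc (f z) < 1, g (f z) = z & f (pz lam z) = lam * f z].
Hypothesis g_disk : forall xi, modc xi < 1 -> rot_dom (g xi) /\ f (g xi) = xi.
Hypothesis f_hol : forall a : R[i], rot_dom a -> exists2 r : R, 0 < r & approx f a r.
Hypothesis g_hol : forall xi, modc xi < 1 -> exists2 r : R, 0 < r & approx g xi r.

Definition rotation_disk : set (P2 C) := [set E (z, 0) | z in Om_proj].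
Local Notation D := rotation_disk.
Definition disk_param (xi : C) : P2 C := E (g xi, 0).

Lemma rot_dom0 : rot_dom 0.
Proof. by left. Qed.

Lemma iter_rot n z : rot_dom z -> rot_dom (iter n (pz lam) z) /\ iter n (pz lam) z = g (lam ^+ n * f z).
Proof.
move=> Vz; suff [h1 h2] : rot_dom (iter n (pz lam) z) /\ f (iter n (pz lam) z) = lam ^+ n * f z.
  by split=> //; rewrite -h2; have [_ ->] := f_dom h1.
elim: n => [|n [IH1 IH2]]; first by rewrite expr0 mul1r.
rewrite iterS; split; first exact: rot_dom_stable.
by have [_ _ ->] := f_dom IH1; rewrite IH2 exprS mulrA.
Qed.

Lemma f_neq0 z : Om_proj z -> f z != 0.
Proof.
move=> Vz; apply: contraNneq (Om_proj_neq0 Vz) => fz.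
have [|_ <- _] := @f_dom z; first by right.
by rewrite fz -{1}f_0; have [_ -> _] := f_dom rot_dom0.
Qed.

Lemma g_Om_proj xi : modc xi < 1 -> xi != 0 -> Om_proj (g xi).
Proof.
move=> x1 xn; have [Vg fg] := g_disk x1; apply: (rot_dom_proj Vg).
by apply: contraNneq xn => g0; rewrite -fg g0 f_0.
Qed.

Lemma Om_proj_fst x : O x -> Om_proj x.1.
Proof. by move=> Ox; exists x.2; case: x Ox. Qed.

(** In the coordinate [f] the first component of the orbit is [lam ^+ k j * f x.1]. *)
Lemma limit_value x (k : nat -> nat) (l : R[i]) (h : P2 C -> P2 C) : O x ->
  {homo k : i j / (i < j)%N} -> modc l = 1 -> tends ultra_nat (fun j => lam ^+ k j) l ->
  {family compactly_in Om, (fun j => iter (k j) F) @ \oo --> h} ->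
  h (E x) = E (g (l * f x.1), 0).
Proof.
move=> Ox hk l1 hl hcv; apply: cclose_eq => e e0.
have e2 : 0 < e / 2 by lra.
have Vx := Om_proj_fst Ox; have VVx : rot_dom x.1 by right.
have [fx1 _ _] := f_dom VVx.
have lf1 : modc (l * f x.1) < 1 by rewrite modcM l1 mul1r.
have [d d0 hd] := E_cont (g (l * f x.1), 0) e2.
have [r r0 gr] := g_hol lf1.
have [d' d'0 hd'] := approx_cont r0 gr d0.
have [s s0 ws] := Om_wzero Ox.
have [N hN] := ws _ d0.
have cpt : compact ([set E x] : set (P2 C)) by exact: compact_set1.
have [|N' hN'] := (family_cvgP Om (fun j => iter (k j) F) h).1 hcv [set E x] cpt _ _ e2.
  by move=> _ ->.
have G1 := hl _ d'0.
have G2 : ultra_nat [set j | (maxn N N' <= j)%N] by apply: (@ultra_nat_ge (maxn N N')).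
have [j /= [j1]] := ultra_meet G1 G2.
rewrite geq_max => /andP[jN jN'].
have := hN' j jN' (E x) (erefl _); rewrite iter_F_E => h1.
rewrite (splitr e); apply: (cclose_trans h1); apply: cclose_sym; apply: hd; split => /=.
  rewrite iter_skew1 (iter_rot _ VVx).2.
  have -> : lam ^+ k j * f x.1 = l * f x.1 + (lam ^+ k j - l) * f x.1 by ring.
  apply: hd'; rewrite modcM; apply: le_trans j1.
  by rewrite ler_piMr ?modc_ge0 // ltW.
rewrite subr0; apply: hN; first exact: leq_trans jN (homo_ge hk j).
exact: polydisc_center (ltW s0).
Qed.

(** The rotation by [l] maps the punctured disc onto itself, so the image of the
    limit map does not depend on [l]. *)
Lemma limit_set_disk : is_limit_set F Om D.
Proof.
move=> k h hk hcv.
have kb : ultra_nat [set j | modc (lam ^+ k j) <= 1].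
  by apply: (@ultra_nat_ge 0) => j _ /=; rewrite (lamX_mod lam_mod).
have [l hl] := ultra_cvg kb.
have l1 : modc l = 1.
  apply/eqP; rewrite -subr_eq0 -normr_eq0 eq_le normr_ge0 andbT.
  apply/ler_addgt0Pl => e e0; rewrite addr0.
  have [j [/= hj _]] := ultra_meet (hl _ e0) (hl _ e0).
  apply: le_trans hj; rewrite -(lamX_mod lam_mod (k j)) modcB; exact: modc_dist.
apply/seteqP; split=> [_ [p Omp <-]|_ [z Vz <-]].
  have [x _ px] := Om_Kset lam_mod base_Fatou base_Kset Omp; move: Omp; rewrite -px => Ox.
  rewrite (limit_value Ox hk l1 hl hcv).
  exists (g (l * f x.1)) => //; have Vx := Om_proj_fst Ox.
  have [|fx1 _ _] := @f_dom x.1; first by right.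
  apply: g_Om_proj; first by rewrite modcM l1 mul1r.
  by rewrite mulf_neq0 ?f_neq0 // -modc_gt0 l1.
have VVz : rot_dom z by right.
have [fz1 gfz _] := f_dom VVz.
have l0 : l != 0 by rewrite -modc_gt0 l1.
have m1 : modc (l^-1 * f z) < 1 by rewrite modcM modcV l1 invr1 mul1r.
have [w Ow] : Om_proj (g (l^-1 * f z)) by apply: g_Om_proj => //; rewrite mulf_neq0 ?invr_neq0 ?f_neq0.
exists (E (g (l^-1 * f z), w)) => //.
rewrite (limit_value Ow hk l1 hl hcv) /=.
by have [_ ->] := g_disk m1; rewrite mulVKf // gfz.
Qed.

(** When [lam ^+ n] is close to 1 and [n] is large, the orbit of a point of [Om] above
    [z] returns close to [(z, 0)]. *)
Lemma disk_boundary : D `<=` closure Om `\` interior Om.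
Proof.
move=> _ [z Vz <-]; split; last by move=> /interior_subset /Om_not_axis.
have VVz : rot_dom z by right.
move=> B /P2_nbhsP [e e0 orb_q'].
have [d d0 hd] := E_cont (z, 0) e0.
have [fz1 gfz _] := f_dom VVz.
have [r r0 gr] := g_hol fz1.
have [d' d'0 hd'] := approx_cont r0 gr d0.
have [w Ow] := Vz.
have [s s0 ws] := Om_wzero Ow.
have [N hN] := ws _ d0.
have lN : modc (lam ^- N) = 1 by rewrite modcV (lamX_mod lam_mod) invr1.
have [m hm] := lam_dense lam_mod lam_irr lN d'0.
have lmN : modc (lam ^+ (m + N) - 1) <= d'.
  suff -> : lam ^+ (m + N) - 1 = (lam ^+ m - lam ^- N) * lam ^+ N.
    by rewrite modcM (lamX_mod lam_mod) mulr1.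
  rewrite exprD mulrBl mulVf //; by rewrite -modc_gt0 (lamX_mod lam_mod).
have Oi n : O (iter n Fc (z, w)).
  elim: n => //= n IH; exact: (Om_Fc lam_mod base_Fatou base_Kset Om_Fbase IH).
exists (E (iter (m + N) Fc (z, w))); split; first exact: Oi.
apply: orb_q'; apply: hd; split => /=.
  rewrite iter_skew1 (iter_rot _ VVz).2 -[X in _ - X]gfz.
  have -> : lam ^+ (m + N) * f z = f z + (lam ^+ (m + N) - 1) * f z by ring.
  apply: hd'; rewrite modcM; apply: le_trans lmN.
  by rewrite ler_piMr ?modc_ge0 // ltW.
rewrite subr0; apply: hN; first exact: leq_addl.
exact: polydisc_center (ltW s0).
Qed.

Lemma punctured_unit_diskE (xi : C) : punctured_unit_disk xi <-> xi != 0 /\ modc xi < 1.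
Proof.
rewrite /punctured_unit_disk /= normr_gt0 modcE -(rmorph1 (real_complex R)) ltcR.
by split=> [/andP[]|[-> ->]].
Qed.

Lemma disk_param_image : disk_param @` @punctured_unit_disk C = D.
Proof.
apply/seteqP; split=> [_ [xi /punctured_unit_diskE [xn x1] <-]|_ [z Vz <-]].
  by exists (g xi) => //; exact: g_Om_proj.
have [|fz1 gfz _] := @f_dom z; first by right.
exists (f z); last by rewrite /disk_param gfz.
by apply/punctured_unit_diskE; rewrite f_neq0.
Qed.

Lemma disk_param_immersed (xi : C) : modc xi < 1 -> immersive_at disk_param xi.
Proof.
move=> x1; exists (fun w : C => vec (g w, 0)); split.
  have rx : 0 < (1 - modc xi) / 2 by rewrite divr_gt0 // subr_gt0.
  apply/nbhs_modcP; exists ((1 - modc xi) / 2) => // w hw.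
  have w1 : modc w < 1.
    have := modcD (w - xi) xi; rewrite subrK; lra.
  have [r r0 gr] := g_hol w1.
  have [c [K K0 hK]] := approx_quadratic lam_mod lam_irr r0 gr.
  have r4 : 0 < r / 4 by lra.
  split; first exact: (vec_derive r4 K0 hK).1.
  by exists (vec_neq0 (g w, 0)).
have [r r0 gr] := g_hol x1; have [Vg fg] := g_disk x1.
have [s s0 fs] := f_hol Vg.
have [|c [K [c0 K0] hK]] := left_inverse_immersed lam_mod lam_irr r0 gr s0 fs.
  exists ((1 - modc xi) / 2); first by rewrite divr_gt0 // subr_gt0.
  move=> x hx; apply: (g_disk _).2; have := modcD xi x; lra.
have r4 : 0 < r / 4 by lra.
by rewrite (vec_derive r4 K0 hK).2; exact: vec_rank.
Qed.

Lemma disk_param_open (U : set C) : open U -> U `<=` @punctured_unit_disk C ->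
  exists2 W, open W & disk_param @` U = W `&` disk_param @` @punctured_unit_disk C.
Proof.
move=> oU sU; exists (@E R @` [set x | rot_dom x.1 /\ U (f x.1)]).
  apply: open_image => a [Va Ua].
  have [r r0 hr] := rot_dom_open Va.
  have [s s0 fs] := f_hol Va.
  have /nbhs_modcP [d d0 hd] : nbhs (f a.1 : C) U by exact: open_nbhs_nbhs.
  have [d' d'0 hd'] := approx_cont s0 fs d0.
  exists (Num.min r d'); first by rewrite lt_min r0.
  move=> x [hx _]; move: hx; rewrite le_min => /andP[xr xd].
  have ax : a.1 + (x.1 - a.1) = x.1 by rewrite addrC subrK.
  have := hr _ xr; have := hd' _ xd; rewrite ax => h1 h2.
  by split => //; exact: hd.
apply/seteqP; split=> [_ [xi Uxi <-]|_ [[x [Vx Ux] <-] [xi /punctured_unit_diskE [_ x1] /E_inj e]]].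
  have /punctured_unit_diskE [xn x1] := sU _ Uxi.
  split; last by exists xi => //; exact: sU.
  by have [Vg fg] := g_disk x1; exists (g xi, 0) => //=; rewrite fg.
by exists xi; [have [_ <-] := g_disk x1; move: Ux; rewrite -e|rewrite /disk_param e].
Qed.

Lemma disk_param_embedding : parametrizes_punctured_disk disk_param D.
Proof.
split; last exact: disk_param_image.
split=> [xi /punctured_unit_diskE [_]|xi xi'|].
- exact: disk_param_immersed.
- rewrite !inE => /punctured_unit_diskE [_ x1] /punctured_unit_diskE [_ x1'] /E_inj [e].
  by rewrite -(g_disk x1).2 e (g_disk x1').2.
- exact: disk_param_open.
Qed.

Lemma F_disk_param xi : modc xi < 1 -> F (disk_param xi) = disk_param (lam * xi).
Proof.
move=> x1; rewrite F_E; congr E.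
have [Vg fg] := g_disk x1; have [_ gf] := iter_rot 1 Vg.
by rewrite [LHS]surjective_pairing /= [pz lam _]gf fg expr1 -[LHS]/(_, (iter 1 Fc (g xi, 0)).2) iter_skew20.
Qed.

Lemma F_disk : F @` D `<=` D.
Proof.
move=> _ [_ [z Vz <-] <-]; exists (pz lam z); first exact: Om_proj_stable.
by rewrite F_E [in RHS]/(Fc) /= -[qw _ _ _]/((iter 1 Fc (z, 0)).2) iter_skew20.
Qed.

End RotationDisk.

End MainComponent.

Local Close Scope complex_scope.

Theorem theorem7 (R : realType) (theta : R)
    (theta_irr : irrational theta)
    (lin1 : linearizable
      (fun z : R[i] => expi2pi theta * z + z ^+ 3) (expi2pi theta))
    (lin2 : linearizable
      (fun w : R[i] => (expi2pi theta)^-1 * w + w ^+ 3) (expi2pi theta)^-1) :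
  let F : P2 R[i] -> P2 R[i] := Fmap (expi2pi theta) in
  exists (Om D : set (P2 R[i])),
    [/\ Fatou_component F Om /\ F @` Om = Om,
        is_limit_set F Om D,
        embedded_punctured_disk D,
        D `<=` closure Om `\` interior Om &
        acts_as_irrational_rotation F D].
Proof.
move=> F.
have lam_mod := expi2pi_mod theta.
have lam_irr := expi2pi_irr theta_irr.
have stable_p : stable (pz (expi2pi theta)) := cubic_stable lam_mod lin1.
have stable_q : stable (qw (expi2pi theta) 0).
  have -> : qw (expi2pi theta) 0 = (fun w => (expi2pi theta)^-1 * w + w ^+ 3).
    by apply/funext => w; rewrite /qw mul0r addr0.
  exact: cubic_stable (lamV_mod lam_mod) lin2.
have [rb [rb0 rb20 orb_p orb_q]] := near_origin lam_mod lam_irr stable_p stable_q.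
have [f [g [f0 fV gD fA gA]]] := rotation_unit_disk lam_mod lam_irr rb0 rb20 orb_p orb_q.
have Fx0 := base_Fatou lam_mod rb0 rb20 orb_p orb_q.
have param := disk_param_embedding lam_mod lam_irr stable_q rb0 rb20 orb_p orb_q f0 fV gD fA gA.
exists (connected_component (Fatou_set F) (E (base_pt rb))), (rotation_disk (expi2pi theta) rb).
split.
- split; first by exists (E (base_pt rb)).
  exact: (F_Om lam_mod Fx0 (base_Kset rb0 orb_p orb_q) (Om_Fbase lam_mod rb0 rb20 orb_p orb_q)).
- exact: (limit_set_disk lam_mod lam_irr stable_q rb0 rb20 orb_p orb_q f0 fV gD gA).
- by exists (disk_param g).
- have := disk_boundary lam_mod lam_irr rb0 rb20 orb_p orb_q fV gA. exact.
- split; first exact: (F_disk lam_mod rb0 rb20 orb_p orb_q).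
  exists (disk_param g), theta; split=> // xi /punctured_unit_diskE [_ x1].
  exact: (F_disk_param lam_mod rb0 rb20 orb_p orb_q fV gD x1).
Qed.
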